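(* Let $d\ge1$, let $a_1,a_2,b_1,b_2>0$, and put $\mathbf{a}=(a_1,a_2)$, $|\mathbf{a}|=a_1+a_2$, $\mathbf{b}=(b_1,b_2)$, $|\mathbf{b}|=b_1+b_2$. Let $\mathbf{k}=(k_1,\dots,k_d)$, $\mathbf{l}=(l_1,\dots,l_d)\in\mathbb{N}_0^d$ and let $n,m$ be integers with $n\ge|\mathbf{k}|$, $m\ge|\mathbf{l}|$. Define $$A^{(d+1)}_{n,\mathbf{k}}(t,\boldsymbol{x};a_1,a_2,b_1,b_2)={}_2F_1\!\left(\begin{matrix}-n+|\mathbf{k}|,\ b_1+|\mathbf{k}|-t\\ 2|\mathbf{k}|+|\mathbf{b}|\end{matrix}\,\Big|\,2\right)(b_1-t)_{|\mathbf{k}|}$$ $$\times\prod_{j=1}^d\left\{\Gamma\!\left(a_1+\tfrac{|\mathbf{k}^{j+1}|-x_j}{2}+\tfrac{d-j}{4}\right)\Gamma\!\left(a_1+\tfrac{|\mathbf{k}^{j+1}|+x_j}{2}+\tfrac{d-j}{4}\right)\right.$$ $$\left.\times\,{}_3F_2\!\left(\begin{matrix}-k_j,\ k_j+2\left(|\mathbf{k}^{j+1}|+|\mathbf{a}|+\frac{d-j-1}{2}\right),\ a_1+\frac{|\mathbf{k}^{j+1}|+x_j}{2}+\frac{d-j}{4}\\ |\mathbf{k}^{j+1}|+|\mathbf{a}|+\frac{d-j}{2},\ |\mathbf{k}^{j+1}|+2a_1+\frac{d-j}{2}\end{matrix}\,\Big|\,1\right)\right\},$$ or, in terms of continuous Hahn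 polynomials $p_k$, $$A^{(d+1)}_{n,\mathbf{k}}(t,\boldsymbol{x};a_1,a_2,b_1,b_2)={}_2F_1\!\left(\begin{matrix}-n+|\mathbf{k}|,\ b_1+|\mathbf{k}|-t\\ 2|\mathbf{k}|+|\mathbf{b}|\end{matrix}\,\Big|\,2\right)(b_1-t)_{|\mathbf{k}|}$$ $$\times\prod_{j=1}^d\left\{\frac{k_j!\,i^{-k_j}}{\left(|\mathbf{k}^{j+1}|+2a_1+\frac{d-j}{2}\right)_{k_j}\left(|\mathbf{k}^{j+1}|+|\mathbf{a}|+\frac{d-j}{2}\right)_{k_j}}\;p_{k_j}\!\left(-\tfrac{ix_j}{2};\,\alpha_j,\,\alpha_j',\,\alpha_j',\,\alpha_j\right)\right.$$ $$\left.\times\,\Gamma\!\left(a_1+\tfrac{|\mathbf{k}^{j+1}|-x_j}{2}+\tfrac{d-j}{4}\right)\Gamma\!\left(a_1+\tfrac{|\mathbf{k}^{j+1}|+x_j}{2}+\tfrac{d-j}{4}\right)\right\},$$ where $\alpha_j=a_1+\frac{|\mathbf{k}^{j+1}|}{2}+\frac{d-j}{4}$ and $\alpha_j'=a_2+\frac{|\mathbf{k}^{j+1}|}{2}+\frac{d-j}{4}$. Then $$\int_{-\infty}^{\infty}\!\!\cdots\int_{-\infty}^{\infty}\Gamma(b_1-it)\,\Gamma(b_2+it)\,A^{(d+1)}_{n,\mathbf{k}}(it,i\boldsymbol{x};a_1,a_2,b_1,b_2)\,A^{(d+1)}_{m,\mathbf{l}}(-it,-i\boldsymbol{x};a_2,a_1,b_2,b_1)\,d\boldsymbol{x}\,dt$$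 $$=(2\pi)^{d+1}\,2^{-2d|\mathbf{a}|-2|\mathbf{k}|-|\mathbf{b}|+d+1}\;h_{\mathbf{k}}^{(a_1+a_2-\frac12)}\;\frac{\Gamma(|\mathbf{b}|+n+|\mathbf{k}|)\,(n-|\mathbf{k}|)!}{\left((2|\mathbf{k}|+|\mathbf{b}|)_{n-|\mathbf{k}|}\right)^2}\,\delta_{n,m}$$ $$\times\prod_{j=1}^{d}\frac{(k_j!)^2\,\Gamma\!\left(|\mathbf{k}^{j+1}|+2a_1+\frac{d-j}{2}\right)\Gamma\!\left(|\mathbf{k}^{j+1}|+2a_2+\frac{d-j}{2}\right)}{2^{2|\mathbf{k}^{j+1}|}\left((2|\mathbf{k}^{j+1}|+2|\mathbf{a}|+d-j-1)_{k_j}\right)^2}\,\delta_{k_j,l_j}.$$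
   Context: Notation: $\mathbb{N}_0=\{0,1,2,\dots\}$; $|\mathbf{k}|=k_1+\cdots+k_d$; $\mathbf{k}^{j}=(k_j,\dots,k_d)$ and $|\mathbf{k}^{j}|=k_j+\cdots+k_d$ for $1\le j\le d$, and $|\mathbf{k}^{d+1}|=0$ (similarly for $\mathbf{l}$). $\boldsymbol{x}=(x_1,\dots,x_d)$, $i\boldsymbol{x}=(ix_1,\dots,ix_d)$ with $i$ the imaginary unit; the integral is over $(t,\boldsymbol{x})\in\mathbb{R}^{d+1}$. The function $A^{(d+1)}_{m,\mathbf{l}}(\cdot,\cdot;a_2,a_1,b_2,b_1)$ is the same expression with $(n,\mathbf{k})$ replaced by $(m,\mathbf{l})$ and with $a_1\leftrightarrow a_2$, $b_1\leftrightarrow b_2$ interchanged. $\delta$ is the Kronecker delta and $\Gamma$ the Gamma function. Pochhammer symbol: $(\alpha)_0=1$, $(\alpha)_n=\alpha(\alpha+1)\cdots(\alpha+n-1)$ for $n\ge1$. Hypergeometric function: ${}_pF_q\!\left(\begin{matrix}a_1,\dots,a_p\\ b_1,\dots,b_q\end{matrix}\Big|x\right)=\sum_{n\ge0}\frac{(a_1)_n\cdots(a_p)_n}{(b_1)_n\cdots(b_q)_n}\frac{x^n}{n!}$. The constant $h_{\mathbf{k}}^{(\mu)}$ (the squared norm of a product-type orthogonal polynomial on the unit ball of $\mathbb{R}^d$ for the weight $(1-\|\boldsymbol{x}\|^2)^{\mu-1/2}$) is $$h_{\mathbf{k}}^{(\mu)}=\frac{\pi^{d/2}\,\Gamma(\mu+\frac12)\,(\mu+\frac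 d2)_{|\mathbf{k}|}}{\Gamma(\mu+\frac{d+1}{2}+|\mathbf{k}|)}\prod_{j=1}^{d}\frac{(\mu+\frac{d-j}{2})_{|\mathbf{k}^j|}\,(2\mu+2|\mathbf{k}^{j+1}|+d-j)_{k_j}}{k_j!\,(\mu+\frac{d-j+1}{2})_{|\mathbf{k}^j|}}.$$ Continuous Hahn polynomials, with parameters $A,B,C,D$: $$p_k(x;A,B,C,D)=i^k\frac{(A+C)_k(A+D)_k}{k!}\,{}_3F_2\!\left(\begin{matrix}-k,\ k+A+B+C+D-1,\ A+ix\\ A+C,\ A+D\end{matrix}\Big|1\right).$$
   Formalization: The exponent d+1 of 2 is corrected to d+1-binom(d-1,2), since the printed identity fails for d≥3 (already at k=l=0, n=m=0); the case |a|=1/2, k_d>0, n=m, k=l, where the printed right side is 0/0, is excluded. *)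

(* Defs.v *)
From HB Require Import structures.
From mathcomp Require Import all_boot all_order all_algebra.
From mathcomp Require Import all_classical all_reals all_analysis.
From mathcomp Require Import complex.
Set Implicit Arguments.
Unset Strict Implicit.
Unset Printing Implicit Defensive.
Import Order.TTheory GRing.Theory Num.Theory.
Import numFieldNormedType.Exports.
Local Open Scope classical_set_scope.
Local Open Scope complex_scope.
Local Open Scope ring_scope.

Section lebesgue_tuple.
Context {R : realType}.
Local Notation mR := (measurableTypeR R).

Definition tcons n (p : mR * n.-tuple mR) : n.+1.-tuple mR :=
  [tuple of p.1 :: p.2].

Definition tuncons n (u : n.+1.-tuple mR) : mR * n.-tuple mR :=
  (thead u, [tuple of behead u]).

Lemma measurable_tcons n : measurable_fun setT (@tcons n).
Proof. exact: measurable_cons. Qed.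

Lemma measurable_tuncons n : measurable_fun setT (@tuncons n).
Proof.
by apply/measurable_fun_pairP; split;
  [exact: measurable_tnth | exact: measurable_behead].
Qed.

Lemma tconsK n : cancel (@tcons n) (@tuncons n).
Proof. by case=> x v; congr (_, _); apply/val_inj. Qed.

Definition lebesgue_line : {sigma_finite_measure set mR -> \bar R} :=
  @lebesgue_measure R.

Section tcons_measure.
Variable n : nat.
Variable m : {sigma_finite_measure set (n.-tuple mR) -> \bar R}.

Definition tcons_measure : set (n.+1.-tuple mR) -> \bar R :=
  pushforward (lebesgue_line \x m)%E (@tcons n).

Let tcons_measure0 : tcons_measure set0 = 0%E.
Proof. by apply: measure0; exact: measurable_tcons. Qed.

Let tcons_measure_ge0 A : (0 <= tcons_measure A)%E.
Proof. by apply: measure_ge0; exact: measurable_tcons. Qed.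

Let tcons_measure_sigma_additive : semi_sigma_additive tcons_measure.
Proof.
by apply: measure_semi_sigma_additive; exact: measurable_tcons.
Qed.

HB.instance Definition _ := isMeasure.Build _ _ _ tcons_measure
  tcons_measure0 tcons_measure_ge0 tcons_measure_sigma_additive.

Let tcons_measure_sigma_finite : sigma_finite setT tcons_measure.
Proof.
have /sigma_finiteP[F [FT ndF mF]] := sigma_finiteT lebesgue_line.
have /sigma_finiteP[G [GT ndG mG]] := sigma_finiteT m.
exists (fun i => @tuncons n @^-1` (F i `*` G i)).
  rewrite -preimage_bigcup [X in _ @^-1` X](_ : _ = setT) ?preimage_setT//.
  rewrite -subTset => -[x v] _.
  have [i _ Fx] : (\bigcup_i F i) x by rewrite -FT.
  have [j _ Gv] : (\bigcup_i G i) v by rewrite -GT.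
  exists (maxn i j) => //; split => /=.
    by move: Fx; exact/subsetPset/ndF/leq_maxl.
  by move: Gv; exact/subsetPset/ndG/leq_maxr.
move=> i; have [mFi Foo] := mF i; have [mGi Goo] := mG i; split.
  rewrite -[X in measurable X]setTI.
  by apply: measurable_tuncons => //; exact: measurableX.
rewrite /tcons_measure /pushforward -comp_preimage.
rewrite (_ : _ \o _ = id); last by apply/funext => x; exact: tconsK.
by rewrite preimage_id product_measure1E// lte_mul_pinfty// ge0_fin_numE.
Qed.

HB.instance Definition _ := Measure_isSigmaFinite.Build _ _ _ tcons_measure
  tcons_measure_sigma_finite.

End tcons_measure.

(* Lebesgue measure on R^n: the n-fold product of the Lebesgue measure on R,
   transported along R * R^n.-1 -> R^n, (x, v) |-> x :: v. *)
Fixpoint lebesgue_tuple (n : nat) :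
    {sigma_finite_measure set (n.-tuple mR) -> \bar R} :=
  if n is n'.+1 return {sigma_finite_measure set (n.-tuple mR) -> \bar R} then
    tcons_measure (lebesgue_tuple n')
  else \d_ ([tuple] : 0.-tuple mR).

End lebesgue_tuple.
Arguments lebesgue_tuple R n : clear implicits.

Section complex_functions.
Context {R : realType}.
Local Notation C := R[i].

Section integral.
Context d {T : measurableType d}.
Variable mu : {measure set T -> \bar R}.

Definition cintegrable (D : set T) (f : T -> C) : Prop :=
  mu.-integrable D (fun x => (complex.Re (f x))%:E) /\
  mu.-integrable D (fun x => (complex.Im (f x))%:E).

Definition cintegral (D : set T) (f : T -> C) : C :=
  (\int[mu]_(x in D) complex.Re (f x)) +i* (\int[mu]_(x in D) complex.Im (f x)).

End integral.

(* s ^ z = exp (z ln s), meaningful for s > 0 *)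
Definition cpowR (s : R) (z : C) : C :=
  (expR (complex.Re z * ln s) * cos (complex.Im z * ln s)) +i*
  (expR (complex.Re z * ln s) * sin (complex.Im z * ln s)).

(* Euler's integral, which is the Gamma function on the half-plane 0 < Re z *)
Definition Gamma (z : C) : C :=
  cintegral (@lebesgue_measure R) `]0, +oo[
    (fun s : R => (expR (- s))%:C * cpowR s (z - 1)).

Definition poch (a : C) (n : nat) : C := \prod_(i < n) (a + i%:R).

(* [hypergeom [:: a_1; ..; a_p] [:: b_1; ..; b_q] x] is pFq. The series is
   taken in the alias C^o, which carries the topology of the modulus. *)
Definition hypergeom (a b : seq C) (x : C) : C :=
  limn (series (fun n : nat =>
    (\prod_(z <- a) poch z n) / (\prod_(z <- b) poch z n)
      * (x ^+ n / n`!%:R) : C^o)).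

Definition cont_hahn (k : nat) (x A B c D : C) : C :=
  'i%C ^+ k * (poch (A + c) k * poch (A + D) k / k`!%:R) *
  hypergeom [:: - k%:R; k%:R + A + B + c + D - 1; A + 'i%C * x]
            [:: A + c; A + D] 1.

End complex_functions.

(* |k^j|. Components are numbered from 0 here, so that the j-th component of k
   (1 <= j <= d) is [k i] with i = j - 1, and then |k^j| is [tailsum k i],
   |k^{j+1}| is [tailsum k i.+1] and d - j is [d - i.+1]. *)
Definition tailsum (d : nat) (k : 'I_d -> nat) (j : nat) : nat :=
  \sum_(i < d | (j <= i)%N) k i.

Definition wt (d : nat) (k : 'I_d -> nat) : nat := \sum_(i < d) k i.

Section Afun.
Context {R : realType}.
Local Notation C := R[i].

Definition ball_norm (d : nat) (k : 'I_d -> nat) (mu : C) : C :=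
  (pi `^ (d%:R / 2) : R)%:C * Gamma (mu + 2^-1) * poch (mu + d%:R / 2) (wt k)
    / Gamma (mu + d.+1%:R / 2 + (wt k)%:R) *
  \prod_(j < d)
    (poch (mu + (d - j.+1)%:R / 2) (tailsum k j) *
     poch (2 * mu + 2 * (tailsum k j.+1)%:R + (d - j.+1)%:R) (k j) /
     ((k j)`!%:R * poch (mu + (d - j.+1).+1%:R / 2) (tailsum k j))).

Definition Afun_t (d n : nat) (k : 'I_d -> nat) (t b1 b2 : C) : C :=
  hypergeom [:: - n%:R + (wt k)%:R; b1 + (wt k)%:R - t]
            [:: 2 * (wt k)%:R + (b1 + b2)] 2 *
  poch (b1 - t) (wt k).

Definition Afun (d n : nat) (k : 'I_d -> nat) (t : C) (x : 'I_d -> C)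
    (a1 a2 b1 b2 : C) : C :=
  Afun_t n k t b1 b2 *
  \prod_(j < d)
    let K : C := (tailsum k j.+1)%:R in
    let e : C := (d - j.+1)%:R in
    Gamma (a1 + (K - x j) / 2 + e / 4) *
    Gamma (a1 + (K + x j) / 2 + e / 4) *
    hypergeom [:: - (k j)%:R;
                  (k j)%:R + 2 * (K + (a1 + a2) + (e - 1) / 2);
                  a1 + (K + x j) / 2 + e / 4]
              [:: K + (a1 + a2) + e / 2; K + 2 * a1 + e / 2] 1.

Definition Afun_hahn (d n : nat) (k : 'I_d -> nat) (t : C) (x : 'I_d -> C)
    (a1 a2 b1 b2 : C) : C :=
  Afun_t n k t b1 b2 *
  \prod_(j < d)
    let K : C := (tailsum k j.+1)%:R in
    let e : C := (d - j.+1)%:R in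
    let alpha := a1 + K / 2 + e / 4 in
    let alpha' := a2 + K / 2 + e / 4 in
    (k j)`!%:R * 'i%C ^- k j /
      (poch (K + 2 * a1 + e / 2) (k j) * poch (K + (a1 + a2) + e / 2) (k j)) *
    cont_hahn (k j) (- ('i%C * x j / 2)) alpha alpha' alpha' alpha *
    (Gamma (a1 + (K - x j) / 2 + e / 4) * Gamma (a1 + (K + x j) / 2 + e / 4)).

Definition integrand (d n m : nat) (k l : 'I_d -> nat) (a1 a2 b1 b2 : C)
    (p : measurableTypeR R * d.-tuple (measurableTypeR R)) : C :=
  let t : C := 'i%C * (p.1 : R)%:C in
  let x (j : 'I_d) : C := 'i%C * (tnth p.2 j : R)%:C in
  Gamma (b1 - t) * Gamma (b2 + t) *
  Afun n k t x a1 a2 b1 b2 *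
  Afun m l (- t) (fun j => - x j) a2 a1 b2 b1.

(* 2 |k^{j+1}| + 2 |a| + d - j - 1, whose k_j-th Pochhammer symbol is squared in
   the denominator of the norm. For |a| > 0 that symbol vanishes only at the last
   index, where the base is 2 |a| - 1, and only if |a| = 1/2 and k_d > 0; the
   norm is then an undefined expression 0 / 0. *)
Definition norm_base (d : nat) (k : 'I_d -> nat) (a : C) (j : 'I_d) : C :=
  2 * (tailsum k j.+1)%:R + 2 * a + (d - j.+1)%:R - 1.

(* The exponent of 2 in the norm. By the orthogonality of the continuous Hahn
   polynomials the x_j-integral contributes the factor
     2 ^ (2 - 2 (|a| + |k^{j+1}| + (d - j) / 2)),   1 <= j <= d,
   next to 2 pi and the norm of a Gegenbauer polynomial. With the factor
   2 ^ (- |b| - 2 |k|) of the t-integral, and 2 ^ (- 2 |k^{j+1}|) kept apart, this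
   gives - 2 d |a| - 2 |k| - |b| + 2 d - d (d - 1) / 2, where
   2 d - d (d - 1) / 2 = d + 1 - 'C(d - 1, 2). The published formula is printed with
   d + 1 only, which is the same for d <= 2 but wrong for d >= 3. *)
Definition exponent2 (d K : nat) (a b : R) : R :=
  - (2 * d%:R * a) - 2 * K%:R - b + d%:R + 1 - 'C(d.-1, 2)%:R.

End Afun.

(* Main.v *)
Require Import Defs.
From HB Require Import structures.
From mathcomp Require Import all_boot all_order all_algebra.
From mathcomp Require Import all_classical all_reals all_analysis.
From mathcomp Require Import complex measurable_realfun.
From mathcomp Require Import ring lra.
Import Order.TTheory GRing.Theory Num.Theory.
Import numFieldNormedType.Exports.
Local Open Scope classical_set_scope.
Local Open Scope complex_scope.
Import ComplexField.Normc.
Local Open Scope ring_scope.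
Set Implicit Arguments.
Unset Strict Implicit.
Unset Printing Implicit Defensive.

(** At purely imaginary arguments the integrand is a product of d + 1 functions
    of one real variable each: the factor in t involves two Meixner-Pollaczek
    polynomials, the factor in x_j two continuous Hahn polynomials in x_j / 2
    (integrandE). By Fubini's theorem the integral is a product of
    one-dimensional integrals (value_factors).

    The analytic input is that, on a vertical line in the right half-plane, the
    Gamma function is the Fourier transform of y |-> exp (p y - exp y)
    (Gamma_fourier), and that Gamma (p + i x) Gamma (q - i x) is a multiple of the
    transform of a Beta density (Gamma_mul_fourier). With Parseval's formula,
    obtained by Abel summation, these give the integral of
    Gamma (p + i x) Gamma (q - i x) and Barnes's first lemma
    (cintegral_GammaGamma, cintegral_barnes).

    A terminating hypergeometric series multiplied by its Gamma factor is a finite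
    combination of Gamma functions with shifted arguments. Hence each
    one-dimensional integral is a double sum whose kernel depends on the sum of
    the two summation indices: it is (B)_(r+q) for t, the moments of a Laguerre
    weight, and (s)_(r+q) / (2 s)_(r+q) for x_j, the moments of a Gegenbauer
    weight shifted to the unit interval. An alternating binomial sum of a
    polynomial of low degree vanishes, which makes these Gram sums diagonal
    (gram_laguerre, gram_jacobi).

    The parameters of the Hahn polynomials in x_j depend on the later components
    of the multi-indices only. So if k and l differ, the integral in x_j vanishes
    for the last j with k_j different from l_j (prod_cintegral_x_factor0). If they
    agree, Legendre's duplication formula turns the norm of the j-th Hahn
    polynomial into a quotient of consecutive terms of a sequence of Gamma values
    times factors that occur in the closed formula as well (hahn_norm_eval,
    x_factor_eval). Both this product
    and the product in the norm on the ball telescope, and what remains is the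
    same on the two sides. *)

(** * Complex-valued integrals and Fubini's theorem *)

Section complex_parts.
Context {R : realType}.
Implicit Types x y : R[i].

Lemma ReD x y : complex.Re (x + y) = complex.Re x + complex.Re y.
Proof. by case: x; case: y. Qed.
Lemma ImD x y : complex.Im (x + y) = complex.Im x + complex.Im y.
Proof. by case: x; case: y. Qed.
Lemma ReM x y : complex.Re (x * y) =
  complex.Re x * complex.Re y - complex.Im x * complex.Im y.
Proof. by case: x; case: y. Qed.
Lemma ImM x y : complex.Im (x * y) =
  complex.Re x * complex.Im y + complex.Im x * complex.Re y.
Proof. by case: x; case: y. Qed.

Lemma complex_eqP x y :
  complex.Re x = complex.Re y -> complex.Im x = complex.Im y -> x = y.
Proof. by case: x; case: y => ? ? ? ? /= -> ->. Qed.

Lemma normr_Re_le x : `|complex.Re x| <= normc x.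
Proof.
case: x => a b /=; rewrite -sqrtr_sqr ler_sqrt ?addr_ge0 ?sqr_ge0//.
by rewrite lerDl sqr_ge0.
Qed.

Lemma normr_Im_le x : `|complex.Im x| <= normc x.
Proof.
case: x => a b /=; rewrite -sqrtr_sqr ler_sqrt ?addr_ge0 ?sqr_ge0//.
by rewrite lerDr sqr_ge0.
Qed.

Lemma normc_ge0 x : 0 <= normc x.
Proof. by case: x => a b; exact: sqrtr_ge0. Qed.

Lemma normc_le1 x : normc x <= `|complex.Re x| + `|complex.Im x|.
Proof.
case: x => a b /=; rewrite -[leRHS]ger0_norm ?addr_ge0// -sqrtr_sqr.
rewrite ler_sqrt ?sqr_ge0// sqrrD !real_normK ?num_real//.
by rewrite lerD2r lerDl mulrn_wge0// mulr_ge0.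
Qed.

End complex_parts.

Section cintegral_theory.
Context {R : realType} d {T : measurableType d} (mu : {measure set T -> \bar R}).
Local Notation C := R[i].
Implicit Types f g : T -> C.

Definition cmeasurable f :=
  measurable_fun setT (fun x => complex.Re (f x)) /\
  measurable_fun setT (fun x => complex.Im (f x)).

Lemma cmeasurableM f g : cmeasurable f -> cmeasurable g ->
  cmeasurable (fun x => f x * g x).
Proof.
move=> [f1 f2] [g1 g2]; split.
  under eq_fun do rewrite ReM; apply: measurable_funB; exact: measurable_funM.
under eq_fun do rewrite ImM; apply: measurable_funD; exact: measurable_funM.
Qed.

Lemma cmeasurable_cst (c : C) : cmeasurable (fun=> c).
Proof. by split; exact: measurable_cst. Qed.

Lemma cintegrable_measurable f : cintegrable mu setT f -> cmeasurable f.
Proof.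
by move=> [/measurable_int/measurable_EFinP ? /measurable_int/measurable_EFinP ?].
Qed.

(** Complex integrability reduces to a real integrable majorant of the modulus. *)
Lemma cintegrable_le f (h : T -> R) : cmeasurable f ->
  mu.-integrable setT (EFin \o h) -> (forall x, normc (f x) <= h x) ->
  cintegrable mu setT f.
Proof.
move=> [f1 f2] ih fh; split.
  apply: (le_integrable _ _ _ ih) => //; first exact/measurable_EFinP.
  move=> x _ /=; rewrite lee_fin [leRHS]ger0_norm ?(le_trans (normc_ge0 _) (fh x))//.
  exact: le_trans (normr_Re_le _) (fh x).
apply: (le_integrable _ _ _ ih) => //; first exact/measurable_EFinP.
move=> x _ /=; rewrite lee_fin [leRHS]ger0_norm ?(le_trans (normc_ge0 _) (fh x))//.
exact: le_trans (normr_Im_le _) (fh x).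
Qed.

Lemma cintegrable_dom f : cintegrable mu setT f ->
  exists h : T -> R, [/\ mu.-integrable setT (EFin \o h),
    (forall x, 0 <= h x) & forall x, normc (f x) <= h x].
Proof.
move=> [f1 f2].
exists (fun x => `|complex.Re (f x)| + `|complex.Im (f x)|); split.
- have := integrableD measurableT (integrable_norm f1) (integrable_norm f2).
  by apply: eq_integrable => // x _ /=; rewrite EFinD.
- by move=> x; rewrite addr_ge0.
- by move=> x; exact: normc_le1.
Qed.

Lemma eq_cintegrable f g : f =1 g -> cintegrable mu setT f ->
  cintegrable mu setT g.
Proof. by move=> /funext ->. Qed.

Lemma eq_cintegral f g : f =1 g -> cintegral mu setT f = cintegral mu setT g.
Proof. by move=> /funext ->. Qed.

Lemma cintegrableD f g : cintegrable mu setT f -> cintegrable mu setT g ->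
  cintegrable mu setT (fun x => f x + g x).
Proof.
move=> [f1 f2] [g1 g2]; split.
  have := integrableD measurableT f1 g1.
  by apply: eq_integrable => // x _ /=; rewrite ReD EFinD.
have := integrableD measurableT f2 g2.
by apply: eq_integrable => // x _ /=; rewrite ImD EFinD.
Qed.

Lemma cintegralD f g : cintegrable mu setT f -> cintegrable mu setT g ->
  cintegral mu setT (fun x => f x + g x) =
  cintegral mu setT f + cintegral mu setT g.
Proof.
move=> [f1 f2] [g1 g2]; apply: complex_eqP.
  by rewrite ReD/= -RintegralD//; apply: eq_Rintegral => x _; rewrite ReD.
by rewrite ImD/= -RintegralD//; apply: eq_Rintegral => x _; rewrite ImD.
Qed.

Lemma cintegrable_bounded_mul f g (M : R) : cintegrable mu setT f ->
  cmeasurable g -> (forall x, normc (g x) <= M) ->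
  cintegrable mu setT (fun x => f x * g x).
Proof.
move=> fi mg gM; have [h [hi h0 fh]] := cintegrable_dom fi.
apply: (@cintegrable_le _ (fun x => M * h x)).
- exact/cmeasurableM/mg/cintegrable_measurable.
- have := integrableZl measurableT M hi.
  by apply: eq_integrable => // x _ /=; rewrite EFinM.
- by move=> x; rewrite normcM mulrC ler_pM ?normc_ge0.
Qed.

Lemma cintegrableZ (c : C) f : cintegrable mu setT f ->
  cintegrable mu setT (fun x => c * f x).
Proof.
move=> fi.
have := cintegrable_bounded_mul fi (cmeasurable_cst c) (fun=> lexx (normc c)).
by apply: eq_cintegrable => x; rewrite mulrC.
Qed.

Lemma cintegralZ (c : C) f : cintegrable mu setT f ->
  cintegral mu setT (fun x => c * f x) = c * cintegral mu setT f.
Proof.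
move=> [f1 f2].
have Zi (r : R) (h : T -> R) : mu.-integrable setT (EFin \o h) ->
    mu.-integrable setT (EFin \o (fun x => r * h x)).
  move=> /(integrableZl measurableT r).
  by apply: eq_integrable => // x _ /=; rewrite EFinM.
apply: complex_eqP.
  rewrite ReM/= -!RintegralZl// -RintegralB//; try exact: Zi.
  by apply: eq_Rintegral => x _; rewrite ReM.
rewrite ImM/= -!RintegralZl// -RintegralD//; try exact: Zi.
by apply: eq_Rintegral => x _; rewrite ImM.
Qed.

Lemma cintegrable0 : cintegrable mu setT (fun=> 0 : C).
Proof. by split; exact: integrable0. Qed.

Lemma cintegral0 : cintegral mu setT (fun=> 0 : C) = 0.
Proof. by apply: complex_eqP; rewrite /= /Rintegral integral0. Qed.

Lemma cintegrable_sum I (s : seq I) (F : I -> T -> C) :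
  (forall i, cintegrable mu setT (F i)) ->
  cintegrable mu setT (fun x => \sum_(i <- s) F i x).
Proof.
move=> Fi; elim: s => [|i s ih].
  by apply: eq_cintegrable cintegrable0 => x; rewrite big_nil.
by apply: eq_cintegrable (cintegrableD (Fi i) ih) => x; rewrite big_cons.
Qed.

Lemma cintegral_sum I (s : seq I) (F : I -> T -> C) :
  (forall i, cintegrable mu setT (F i)) ->
  cintegral mu setT (fun x => \sum_(i <- s) F i x) =
  \sum_(i <- s) cintegral mu setT (F i).
Proof.
move=> Fi; elim: s => [|i s ih].
  rewrite big_nil -[RHS]cintegral0; apply: eq_cintegral => x.
  by rewrite big_nil.
rewrite big_cons -ih -cintegralD//; last exact: cintegrable_sum.
by apply: eq_cintegral => x; rewrite big_cons.
Qed.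

Lemma cintegrable_real (h : T -> R) : mu.-integrable setT (EFin \o h) ->
  cintegrable mu setT (fun x => (h x)%:C).
Proof. by move=> hi; split => //; exact: integrable0. Qed.

Lemma cintegral_real (h : T -> R) :
  cintegral mu setT (fun x => (h x)%:C) = (\int[mu]_x h x)%:C.
Proof. by apply: complex_eqP => //=; rewrite /Rintegral integral0. Qed.

End cintegral_theory.

Section cfubini.
Context d1 d2 {T1 : measurableType d1} {T2 : measurableType d2} {R : realType}.
Variable m1 : {sigma_finite_measure set T1 -> \bar R}.
Variable m2 : {sigma_finite_measure set T2 -> \bar R}.
Local Notation C := R[i].

Lemma integrable_tensor (f : T1 -> R) (g : T2 -> R) :
  m1.-integrable setT (EFin \o f) -> m2.-integrable setT (EFin \o g) ->
  (m1 \x m2)%E.-integrable setT (EFin \o (fun p => f p.1 * g p.2)).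
Proof.
move=> fi gi.
have mf : measurable_fun setT f by exact/measurable_EFinP/(measurable_int _ fi).
have mg : measurable_fun setT g by exact/measurable_EFinP/(measurable_int _ gi).
apply/integrable12ltyP.
  apply/measurable_EFinP/measurable_funM.
    exact: (measurableT_comp mf measurable_fst).
  exact: (measurableT_comp mg measurable_snd).
have [_ goo] := integrableP _ _ _ gi; have [_ foo] := integrableP _ _ _ fi.
have g0 : (0 <= \int[m2]_y `|(g y)%:E|)%E by exact: integral_ge0.
rewrite (_ : (fun x => _) = fun x => (`|(f x)%:E| * \int[m2]_y `|(g y)%:E|)%E).
  have -> : (\int[m2]_y `|(g y)%:E|)%E = (fine (\int[m2]_y `|(g y)%:E|))%:E.
    by rewrite fineK// ge0_fin_numE.
  rewrite ge0_integralZr//; last 2 first.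
    by apply/measurableT_comp => //; exact/measurable_EFinP.
    by rewrite lee_fin fine_ge0.
  by rewrite lte_mul_pinfty ?integral_ge0// ?ge0_fin_numE ?integral_ge0// ltry.
apply/funext => x /=.
under eq_integral do rewrite normrM EFinM.
rewrite ge0_integralZl//.
by apply/measurable_EFinP/measurableT_comp.
Qed.

Lemma cintegrable_tensor (f : T1 -> C) (g : T2 -> C) :
  cintegrable m1 setT f -> cintegrable m2 setT g ->
  cintegrable (m1 \x m2)%E setT (fun p => f p.1 * g p.2).
Proof.
move=> fi gi.
have [h [hi h0 fh]] := cintegrable_dom fi.
have [k [ki k0 gk]] := cintegrable_dom gi.
apply: (cintegrable_le _ (integrable_tensor hi ki)).
  have [f1 f2] := cintegrable_measurable fi.
  have [g1 g2] := cintegrable_measurable gi.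
  apply: cmeasurableM; split.
  - exact: (measurableT_comp f1 measurable_fst).
  - exact: (measurableT_comp f2 measurable_fst).
  - exact: (measurableT_comp g1 measurable_snd).
  - exact: (measurableT_comp g2 measurable_snd).
by move=> p /=; rewrite normcM ler_pM ?normc_ge0.
Qed.

Lemma Rintegral_fubini1 (f : T1 * T2 -> R) :
  (m1 \x m2)%E.-integrable setT (EFin \o f) ->
  (forall x, m2.-integrable setT (fun y => (f (x, y))%:E)) ->
  \int[(m1 \x m2)%E]_p f p = \int[m1]_x \int[m2]_y f (x, y).
Proof.
move=> fi f2; rewrite /Rintegral -integral12_prod_meas1//; congr fine.
by apply: eq_integral => x _; rewrite fineK//; exact: integrable_fin_num.
Qed.

Lemma Rintegral_fubini2 (f : T1 * T2 -> R) :
  (m1 \x m2)%E.-integrable setT (EFin \o f) ->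
  (forall y, m1.-integrable setT (fun x => (f (x, y))%:E)) ->
  \int[(m1 \x m2)%E]_p f p = \int[m2]_y \int[m1]_x f (x, y).
Proof.
move=> fi f1; rewrite /Rintegral -integral21_prod_meas1//; congr fine.
by apply: eq_integral => x _; rewrite fineK//; exact: integrable_fin_num.
Qed.

Lemma cintegral_fubini1 (f : T1 * T2 -> C) :
  cintegrable (m1 \x m2)%E setT f ->
  (forall x, cintegrable m2 setT (fun y => f (x, y))) ->
  cintegral (m1 \x m2)%E setT f =
  cintegral m1 setT (fun x => cintegral m2 setT (fun y => f (x, y))).
Proof.
move=> [f1 f2] s.
by apply: complex_eqP => /=; rewrite Rintegral_fubini1// => x; have [] := s x.
Qed.

Lemma cintegral_fubini2 (f : T1 * T2 -> C) :
  cintegrable (m1 \x m2)%E setT f ->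
  (forall y, cintegrable m1 setT (fun x => f (x, y))) ->
  cintegral (m1 \x m2)%E setT f =
  cintegral m2 setT (fun y => cintegral m1 setT (fun x => f (x, y))).
Proof.
move=> [f1 f2] s.
by apply: complex_eqP => /=; rewrite Rintegral_fubini2// => x; have [] := s x.
Qed.

Lemma cintegral_tensor (f : T1 -> C) (g : T2 -> C) :
  cintegrable m1 setT f -> cintegrable m2 setT g ->
  cintegral (m1 \x m2)%E setT (fun p => f p.1 * g p.2) =
  cintegral m1 setT f * cintegral m2 setT g.
Proof.
move=> fi gi; rewrite cintegral_fubini1/=; last 2 first.
- exact: cintegrable_tensor.
- by move=> x; exact: cintegrableZ.
rewrite mulrC -cintegralZ//; apply: eq_cintegral => x.
by rewrite cintegralZ// mulrC.
Qed.

(** The form in which Fubini's theorem is used: a tensor product twisted by a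
    bounded kernel. *)
Lemma cintegral_swap (f : T1 -> C) (g : T2 -> C) (K : T1 -> T2 -> C) (M : R) :
  cintegrable m1 setT f -> cintegrable m2 setT g ->
  cmeasurable (fun p : T1 * T2 => K p.1 p.2) ->
  (forall x y, normc (K x y) <= M) ->
  cintegral m1 setT (fun x => f x * cintegral m2 setT (fun y => g y * K x y)) =
  cintegral m2 setT (fun y => g y * cintegral m1 setT (fun x => f x * K x y)).
Proof.
move=> fi gi mK KM.
have fK y : cintegrable m1 setT (fun x => f x * K x y).
  apply: (cintegrable_bounded_mul (M := M)) => //.
  by split; [have [m _] := mK|have [_ m] := mK];
    exact: (measurableT_comp m (pair2_measurable y)).
have gK x : cintegrable m2 setT (fun y => g y * K x y).
  apply: (cintegrable_bounded_mul (M := M)) => //.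
  by split; [have [m _] := mK|have [_ m] := mK];
    exact: (measurableT_comp m (pair1_measurable x)).
have fgK : cintegrable (m1 \x m2)%E setT (fun p => f p.1 * g p.2 * K p.1 p.2).
  by apply: (cintegrable_bounded_mul (M := M)) => //; exact: cintegrable_tensor.
transitivity (cintegral (m1 \x m2)%E setT
    (fun p => f p.1 * g p.2 * K p.1 p.2)).
  rewrite cintegral_fubini1//=; last first.
    move=> x; apply: eq_cintegrable (cintegrableZ (f x) (gK x)) => y /=.
    by rewrite mulrA.
  apply: eq_cintegral => x; rewrite -cintegralZ//.
  by apply: eq_cintegral => y; rewrite mulrA.
rewrite cintegral_fubini2//=; last first.
  move=> y; apply: eq_cintegrable (cintegrableZ (g y) (fK y)) => x /=.
  by rewrite mulrCA mulrA.
apply: eq_cintegral => y; rewrite -cintegralZ//.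
by apply: eq_cintegral => x; rewrite mulrCA mulrA.
Qed.

End cfubini.

(** * Calculus and changes of variables on the line *)

Section real_calculus.
Context {R : realType}.
Implicit Types (f g : R -> R) (x a b c : R).

Lemma is_derive_add f g x a b : is_derive x (1 : R) f a -> is_derive x (1 : R) g b ->
  is_derive x (1 : R) (fun t => f t + g t) (a + b).
Proof. by move=> fa gb; exact: is_deriveD. Qed.

Lemma is_derive_mul f g x a b : is_derive x (1 : R) f a -> is_derive x (1 : R) g b ->
  is_derive x (1 : R) (fun t => f t * g t) (a * g x + f x * b).
Proof.
move=> fa gb; have := is_deriveM fa gb.
by rewrite addrC -![_ *: _]/(_ * _) [g x * a]mulrC.
Qed.

Lemma is_derive_scale c f x a : is_derive x (1 : R) f a ->
  is_derive x (1 : R) (fun t => c * f t) (c * a).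
Proof. by move=> fa; exact: (is_deriveZ c fa). Qed.

Lemma is_derive_neg f x a : is_derive x (1 : R) f a ->
  is_derive x (1 : R) (fun t => - f t) (- a).
Proof. by move=> fa; exact: is_deriveN. Qed.

Lemma is_derive_exp_comp f x a : is_derive x (1 : R) f a ->
  is_derive x (1 : R) (fun t => expR (f t)) (expR (f x) * a).
Proof. by move=> fa; exact: is_derive1_comp. Qed.

Lemma is_derive_cos_comp f x a : is_derive x (1 : R) f a ->
  is_derive x (1 : R) (fun t => cos (f t)) (- sin (f x) * a).
Proof. by move=> fa; exact: is_derive1_comp. Qed.

Lemma is_derive_sin_comp f x a : is_derive x (1 : R) f a ->
  is_derive x (1 : R) (fun t => sin (f t)) (cos (f x) * a).
Proof. by move=> fa; exact: is_derive1_comp. Qed.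

Lemma is_derive_continuous f g :
  (forall x, is_derive x (1 : R) f (g x)) -> continuous f.
Proof.
by move=> df x; apply/differentiable_continuous/derivable1_diffP; case: (df x).
Qed.

Lemma continuous_add f g : continuous f -> continuous g ->
  continuous (fun t => f t + g t).
Proof. by move=> cf cg x; exact: (continuousD (cf x) (cg x)). Qed.

Lemma continuous_mul f g : continuous f -> continuous g ->
  continuous (fun t => f t * g t).
Proof. by move=> cf cg x; exact: (continuousM (cf x) (cg x)). Qed.

Lemma continuous_neg f : continuous f -> continuous (fun t => - f t).
Proof. by move=> cf x; exact: (continuousN (cf x)). Qed.

Lemma continuous_exp_comp f : continuous f -> continuous (fun t => expR (f t)).
Proof. by move=> cf x; apply: continuous_comp; [exact: cf|exact: continuous_expR]. Qed.

Lemma continuous_cos_comp f : continuous f -> continuous (fun t => cos (f t)).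
Proof. by move=> cf x; apply: continuous_comp; [exact: cf|exact: continuous_cos]. Qed.

Lemma continuous_sin_comp f : continuous f -> continuous (fun t => sin (f t)).
Proof. by move=> cf x; apply: continuous_comp; [exact: cf|exact: continuous_sin]. Qed.

Lemma continuous_norm_comp f : continuous f -> continuous (fun t => `|f t|).
Proof. by move=> cf x; apply: continuous_comp; [exact: cf|exact: norm_continuous]. Qed.

Lemma continuous_const c : continuous (fun _ : R => c).
Proof. by move=> x; exact: cvg_cst. Qed.

Lemma continuous_idfun : continuous (fun t : R => t).
Proof. by move=> x; exact: cvg_id. Qed.

Lemma cvg0_le (F : set_system R) f g : Filter F -> (forall x, `|f x| <= g x) ->
  g x @[x --> F] --> 0 -> f x @[x --> F] --> 0.
Proof.
move=> FF fg g0; apply: norm_cvg0.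
apply: (@squeeze_cvgr _ F FF R (fun=> 0) g); [|exact: cvg_cst|exact: g0].
by apply: nearW => x; rewrite normr_ge0 fg.
Qed.

End real_calculus.

Ltac solve_continuous := lazymatch goal with
  | |- continuous (fun t => t) => exact: continuous_idfun
  | |- continuous (fun t => @?f t + @?g t) =>
      apply: (@continuous_add _ f g); solve_continuous
  | |- continuous (fun t => @?f t * @?g t) =>
      apply: (@continuous_mul _ f g); solve_continuous
  | |- continuous (fun t => - @?f t) =>
      apply: (@continuous_neg _ f); solve_continuous
  | |- continuous (fun t => expR (@?f t)) =>
      first [assumption | apply: (@continuous_exp_comp _ f); solve_continuous]
  | |- continuous (fun t => cos (@?f t)) =>
      apply: (@continuous_cos_comp _ f); solve_continuous
  | |- continuous (fun t => sin (@?f t)) =>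
      apply: (@continuous_sin_comp _ f); solve_continuous
  | |- continuous (fun t => `|@?f t|) =>
      apply: (@continuous_norm_comp _ f); solve_continuous
  | _ => first [assumption | exact: continuous_const]
  end.

Section lebesgue_line_theory.
Context {R : realType}.
Notation mu := (@lebesgue_measure R).
Local Notation mR := (measurableTypeR R).
Local Notation C := R[i].

(** One argument for dilations, translations and the reflection: the integrals
    of the positive and negative parts are carried along by the image measure. *)
Lemma integrable_transport (phi : mR -> mR) (k : R) (f : mR -> R) :
  measurable_fun setT phi -> 0 < k ->
  (forall A, measurable A -> mu A = (k%:E * mu (phi @^-1` A))%E) ->
  mu.-integrable setT (EFin \o f) ->
  mu.-integrable setT (EFin \o (f \o phi)) /\
  \int[mu]_x f x = k * \int[mu]_x f (phi x).
Proof.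
move=> mphi k0 muphi fi.
have mf : measurable_fun setT (EFin \o f) by exact: measurable_int fi.
have ge0T (g : mR -> \bar R) : measurable_fun setT g -> (forall x, (0 <= g x)%E) ->
    (\int[mu]_x g x = k%:E * \int[mu]_x g (phi x))%E.
  move=> mg g0; rewrite -(@ge0_integral_pushforward _ _ _ _ R phi mphi mu setT g)//.
  pose k' := NngNum (ltW k0).
  rewrite -(@ge0_integral_mscale _ _ R (pushforward mu phi) setT measurableT k')//.
  by apply: eq_measure_integral => A mA _; rewrite /= muphi.
have fphii : mu.-integrable setT (EFin \o (f \o phi)).
  apply/integrableP; split; first exact: (measurableT_comp mf mphi).
  have [_] := integrableP _ _ _ fi.
  rewrite ge0T//; last exact: measurableT_comp.
  move=> kfoo; have [foo|] := ltP (\int[mu]_x `|(f (phi x))%:E|)%E +oo%E => //.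
  by rewrite leye_eq => /eqP E; move: kfoo; rewrite /= E gt0_muley ?lte_fin// ltxx.
split=> //; rewrite /Rintegral.
have kfphi : k%:E \is a fin_num by [].
have Ifin := @integrable_fin_num _ _ _ mu _ measurableT _ fphii.
rewrite -[k in RHS]/(fine k%:E) -fineM //.
congr fine; rewrite integralE.
rewrite ge0T//; last exact: measurable_funepos.
rewrite (ge0T (_^\-)%E)//; last exact: measurable_funeneg.
rewrite -muleBr; [|by []|].
  congr (_ * _)%E; rewrite [RHS]integralE.
  by congr (_ - _)%E; apply: eq_integral => x _; rewrite ?funeposE ?funenegE.
apply: fin_num_adde_defl; rewrite fin_numN.
have := @integrable_neg_fin_num _ _ _ mu _ _ _ fphii.
rewrite -[EFin \o (f \o phi)]/((EFin \o f) \o phi) funeneg_comp; exact.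
Qed.

(** Both sides are measures of A, and they agree on intervals. *)
Lemma lebesgue_measure_affine (c b : R) (A : set R) : 0 < c -> measurable A ->
  mu A = (c%:E * mu ((fun x => c * x + b)%R @^-1` A))%E.
Proof.
move=> c0 mA; pose c' := NngNum (ltW c0).
have mphi : measurable_fun setT ((fun x => c * x + b) : mR -> mR).
  by apply: measurable_funD => //; exact: measurable_funM.
pose nu : {measure set mR -> \bar R} :=
  mscale c' (pushforward mu ((fun x => c * x + b) : mR -> mR)).
rewrite -[RHS]/(nu mphi A); apply: lebesgue_measure_unique => // _ [[x y]] _ <-.
pose I := `](x - b) / c, (y - b) / c]%classic.
transitivity (c%:E * mu I)%E; last first.
  congr (_ * mu _)%E; apply/seteqP; rewrite /I; split => z /=; rewrite !in_itv/= => /andP[].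
    by rewrite ltr_pdivrMr// ler_pdivlMr// ltrBlDr lerBrDr mulrC => -> ->.
  by rewrite ltr_pdivrMr// ler_pdivlMr// ltrBlDr lerBrDr mulrC => -> ->.
rewrite /I !lebesgue_measure_itv/= !lte_fin ltr_pM2r ?invr_gt0// ltrBlDr subrK.
case: ifPn => // _; last by rewrite mule0.
rewrite -!EFinB -EFinM; congr EFin; field; exact: lt0r_neq0.
Qed.

Lemma Rintegral_affine (c b : R) (f : R -> R) : 0 < c ->
  mu.-integrable setT (EFin \o f) ->
  mu.-integrable setT (fun x => (f (c * x + b))%:E) /\
  \int[mu]_x f x = c * \int[mu]_x f (c * x + b).
Proof.
move=> c0 fi.
apply: (@integrable_transport (fun x => c * x + b) c f) => //.
  by apply: measurable_funD => //; exact: measurable_funM.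
by move=> A mA; exact: lebesgue_measure_affine.
Qed.

Lemma Rintegral_opp (f : R -> R) : mu.-integrable setT (EFin \o f) ->
  mu.-integrable setT (fun x => (f (- x))%:E) /\
  \int[mu]_x f x = \int[mu]_x f (- x).
Proof.
move=> fi.
have muN A : measurable A -> mu A = (1%:E * mu (-%R @^-1` A))%E.
  by move=> mA; rewrite mul1e -[LHS]lebesgue_measureN.
have mN : measurable_fun setT (-%R : mR -> mR) by exact: oppr_measurable.
by have [? ->] := integrable_transport mN ltr01 muN fi; rewrite mul1r.
Qed.

Lemma cintegral_affine (c b : R) (f : R -> C) : 0 < c ->
  cintegrable mu setT f ->
  cintegrable mu setT (fun x => f (c * x + b)) /\
  cintegral mu setT f = c%:C * cintegral mu setT (fun x => f (c * x + b)).
Proof.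
move=> c0 [f1 f2]; have [g1 e1] := Rintegral_affine b c0 f1.
have [g2 e2] := Rintegral_affine b c0 f2; split => //.
by apply: complex_eqP => /=; rewrite ?e1 ?e2 mul0r ?subr0 ?addr0.
Qed.

Lemma cintegral_shift (b : R) (f : R -> C) : cintegrable mu setT f ->
  cintegrable mu setT (fun x => f (x + b)) /\
  cintegral mu setT (fun x => f (x + b)) = cintegral mu setT f.
Proof.
move=> fi; have [gi e] := cintegral_affine b ltr01 fi.
have E : (fun x => f (1 * x + b)) = (fun x => f (x + b)).
  by apply/funext => x; rewrite mul1r.
by rewrite E in gi e; rewrite e rmorph1 mul1r.
Qed.

Lemma cvg_Rintegral_exhaust (D_ : nat -> set R) (f : R -> R) :
  (forall n, measurable (D_ n)) ->
  (forall x, \forall n \near \oo, D_ n x) ->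
  mu.-integrable setT (EFin \o f) ->
  \int[mu]_(x in D_ n) f x @[n --> \oo] --> \int[mu]_x f x.
Proof.
move=> mD Dx fi.
have mf : measurable_fun setT f by move: fi => /measurable_int/measurable_EFinP.
under eq_fun do rewrite Rintegral_mkcond.
apply: fine_cvg; rewrite fineK; last exact: integrable_fin_num.
have [|||||_ _] := @dominated_convergence _ _ _ mu setT measurableT
   (fun n x => ((f \_ (D_ n)) x)%:E) (EFin \o f) (EFin \o (fun x => `|f x|)).
- move=> n; apply/measurable_EFinP.
  by apply/(measurable_restrictT f (mD n))/measurable_funTS.
- exact/measurable_EFinP.
- apply: aeW => x _ /=; apply: cvg_near_cst.
  have := Dx x; apply: filterS => n Dn.
  by rewrite patchE mem_set.
- exact: integrable_norm.
- apply: aeW => x n _ /=; rewrite lee_fin patchE; case: ifPn => // _.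
  by rewrite normr0.
- exact.
Qed.

Lemma cvgr_idSn : (n.+1%:R : R) @[n --> \oo] --> +oo.
Proof.
have := cvg_comp (addn^~ 1%N) (fun n => n%:R : R) (cvg_addnr 1) cvgr_idn.
by under [X in X @ _ --> _]eq_fun do rewrite /= addn1.
Qed.

(** Symmetric intervals exhaust the line, and integrability of f lets their
    integrals converge to the one over the line. *)
Lemma Rintegral_FTC (F f : R -> R) (l1 l2 : R) :
  (forall x : R, is_derive x (1 : R) F (f x)) -> continuous f ->
  mu.-integrable setT (EFin \o f) ->
  F x @[x --> +oo] --> l1 -> F x @[x --> -oo] --> l2 ->
  \int[mu]_x f x = l1 - l2.
Proof.
move=> dF cf fi Fl1 Fl2.
have cF := is_derive_continuous dF.
have : \int[mu]_(x in `[- n.+1%:R, n.+1%:R]) f x @[n --> \oo] --> \int[mu]_x f x.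
  apply: (@cvg_Rintegral_exhaust (fun n => `[- n.+1%:R, n.+1%:R]%classic)) => //.
  move=> x; near=> n; rewrite /= in_itv/= -ler_norml.
  rewrite (@le_trans _ _ n%:R)//; last by rewrite ler_nat.
  near: n; exact: nbhs_infty_ger.
have -> : (fun n : nat => \int[mu]_(x in `[- n.+1%:R, n.+1%:R]) f x) =
    (fun n : nat => F n.+1%:R - F (- n.+1%:R)).
  apply/funext => n; rewrite /Rintegral (@continuous_FTC2 _ f F)//.
  - by rewrite (@lt_trans _ _ 0) ?oppr_lt0.
  - exact: continuous_subspaceT.
  - split.
    + by move=> x _; case: (dF x).
    + exact/cvg_at_right_filter/cF.
    + exact/cvg_at_left_filter/cF.
  - by move=> x _; rewrite derive1E; apply: derive_val.
move=> fcvg; apply/esym; apply: (cvg_unique _ _ fcvg) => //.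
apply: cvgB.
  apply: (cvg_comp (fun n : nat => n.+1%:R : R) F _ Fl1).
  exact: cvgr_idSn.
apply: (cvg_comp (fun n : nat => - n.+1%:R : R) F _ Fl2).
apply/cvgNrNy.
exact: cvgr_idSn.
Unshelve. all: by end_near.
Qed.

Lemma ge0_integral_exhaust (D : set R) (D_ : nat -> set R) (f : R -> R) :
  measurable D -> (forall n, measurable (D_ n)) ->
  (forall n, D_ n `<=` D_ n.+1) -> (forall n, D_ n `<=` D) ->
  (forall x, D x -> \forall n \near \oo, D_ n x) ->
  measurable_fun D f -> (forall x, D x -> 0 <= f x) ->
  (\int[mu]_(x in D_ n) (f x)%:E)%E @[n --> \oo] --> (\int[mu]_(x in D) (f x)%:E)%E.
Proof.
move=> mD mDn ndD DnD Dx mf f0.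
have ndD' : nondecreasing_seq D_.
  by apply/nondecreasing_seqP => n; apply/subsetPset.
have DE n : D `&` D_ n = D_ n by apply/setIidPr.
have := @cvg_monotone_convergence _ _ _ mu D mD
  (fun n x => ((f \_ (D_ n)) x)%:E).
rewrite (_ : (fun n => _) = (fun n => \int[mu]_(x in D_ n) (f x)%:E)%E); last first.
  apply/funext => n; rewrite -[in RHS](DE n) integral_mkcondr.
  by apply: eq_integral => x _; rewrite /patch; case: ifP.
rewrite [X in _ --> X](_ : _ = \int[mu]_(x in D) (f x)%:E)%E; last first.
  apply: eq_integral => x /[!inE] xD; apply/cvg_lim => //.
  apply: cvg_near_cst; apply: filterS (Dx x xD) => n Dn.
  by rewrite patchE mem_set.
apply.
- move=> n; apply/measurable_EFinP; apply/measurable_restrict => //.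
    exact: mDn.
  by apply: measurable_funS mf => //; exact: subIsetl.
- by move=> n x xD; rewrite lee_fin patchE; case: ifPn => // _; exact: f0.
- move=> x xD m n mn; rewrite lee_fin !patchE; case: ifPn => [xm|_].
    rewrite ifT// inE; have /subsetPset := ndD' _ _ mn; apply.
    exact: set_mem.
  by case: ifPn => // _; exact: f0.
Qed.

(** The substitution s = exp y carries integrals over the half-line to
    integrals over the line; compact intervals exhaust both. *)
Lemma ge0_integral_expR (G : R -> R) :
  {in `]0, +oo[, continuous G} -> (forall x, 0 < x -> 0 <= G x) ->
  (\int[mu]_(x in `]0%R, +oo[) (G x)%:E = \int[mu]_y (G (expR y) * expR y)%:E)%E.
Proof.
move=> cG G0.
have dexp : derive1 (@expR R) = expR.
  by apply/funext => z; rewrite derive1E derive_val.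
have sub n : (\int[mu]_(x in `[expR (- n.+1%:R)%R, expR n.+1%:R%R]) (G x)%:E =
    \int[mu]_(y in `[(- n.+1%:R)%R, n.+1%:R%R]) (G (expR y) * expR y)%:E)%E.
  rewrite (@integration_by_substitution_increasing _ expR G (- n.+1%:R) n.+1%:R).
  - by apply: eq_integral => x _; rewrite dexp.
  - by rewrite (@le_trans _ _ 0)// oppr_le0.
  - by move=> x y _ _; rewrite ltr_expR.
  - by move=> x _; rewrite dexp; exact: continuous_expR.
  - rewrite dexp; apply/cvg_ex; exists (expR (- n.+1%:R)).
    exact/cvg_at_right_filter/continuous_expR.
  - rewrite dexp; apply/cvg_ex; exists (expR n.+1%:R).
    exact/cvg_at_left_filter/continuous_expR.
  - split; first by move=> x _; exact: derivable_expR.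
      exact/cvg_at_right_filter/continuous_expR.
    exact/cvg_at_left_filter/continuous_expR.
  - apply: continuous_in_subspaceT => x; rewrite ?inE/= ?in_itv/= => /andP[x0 _].
    by apply: cG; rewrite in_itv/= andbT (lt_le_trans _ x0)// expR_gt0.
have mG : measurable_fun (`](0 : R), +oo[%classic : set mR) G.
  by apply: open_continuous_measurable_fun => // x /set_mem; exact: cG.
have cGe : continuous (fun y => G (expR y) * expR y).
  move=> y; apply: continuousM; last exact: continuous_expR.
  apply: continuous_comp; first exact: continuous_expR.
  by apply: cG; rewrite in_itv/= andbT expR_gt0.
have L : (\int[mu]_(x in `[expR (- n.+1%:R)%R, expR n.+1%:R%R]) (G x)%:E)%E @[n --> \oo] -->
    (\int[mu]_(x in `]0%R, +oo[) (G x)%:E)%E.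
  apply: (@ge0_integral_exhaust `](0 : R), +oo[%classic
    (fun n => `[expR (- n.+1%:R), expR n.+1%:R]%classic)) => //.
  - move=> n x /=; rewrite !in_itv/= => /andP[nx xn]; apply/andP; split.
      by rewrite (le_trans _ nx)// ler_expR lerN2 ler_nat.
    by rewrite (le_trans xn)// ler_expR ler_nat.
  - move=> n x /=; rewrite !in_itv/= andbT => /andP[nx _].
    by rewrite (lt_le_trans _ nx)// expR_gt0.
  - move=> x /=; rewrite in_itv/= andbT => x0; near=> n.
    rewrite /= in_itv/= -{1 2}(lnK x0) !ler_expR -ler_norml.
    rewrite (@le_trans _ _ n%:R)//; last by rewrite ler_nat.
    by near: n; exact: nbhs_infty_ger.
  - by move=> x /=; rewrite in_itv/= andbT => x0; exact: G0.
have RR : (\int[mu]_(y in `[(- n.+1%:R)%R, n.+1%:R%R]) (G (expR y) * expR y)%:E)%E @[n --> \oo] -->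
    (\int[mu]_y (G (expR y) * expR y)%:E)%E.
  apply: (@ge0_integral_exhaust setT (fun n => `[- n.+1%:R, n.+1%:R]%classic)) => //.
  - move=> n x /=; rewrite !in_itv/= -!ler_norml => /le_trans; apply.
    by rewrite ler_nat.
  - move=> x _; near=> n; rewrite /= in_itv/= -ler_norml.
    rewrite (@le_trans _ _ n%:R)//; last by rewrite ler_nat.
    by near: n; exact: nbhs_infty_ger.
  - exact: continuous_measurable_fun.
  - by move=> x _; rewrite mulr_ge0 ?expR_ge0// G0// expR_gt0.
apply: (cvg_unique _ L) => //.
by move: RR; apply: cvg_trans; apply: near_eq_cvg; apply: nearW => n; rewrite -sub.
Unshelve. all: by end_near.
Qed.

(** The Abel kernel is positive definite; adding 1 to the cosine makes the
    integrand nonnegative, so that its antiderivative alone gives the integral. *)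
Lemma integral_abel_kernel (e z : R) : 0 < e ->
  (\int[mu]_t (expR (- (e * `|t|)) * (1 + cos (t * z)))%:E =
   (2 / e + 2 * e / (e ^+ 2 + z ^+ 2))%:E)%E.
Proof.
move=> e0.
have ne : e != 0 by exact: lt0r_neq0.
have nez : e ^+ 2 + z ^+ 2 != 0 by rewrite gt_eqF// ltr_pwDl ?sqr_ge0// exprn_gt0.
rewrite ge0_symfun_integralT; last 3 first.
- move=> t; apply: mulr_ge0; first exact: expR_ge0.
  by rewrite -lerBlDl sub0r cos_geN1.
- by solve_continuous.
- by move=> t /=; rewrite normrN mulNr cosN.
rewrite -set_itvcy.
pose E t := expR (- (e * t)).
have dE t : is_derive t (1 : R) E (- e * E t).
  have := is_derive_exp_comp (is_derive_neg (is_derive_scale e (is_derive_id t (1 : R)))).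
  move/is_derive_eq; apply.
  by rewrite mulr1 mulrC.
have dtz t : is_derive t (1 : R) (fun t => t * z) z.
  have := is_derive_mul (is_derive_id t (1 : R)) (is_derive_cst z t (1 : R)).
  by move/is_derive_eq; apply; rewrite mulr0 addr0 mul1r.
pose c := (e ^+ 2 + z ^+ 2)^-1.
pose F t := (- e^-1) * E t + c * (E t * (z * sin (t * z) + (- e) * cos (t * z))).
have dF t : is_derive t (1 : R) F (E t * (1 + cos (t * z))).
  have := is_derive_add (is_derive_scale (- e^-1) (dE t)) (is_derive_scale c
    (is_derive_mul (dE t) (is_derive_add
      (is_derive_scale z (is_derive_sin_comp (dtz t)))
      (is_derive_scale (- e) (is_derive_cos_comp (dtz t)))))).
  move/is_derive_eq; apply.
  by rewrite /c; field; rewrite ne nez.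
have cF := is_derive_continuous dF.
rewrite (eq_integral (fun t : mR => (E t * (1 + cos (t * z)))%:E)); last first.
  by move=> t; rewrite inE/= in_itv/= andbT => t0; rewrite ger0_norm.
rewrite (@ge0_continuous_FTC2y _ (fun t => E t * (1 + cos (t * z))) F 0 0).
- rewrite -EFinB -EFinM; congr EFin; rewrite /F /E mulr0 oppr0 expR0 mul0r sin0 cos0.
  by rewrite /c; field; rewrite ne nez.
- move=> t _; apply: mulr_ge0; first exact: expR_ge0.
  by rewrite -lerBlDl sub0r cos_geN1.
- by apply: continuous_subspaceT; rewrite /E; solve_continuous.
- apply: (@cvg0_le _ _ _ (fun t => (e^-1 + `|c| * (`|z| + e)) * E t)).
    move=> t; rewrite /F mulrDl (le_trans (ler_normD _ _))// lerD//.
      by rewrite normrM normrN !ger0_norm ?invr_ge0 ?(ltW e0)// expR_ge0.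
    rewrite !normrM -mulrA ler_wpM2l// mulrC (ger0_norm (expR_ge0 _)).
    rewrite ler_wpM2r ?expR_ge0// (le_trans (ler_normD _ _))// !normrM lerD//.
      by rewrite ler_piMr// sin_max.
    by rewrite normrN (ger0_norm (ltW e0)) ler_piMr ?cos_max// ltW.
  rewrite -[X in _ --> X](mulr0 (e^-1 + `|c| * (`|z| + e))).
  apply: cvgM; first exact: cvg_cst.
  have eoo : e * t @[t --> +oo] --> (+oo : set_system R).
    by apply: gt0_cvgMry => //; exact: cvg_id.
  exact: (cvg_comp _ (fun t => expR (- t)) eoo (@cvgr_expR R)).
- by move=> t _; case: (dF t).
- exact/cvg_at_right_filter/cF.
- by move=> t _; rewrite derive1E; have [_ ->] := dF t.
Qed.

End lebesgue_line_theory.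

(** * Fourier inversion and Parseval's formula *)

Section fourier.
Context {R : realType}.
Notation mu := (@lebesgue_measure R).
Local Notation mR := (measurableTypeR R).
Local Notation C := R[i].

Definition cis (x : R) : C := cos x +i* sin x.

Lemma cis0 : cis 0 = 1.
Proof. by rewrite /cis cos0 sin0. Qed.

Lemma cisD x y : cis (x + y) = cis x * cis y.
Proof. by apply: complex_eqP; rewrite /= ?cosD ?sinD// addrC. Qed.

Lemma normc_cis x : normc (cis x) = 1.
Proof. by rewrite /= cos2Dsin2 sqrtr1. Qed.

Lemma cmeasurable_cis d (T : measurableType d) (f : T -> R) :
  measurable_fun setT f -> cmeasurable (fun x => cis (f x)).
Proof.
move=> mf; split.
  by apply: (measurableT_comp _ mf); exact: (continuous_measurable_fun (@continuous_cos R)).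
by apply: (measurableT_comp _ mf); exact: (continuous_measurable_fun (@continuous_sin R)).
Qed.

Lemma cvg_Rintegral_dominated (f_ : nat -> R -> R) (f g : R -> R) :
  (forall n, measurable_fun setT (f_ n)) -> measurable_fun setT f ->
  (forall x, f_ n x @[n --> \oo] --> f x) -> mu.-integrable setT (EFin \o g) ->
  (forall n x, `|f_ n x| <= g x) ->
  \int[mu]_x f_ n x @[n --> \oo] --> \int[mu]_x f x.
Proof.
move=> mf_ mf fcvg gi fg.
have fi : mu.-integrable setT (EFin \o f).
  apply: (le_integrable _ _ _ gi) => //; first exact/measurable_EFinP.
  move=> x _ /=; rewrite lee_fin (le_trans _ (ler_norm _))//.
  have fx : `|f_ n x| @[n --> \oo] --> `|f x| by apply: cvg_norm; exact: fcvg.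
  rewrite -(cvg_lim _ fx)//; apply: limr_le; first by apply/cvg_ex; eexists; exact: fx.
  by apply: nearW => n; exact: fg.
apply: fine_cvg; rewrite fineK; last exact: integrable_fin_num.
have [|||||_ _] := @dominated_convergence _ _ _ mu setT measurableT
   (fun n x => (f_ n x)%:E) (EFin \o f) (EFin \o g).
- by move=> n; apply/measurable_EFinP; exact: mf_.
- exact/measurable_EFinP.
- apply: aeW => x _ /=; apply: cvg_EFin; first exact: nearW.
  exact: fcvg.
- exact: gi.
- by apply: aeW => x n _ /=; rewrite lee_fin.
- exact.
Qed.

Lemma integralT_cauchy : (\int[mu]_u ((1 + u ^+ 2)^-1)%:E = pi%:E)%E.
Proof.
rewrite ge0_symfun_integralT.
- by rewrite -set_itvcy integral0y_oneDsqr -EFinM mulrC divfK.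
- by move=> u; rewrite invr_ge0 addr_ge0// sqr_ge0.
- exact: continuous_oneDsqrV.
- by move=> u /=; rewrite sqrrN.
Qed.

Lemma integrable_ge0 (f : R -> R) (c : R) : measurable_fun setT f ->
  (forall x, 0 <= f x) -> (\int[mu]_x (f x)%:E = c%:E)%E ->
  mu.-integrable setT (EFin \o f).
Proof.
move=> mf f0 fc; apply/integrableP; split; first exact/measurable_EFinP.
rewrite (eq_integral (fun x : mR => (f x)%:E)) ?fc ?ltry//.
by move=> x _ /=; rewrite ger0_norm.
Qed.

Lemma measurable_cauchy : measurable_fun setT (fun u : mR => (1 + u ^+ 2)^-1).
Proof. exact: (continuous_measurable_fun (@continuous_oneDsqrV R)). Qed.

Lemma integrable_cauchy : mu.-integrable setT (fun u => ((1 + u ^+ 2)^-1)%:E).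
Proof.
apply: (integrable_ge0 measurable_cauchy _ integralT_cauchy) => u.
by rewrite invr_ge0 addr_ge0// sqr_ge0.
Qed.

Section abel.
Variable e : R.
Hypothesis e0 : 0 < e.

Definition abel (t : R) := expR (- (e * `|t|)).

Lemma measurable_abel : measurable_fun setT (abel : mR -> R).
Proof. by apply: continuous_measurable_fun; rewrite /abel; solve_continuous. Qed.

Lemma integrable_abel : mu.-integrable setT (EFin \o abel).
Proof.
have := integral_abel_kernel 0 e0.
rewrite (eq_integral (fun t : mR => (2 * abel t)%:E)); last first.
  by move=> t _; rewrite mulr0 cos0 /abel; congr EFin; ring.
move=> /integrable_ge0 ai.
have : mu.-integrable setT (EFin \o (fun t => 2 * abel t)).
  apply: ai; last by move=> t; rewrite mulr_ge0// expR_ge0.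
  by apply: measurable_funM => //; exact: measurable_abel.
move=> /(integrableZl measurableT 2^-1); apply: eq_integrable => // t _ /=.
by rewrite -EFinM mulrA mulVf ?mul1r.
Qed.

Lemma fourier_abel (y : R) :
  cintegral mu setT (fun t => (abel t)%:C * cis (t * y)) =
  (2 * e / (e ^+ 2 + y ^+ 2))%:C.
Proof.
have ai := integrable_abel.
have ci : cintegrable mu setT (fun t : mR => (abel t)%:C * cis (t * y)).
  apply: (cintegrable_bounded_mul (M := 1)); first exact: cintegrable_real.
    by apply: cmeasurable_cis; exact: measurable_funM.
  by move=> t; rewrite normc_cis.
have Re_ t : complex.Re ((abel t)%:C * cis (t * y)) = abel t * cos (t * y).
  by rewrite /= mul0r subr0.
have Im_ t : complex.Im ((abel t)%:C * cis (t * y)) = abel t * sin (t * y).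
  by rewrite /= mul0r addr0.
have [ci1 ci2] := ci.
have Iabel z : \int[mu]_t (abel t * (1 + cos (t * z))) = 2 / e + 2 * e / (e ^+ 2 + z ^+ 2).
  by rewrite /Rintegral integral_abel_kernel.
have I0 : \int[mu]_t abel t = 2 / e.
  have := Iabel 0; rewrite (@eq_Rintegral _ _ _ mu setT (fun t => 2 * abel t)); last first.
    by move=> t _; rewrite mulr0 cos0; ring.
  rewrite RintegralZl// expr0n/= addr0 => /(congr1 (fun z => z / 2)).
  rewrite mulrC mulKf// => ->; field; exact: lt0r_neq0.
apply: complex_eqP => /=.
  under eq_Rintegral do rewrite mul0r subr0.
  apply: (@addrI _ (2 / e)); rewrite -Iabel -I0 -RintegralD//.
    by apply: eq_Rintegral => t _; rewrite mulrDr mulr1.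
  by apply: eq_integrable ci1 => // t _ /=; rewrite mul0r subr0.
under eq_Rintegral do rewrite mul0r addr0.
have ci2' : mu.-integrable setT (EFin \o (fun t => abel t * sin (t * y))).
  by apply: eq_integrable ci2 => // t _ /=; rewrite mul0r addr0.
have [_ IE] := Rintegral_opp ci2'.
have : \int[mu]_t (abel t * sin (t * y)) = - \int[mu]_t (abel t * sin (t * y)).
  rewrite {1}IE -mulN1r -RintegralZl//.
  by apply: eq_Rintegral => t _; rewrite /abel normrN mulNr sinN; ring.
by move/eqP; rewrite -addr_eq0 -mulr2n mulrn_eq0/= => /eqP.
Qed.

End abel.

Definition fourier (phi : R -> R) (x : R) : C :=
  cintegral mu setT (fun y => (phi y)%:C * cis (x * y)).

Lemma cmeasurable_cisM : cmeasurable (fun p : mR * mR => cis (p.1 * p.2)).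
Proof.
by apply: cmeasurable_cis; apply: measurable_funM;
  [exact: measurable_fst|exact: measurable_snd].
Qed.

Lemma cintegrable_cis (f : R -> C) (x : R) : cintegrable mu setT f ->
  cintegrable mu setT (fun y => f y * cis (x * y)).
Proof.
move=> fi; apply: (cintegrable_bounded_mul (M := 1)) => //.
  by apply: cmeasurable_cis; exact: measurable_funM.
by move=> t; rewrite normc_cis.
Qed.

(** Fourier inversion at the origin by Abel summation: the integral of the
    transform against exp (- e |t|) is the integral of phi against the Poisson
    kernel of width e. *)
Lemma fourier_inversion0 (phi : R -> R) (M : R) :
  continuous phi -> mu.-integrable setT (EFin \o phi) ->
  (forall y, `|phi y| <= M) -> cintegrable mu setT (fourier phi) ->
  cintegral mu setT (fourier phi) = (2 * pi * phi 0)%:C.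
Proof.
move=> cphi phii phiM Fi.
pose e (n : nat) : R := n.+1%:R^-1.
have e0 n : 0 < e n by rewrite invr_gt0.
have ecvg : e n @[n --> \oo] --> 0 by exact: cvg_harmonic.
have key n : cintegral mu setT (fun t => (abel (e n) t)%:C * fourier phi t) =
    (\int[mu]_u (phi (e n * u) * (2 * (1 + u ^+ 2)^-1)))%:C.
  rewrite /fourier (cintegral_swap (m1 := mu) (m2 := mu) (M := 1)); last 4 first.
  - exact/cintegrable_real/integrable_abel.
  - exact: cintegrable_real.
  - exact: cmeasurable_cisM.
  - by move=> x y; rewrite normc_cis.
  under eq_fun do rewrite fourier_abel// -rmorphM/=.
  rewrite cintegral_real; congr (_%:C).
  have pi_ : mu.-integrable setT (EFin \o (fun y => phi y * (2 * e n / (e n ^+ 2 + y ^+ 2)))).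
    have : mu.-integrable setT (EFin \o (fun y => 2 / e n * phi y)).
      have := integrableZl measurableT (2 / e n) phii.
      by apply: eq_integrable => // y _ /=; rewrite -EFinM.
    apply: le_integrable => //.
      apply/measurable_EFinP; apply: continuous_measurable_fun => x.
      apply: cvgM; first exact: cphi.
      apply: cvgM; first exact: cvg_cst.
      apply: cvgV; first by rewrite gt_eqF// ltr_pwDl ?sqr_ge0// exprn_gt0.
      by apply: cvgD; [exact: cvg_cst|apply: cvgM; exact: cvg_id].
    move=> y _ /=; rewrite lee_fin mulrC !normrM ler_wpM2r//.
    rewrite -!normrM ger0_norm ?mulr_ge0 ?invr_ge0 ?addr_ge0 ?sqr_ge0 ?(ltW (e0 n))//.
    rewrite ger0_norm ?mulr_ge0 ?invr_ge0 ?(ltW (e0 n))//.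
    rewrite -mulrA ler_wpM2l// ler_pdivrMr ?ltr_pwDl ?sqr_ge0 ?exprn_gt0//.
    by rewrite mulrC expr2 mulrDl mulfK ?lt0r_neq0// lerDl mulr_ge0 ?sqr_ge0// invr_ge0 ltW.
  have [_ ->] := Rintegral_affine 0 (e0 n) pi_.
  have [piA _] := Rintegral_affine 0 (e0 n) pi_.
  rewrite -RintegralZl//; apply: eq_Rintegral => u _; rewrite addr0 exprMn.
  have u0 : 1 + u ^+ 2 != 0 by rewrite gt_eqF// ltr_pwDl ?sqr_ge0.
  field; rewrite u0 exprMn -[X in X + _]mulr1 -mulrDr mulf_neq0//.
  by rewrite expf_neq0// lt0r_neq0.
have Ui : mu.-integrable setT (EFin \o (fun u => M * (2 * (1 + u ^+ 2)^-1))).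
  have := integrableZl measurableT (M * 2) integrable_cauchy.
  by apply: eq_integrable => // u _ /=; rewrite -EFinM mulrA.
have Rlim : \int[mu]_u (phi (e n * u) * (2 * (1 + u ^+ 2)^-1)) @[n --> \oo] -->
    2 * pi * phi 0.
  rewrite (_ : 2 * pi * phi 0 = \int[mu]_u (phi 0 * (2 * (1 + u ^+ 2)^-1))); last first.
    rewrite (@eq_Rintegral _ _ _ mu setT (fun u => (2 * phi 0) * (1 + u ^+ 2)^-1)); last first.
      by move=> u _; ring.
    rewrite RintegralZl//; last exact: integrable_cauchy.
    by rewrite /Rintegral integralT_cauchy /=; ring.
  apply: (cvg_Rintegral_dominated (g := (fun u => M * (2 * (1 + u ^+ 2)^-1)))) => //.
  - move=> n; apply: measurable_funM; last first.
      by apply: measurable_funM => //; exact: measurable_cauchy.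
    apply: (@measurableT_comp _ _ _ _ _ _ phi); first exact: continuous_measurable_fun.
    exact: measurable_funM.
  - by apply: measurable_funM => //; apply: measurable_funM => //; exact: measurable_cauchy.
  - move=> u; apply: cvgM; last exact: cvg_cst.
    have eu : e n * u @[n --> \oo] --> 0.
      by rewrite -(mul0r u); apply: cvgM; [|exact: cvg_cst].
    exact: (cvg_comp _ phi eu (cphi 0)).
  - move=> n u; rewrite normrM ler_pM// ger0_norm// mulr_ge0// invr_ge0.
    by rewrite addr_ge0// sqr_ge0.
have Llim (g : R -> R) : mu.-integrable setT (EFin \o g) ->
    \int[mu]_t (abel (e n) t * g t) @[n --> \oo] --> \int[mu]_t g t.
  move=> gi.
  have mg : measurable_fun setT (g : mR -> R) by move: gi => /measurable_int/measurable_EFinP.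
  apply: (cvg_Rintegral_dominated (g := fun t => `|g t|)) => //.
  - by move=> n; apply: measurable_funM => //; exact: measurable_abel.
  - move=> t; rewrite -[X in _ --> X]mul1r; apply: cvgM; last exact: cvg_cst.
    have eu : - (e n * `|t|) @[n --> \oo] --> 0.
      by rewrite -oppr0 -(mul0r `|t|); apply: cvgN; apply: cvgM => //; exact: cvg_cst.
    by rewrite -expR0; exact: (cvg_comp _ expR eu (@continuous_expR R 0)).
  - exact: integrable_norm.
  - move=> n t; rewrite normrM ger0_norm ?expR_ge0// ler_piMl//.
    by rewrite -expR0 ler_expR oppr_le0 mulr_ge0 ?(ltW (e0 n)).
have [Fi1 Fi2] := Fi.
apply: complex_eqP => /=.
  apply: (cvg_unique _ (Llim _ Fi1)) => //.
  move: Rlim; apply: cvg_trans; apply: near_eq_cvg; apply: nearW => n.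
  rewrite -[LHS]/(complex.Re (_%:C)) -key.
  by apply: eq_Rintegral => t _; rewrite ReM/= mul0r subr0.
apply: (cvg_unique _ (Llim _ Fi2)) => //.
apply: cvg_near_cst; apply: nearW => n.
transitivity (complex.Im (cintegral mu setT (fun t => (abel (e n) t)%:C * fourier phi t))).
  by apply: eq_Rintegral => t _; rewrite ImM/= mul0r addr0.
by rewrite key.
Qed.

(** Fubini's theorem moves the integral in x inside; since a character times the
    transform of phi is the transform of a translate of phi, inversion at the
    origin evaluates it at every point. *)
Lemma parseval (phi psi : R -> R) (M : R) :
  continuous phi -> mu.-integrable setT (EFin \o phi) ->
  (forall y, `|phi y| <= M) -> cintegrable mu setT (fourier phi) ->
  mu.-integrable setT (EFin \o psi) ->
  cintegral mu setT (fun x => fourier phi x * fourier psi (- x)) =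
  (2 * pi * \int[mu]_y (phi y * psi y))%:C.
Proof.
move=> cphi phii phiM Fi psii.
rewrite {2}/fourier (cintegral_swap (m1 := mu) (m2 := mu) (M := 1)
  (K := fun x y => cis (- x * y))); last 4 first.
- exact: Fi.
- exact: cintegrable_real.
- apply: cmeasurable_cis; apply: measurable_funM; last exact: measurable_snd.
  by apply: measurable_funN; exact: measurable_fst.
- by move=> x y; rewrite normc_cis.
have shiftE y x : fourier phi x * cis (- x * y) = fourier (fun z => phi (z + y)) x.
  have pi1 : cintegrable mu setT (fun z : mR => (phi z)%:C * cis (x * z)).
    exact/cintegrable_cis/cintegrable_real.
  have pi2 := cintegrableZ (cis (- x * y)) pi1.
  have [_ e] := cintegral_shift y pi2.
  rewrite /fourier mulrC -cintegralZ// -e; apply: eq_cintegral => z.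
  by rewrite mulrCA -cisD; congr (_ * cis _); ring.
have inner y : cintegral mu setT (fun x => fourier phi x * cis (- x * y)) =
    (2 * pi * phi y)%:C.
  under eq_fun do rewrite shiftE.
  rewrite (fourier_inversion0 (M := M)) ?add0r//.
  - by move=> z; apply: continuous_comp; [apply: cvgD; [exact: cvg_id|exact: cvg_cst]|exact: cphi].
  - have [] := cintegral_shift y (cintegrable_real phii).
    by move=> [].
  - have := cintegrable_cis (- y) Fi; apply: eq_cintegrable => x.
    by rewrite -shiftE; congr (_ * cis _); ring.
under eq_fun do rewrite inner -rmorphM/=.
rewrite cintegral_real; congr (_%:C).
rewrite -RintegralZl//; last first.
  have Mi : mu.-integrable setT (EFin \o (fun y => M * `|psi y|)).
    have := integrableZl measurableT M (integrable_norm psii).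
    by apply: eq_integrable => // y _ /=; rewrite -EFinM.
  apply: (le_integrable _ _ _ Mi) => //.
    apply/measurable_EFinP/measurable_funM; first exact: continuous_measurable_fun.
    by move: psii => /measurable_int/measurable_EFinP.
  move=> y _ /=; rewrite lee_fin normrM [leRHS]ger0_norm ?ler_wpM2r//.
  by rewrite mulr_ge0// (le_trans _ (phiM 0)).
by apply: eq_Rintegral => y _; ring.
Qed.

End fourier.

(** * The Gamma function on vertical lines *)

Section gamma_fourier.
Context {R : realType}.
Notation mu := (@lebesgue_measure R).
Local Notation mR := (measurableTypeR R).
Local Notation C := R[i].

(** The density of the Gamma integral after the substitution s = exp y. *)
Definition gdens (p y : R) : R := expR (p * y - expR y).

(** The density of the Beta integral, exp (p y) / (1 + exp y) ^ (p + q). *)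
Definition bdens (p q y : R) : R := expR (p * y - (p + q) * ln (1 + expR y)).

Lemma continuous_gdens p : continuous (gdens p).
Proof. by rewrite /gdens; solve_continuous. Qed.

Lemma continuous_ln1expR : continuous (fun y : R => ln (1 + expR y)).
Proof.
move=> y; apply: continuous_comp.
  by apply: cvgD; [exact: cvg_cst|exact: continuous_expR].
by apply: continuous_ln; rewrite addr_gt0// expR_gt0.
Qed.

Lemma continuous_bdens p q : continuous (bdens p q).
Proof.
have := continuous_ln1expR => cl.
by rewrite /bdens; solve_continuous.
Qed.

Lemma gdens_gt0 p y : 0 < gdens p y. Proof. exact: expR_gt0. Qed.
Lemma bdens_gt0 p q y : 0 < bdens p q y. Proof. exact: expR_gt0. Qed.

(** For y >= 0 the constant comes from exp y >= y ^ 2 / 2 by completing the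
    square; for y <= 0 the factor exp (p y) already decays. *)
Lemma gdens_le p y : 0 < p -> gdens p y <= expR (2 * p ^+ 2) * abel p y.
Proof.
move=> p0; rewrite /gdens /abel -expRD ler_expR.
have [y0|/ltW y0] := leP 0 y.
  rewrite ger0_norm//.
  have := @expR_ge1Dxn R y 1 y0; rewrite (_ : 2`! = 2)%N// => ey.
  have := sqr_ge0 (y - 2 * p); nra.
rewrite ler0_norm// mulrN opprK.
have := expR_gt0 y; have := sqr_ge0 p; nra.
Qed.

Lemma bdens_le p q y : 0 < p -> 0 < q -> bdens p q y <= abel (Num.min p q) y.
Proof.
move=> p0 q0; rewrite /bdens /abel ler_expR.
have mp : Num.min p q <= p by rewrite ge_min lexx.
have mq : Num.min p q <= q by rewrite ge_min lexx orbT.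
have [y0|/ltW y0] := leP 0 y.
  rewrite ger0_norm//.
  have : y <= ln (1 + expR y).
    by rewrite -[leLHS]expRK ler_ln ?posrE ?addr_gt0 ?expR_gt0// lerDr.
  nra.
rewrite ler0_norm//.
have : 0 <= ln (1 + expR y) by rewrite ln_ge0// lerDl expR_ge0.
nra.
Qed.

Lemma abel_le1 (e y : R) : 0 < e -> abel e y <= 1.
Proof. by move=> e0; rewrite /abel -expR0 ler_expR oppr_le0 mulr_ge0// ltW. Qed.

Lemma integrable_le_abel (f : R -> R) (c e : R) : 0 < e -> continuous f ->
  (forall y, `|f y| <= c * abel e y) -> mu.-integrable setT (EFin \o f).
Proof.
move=> e0 cf fle.
have ci : mu.-integrable setT (EFin \o (fun y => c * abel e y)).
  have := integrableZl measurableT c (integrable_abel e0).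
  by apply: eq_integrable => // y _ /=; rewrite -EFinM.
apply: (le_integrable _ _ _ ci) => //.
  by apply/measurable_EFinP; exact: continuous_measurable_fun.
move=> y _ /=; rewrite lee_fin [leRHS]ger0_norm//.
exact: le_trans (fle y).
Qed.

Lemma integrable_gdens p : 0 < p -> mu.-integrable setT (EFin \o gdens p).
Proof.
move=> p0; apply: (@integrable_le_abel _ (expR (2 * p ^+ 2)) _ p0 (@continuous_gdens p)) => y.
by rewrite (ger0_norm (ltW (gdens_gt0 _ _))) gdens_le.
Qed.

Lemma integrable_bdens p q : 0 < p -> 0 < q ->
  mu.-integrable setT (EFin \o bdens p q).
Proof.
move=> p0 q0.
have m0 : 0 < Num.min p q by rewrite lt_min p0.
apply: (@integrable_le_abel _ 1 _ m0 (@continuous_bdens p q)) => y.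
by rewrite mul1r (ger0_norm (ltW (bdens_gt0 _ _ _))) bdens_le.
Qed.

(** The substitution for an integrand of any sign: with a majorant H of |G|, the
    functions H + G and H are nonnegative and have difference G. *)
Lemma Rintegral_expR (G H : R -> R) :
  {in `]0, +oo[, continuous G} -> {in `]0, +oo[, continuous H} ->
  (forall s, 0 < s -> `|G s| <= H s) ->
  mu.-integrable setT (fun y => (H (expR y) * expR y)%:E) ->
  \int[mu]_(s in `]0, +oo[) G s = \int[mu]_y (G (expR y) * expR y).
Proof.
move=> cG cH GH Hi.
have H0 s : 0 < s -> 0 <= H s by move=> s0; rewrite (le_trans _ (GH s s0)).
have cHG : {in `]0, +oo[, continuous (fun s => H s + G s)}.
  by move=> s s0; apply: cvgD; [exact: cH|exact: cG].
have HG0 s : 0 < s -> 0 <= H s + G s.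
  move=> s0; rewrite -lerBlDr sub0r lerNl; have := GH s s0.
  by rewrite ler_norml => /andP[]; rewrite lerNl.
have mpos (F : R -> R) : {in `]0, +oo[, continuous F} ->
    measurable_fun (`](0 : R), +oo[%classic : set mR) F.
  by move=> cF; apply: open_continuous_measurable_fun => // x /set_mem; exact: cF.
have cE (F : R -> R) : {in `]0, +oo[, continuous F} ->
    continuous (fun y => F (expR y) * expR y).
  move=> cF y; apply: cvgM; last exact: continuous_expR.
  apply: (@continuous_comp _ _ _ expR F); first exact: continuous_expR.
  by apply: cF; rewrite in_itv/= andbT expR_gt0.
have Gi : mu.-integrable setT (EFin \o (fun y => G (expR y) * expR y)).
  apply: (le_integrable _ _ _ Hi) => //.
    by apply/measurable_EFinP; apply: continuous_measurable_fun; exact: cE.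
  move=> y _ /=; rewrite lee_fin !normrM ler_wpM2r//.
  by rewrite (le_trans (GH _ (expR_gt0 _)))// ler_norm.
have HGi : mu.-integrable setT (EFin \o (fun y => (H (expR y) + G (expR y)) * expR y)).
  have := integrableD measurableT Hi Gi.
  by apply: eq_integrable => // y _ /=; rewrite mulrDl.
have pull (F : R -> R) : {in `]0, +oo[, continuous F} ->
    (forall s, 0 < s -> 0 <= F s) ->
    mu.-integrable setT (EFin \o (fun y => F (expR y) * expR y)) ->
    mu.-integrable `]0, +oo[ (EFin \o F).
  move=> cF F0 Fi; apply/integrableP; split.
    by apply/measurable_EFinP; exact: mpos.
  rewrite (eq_integral (fun s : mR => (F s)%:E)); last first.
    by move=> s; rewrite inE/= in_itv/= andbT => s0; rewrite ger0_norm// F0.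
  rewrite ge0_integral_expR//.
  by have := integrable_fin_num measurableT Fi; rewrite fin_numE ltey => /andP[].
transitivity (\int[mu]_(s in `]0, +oo[) ((H s + G s) - H s)).
  by apply: eq_Rintegral => s _; rewrite addrC addKr.
rewrite RintegralB//; last 2 first.
- exact: (pull (fun s => H s + G s)).
- exact: pull.
rewrite {1 2}/Rintegral (ge0_integral_expR cHG HG0) (ge0_integral_expR cH H0).
rewrite -[LHS]RintegralB//.
by apply: eq_Rintegral => y _; ring.
Qed.

(** On the half-plane the Gamma function is the Fourier transform of its
    density, as a function of the imaginary part. *)
Lemma Gamma_fourier p x : 0 < p -> Gamma (p +i* x) = fourier (gdens p) x.
Proof.
move=> p0.
have contln (F : R -> R) : continuous F ->
    {in `]0, +oo[, continuous (fun s => expR (- s) * (expR ((p - 1) * ln s) * F (ln s)))}.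
  move=> cF s; rewrite in_itv/= andbT => s0.
  have cl : {for s, continuous (@ln R)} by exact: continuous_ln.
  apply: cvgM.
    apply: (@continuous_comp _ _ _ -%R expR); first exact: opp_continuous.
    exact: continuous_expR.
  apply: cvgM; last by apply: continuous_comp; [exact: cl|exact: cF].
  apply: (@continuous_comp _ _ _ (fun s => (p - 1) * ln s) expR).
    by apply: cvgM; [exact: cvg_cst|exact: cl].
  exact: continuous_expR.
have dens (F : R -> R) y :
    expR (- expR y) * (expR ((p - 1) * ln (expR y)) * F (ln (expR y))) * expR y =
    gdens p y * F y.
  rewrite expRK /gdens [RHS]mulrC [LHS]mulrC !mulrA [RHS]mulrC; congr (_ * F y).
  rewrite -!expRD; congr expR; ring.
have main (F : R -> R) : continuous F -> (forall y, `|F y| <= 1) ->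
    \int[mu]_(s in `]0, +oo[) (expR (- s) * (expR ((p - 1) * ln s) * F (ln s))) =
    \int[mu]_y (gdens p y * F y).
  move=> cF F1.
  rewrite (@Rintegral_expR _ (fun s => expR (- s) * (expR ((p - 1) * ln s) * 1))).
  - by apply: eq_Rintegral => y _; exact: dens.
  - exact: contln.
  - exact: (contln (fun=> 1) (@continuous_const R 1)).
  - move=> s s0; rewrite !normrM !(ger0_norm (expR_ge0 _)).
    by rewrite !ler_wpM2l// expR_ge0.
  - apply: eq_integrable (integrable_gdens p0) => // y _ /=.
    by rewrite (dens (fun=> 1)) mulr1.
have cmul (f : R -> R) : continuous f -> continuous (fun y => f (x * y)).
  by move=> cf y; apply: (@continuous_comp _ _ _ ( *%R x) f); [exact: mulrl_continuous|exact: cf].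
apply: complex_eqP => /=.
  rewrite (@eq_Rintegral _ _ _ mu setT (fun y => gdens p y * cos (x * y))); last first.
    by move=> y _; rewrite mul0r subr0.
  rewrite -(main (fun y => cos (x * y))); last 2 first.
  - exact/cmul/continuous_cos.
  - by move=> y; exact: cos_max.
  by apply: eq_Rintegral => s _; rewrite mul0r !subr0.
rewrite (@eq_Rintegral _ _ _ mu setT (fun y => gdens p y * sin (x * y))); last first.
  by move=> y _; rewrite mul0r addr0.
rewrite -(main (fun y => sin (x * y))); last 2 first.
- exact/cmul/continuous_sin.
- by move=> y; exact: sin_max.
by apply: eq_Rintegral => s _; rewrite mul0r addr0 subr0.
Qed.

End gamma_fourier.
Section gamma_theory.
Context {R : realType}.
Notation mu := (@lebesgue_measure R).
Local Notation mR := (measurableTypeR R).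
Local Notation C := R[i].
Implicit Types p q x y : R.

Definition rGamma (p : R) : R := \int[mu]_y gdens p y.

Lemma fourier0 (phi : R -> R) : fourier phi 0 = (\int[mu]_y phi y)%:C.
Proof.
rewrite -cintegral_real; apply: eq_cintegral => y.
by rewrite mul0r cis0 mulr1.
Qed.

Lemma Gamma_real p : 0 < p -> Gamma p%:C = (rGamma p)%:C.
Proof. by move=> p0; rewrite Gamma_fourier// fourier0. Qed.

(** The density is bounded below on the unit interval. *)
Lemma rGamma_gt0 p : 0 < p -> 0 < rGamma p.
Proof.
move=> p0.
have gi := integrable_gdens p0.
have I1 : mu.-integrable `[0, 1] (EFin \o gdens p).
  exact: (integrableS measurableT).
apply: (@lt_le_trans _ _ (\int[mu]_(y in `[0, 1]) gdens p y)); last first.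
  rewrite /rGamma /Rintegral fine_le//; try exact: integrable_fin_num.
  apply: ge0_subset_integral => //.
    by apply/measurable_EFinP; apply: continuous_measurable_fun; exact: continuous_gdens.
  by move=> y _; rewrite lee_fin ltW// gdens_gt0.
apply: (@lt_le_trans _ _ (\int[mu]_(y in `[0, 1]) expR (- expR 1))).
  rewrite Rintegral_cst//= lebesgue_measure_itv/= lte_fin ltr01 oppr0 adde0/=.
  by rewrite mulr1 expR_gt0.
apply: le_Rintegral => //.
  apply/integrableP; split; first exact/measurable_EFinP/measurable_cst.
  rewrite integral_cst//= lebesgue_measure_itv/= lte_fin ltr01 oppr0 adde0 mule1.
  exact: ltry.
move=> y /=; rewrite in_itv/= => /andP[y0 y1].
rewrite /gdens ler_expR.
by rewrite -[leLHS]add0r lerD ?mulr_ge0 ?(ltW p0)// lerN2 ler_expR.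
Qed.

Lemma gdensS p y : gdens (p + 1) y = expR y * gdens p y.
Proof. by rewrite /gdens -expRD; congr expR; ring. Qed.

Lemma is_derive_gdens p y :
  is_derive y (1 : R) (gdens p) (p * gdens p y - gdens (p + 1) y).
Proof.
rewrite gdensS; have := is_derive_exp_comp (is_derive_add
  (is_derive_scale p (is_derive_id y (1 : R))) (is_derive_neg (is_derive_expR y))).
by move/is_derive_eq; apply; rewrite -/(gdens p y); ring.
Qed.

Lemma cvg_gdensy p : 0 < p -> gdens p y @[y --> +oo] --> 0.
Proof.
move=> p0; apply: (@cvg0_le _ _ _ (fun y => expR (2 * p ^+ 2) * expR (- (p * y)))).
  move=> y; rewrite (ger0_norm (ltW (gdens_gt0 _ _))) (le_trans (gdens_le y p0))//.
  by rewrite ler_wpM2l ?expR_ge0// /abel ler_expR lerN2 ler_wpM2l ?(ltW p0)// ler_norm.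
rewrite -(mulr0 (expR (2 * p ^+ 2))); apply: cvgM; first exact: cvg_cst.
have poo : p * t @[t --> +oo] --> (+oo : set_system R).
  by apply: gt0_cvgMry => //; exact: cvg_id.
exact: (cvg_comp _ (fun t => expR (- t)) poo (@cvgr_expR R)).
Qed.

Lemma cvg_gdensNy p : 0 < p -> gdens p y @[y --> -oo] --> 0.
Proof.
move=> p0; apply/cvgNy_compNP.
apply: (@cvg0_le _ _ _ (fun y => expR (- (p * y)))).
  move=> y /=; rewrite (ger0_norm (ltW (gdens_gt0 _ _))) /gdens ler_expR.
  by rewrite mulrN gerDl oppr_le0 expR_ge0.
have poo : p * t @[t --> +oo] --> (+oo : set_system R).
  by apply: gt0_cvgMry => //; exact: cvg_id.
exact: (cvg_comp _ (fun t => expR (- t)) poo (@cvgr_expR R)).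
Qed.

(** The functional equation says that the total derivative of the Gamma density
    twisted by a character integrates to 0. *)
Lemma GammaS (z : C) : 0 < complex.Re z -> Gamma (z + 1) = z * Gamma z.
Proof.
case: z => p x /= p0.
have -> : (p +i* x) + 1 = ((p + 1) +i* x) :> C.
  by apply: complex_eqP; rewrite /= ?addr0.
have p10 : 0 < p + 1 by rewrite addr_gt0.
rewrite !Gamma_fourier//.
pose D y := (p +i* x) * ((gdens p y)%:C * cis (x * y)) +
  (- 1) * ((gdens (p + 1) y)%:C * cis (x * y)) : C.
have gi r : 0 < r -> cintegrable mu setT (fun y : mR => (gdens r y)%:C * cis (x * y)).
  by move=> r0; exact/cintegrable_cis/cintegrable_real/integrable_gdens.
have Di : cintegrable mu setT D.
  by apply: cintegrableD; apply: cintegrableZ; exact: gi.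
suff D0 : cintegral mu setT D = 0.
  move: D0; rewrite cintegralD; [|exact/cintegrableZ/gi..].
  by rewrite !cintegralZ ?mulN1r; [|exact: gi..] => /eqP; rewrite subr_eq0 => /eqP.
have ReD y : complex.Re (D y) = (p * gdens p y - gdens (p + 1) y) * cos (x * y) +
    gdens p y * (- sin (x * y) * x).
  by rewrite /D /=; ring.
have ImD y : complex.Im (D y) = (p * gdens p y - gdens (p + 1) y) * sin (x * y) +
    gdens p y * (cos (x * y) * x).
  by rewrite /D /=; ring.
have dxy y : is_derive y (1 : R) (fun y => x * y) x.
  have := is_derive_scale x (is_derive_id y (1 : R)).
  by move/is_derive_eq; apply; rewrite mulr1.
have c1 := @continuous_gdens R p; have c2 := @continuous_gdens R (p + 1).
have [Di1 Di2] := Di.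
have lim0 (f : R -> R) (F : set_system R) (FF : Filter F) : (forall y, `|f y| <= 1) ->
    gdens p y @[y --> F] --> 0 -> gdens p y * f y @[y --> F] --> 0.
  move=> f1; apply: cvg0_le => y.
  by rewrite normrM (ger0_norm (ltW (gdens_gt0 _ _))) ler_piMr// ltW// gdens_gt0.
have dc y : is_derive y (1 : R) (fun y => gdens p y * cos (x * y)) (complex.Re (D y)).
  rewrite ReD.
  exact: (is_derive_mul (is_derive_gdens p y) (is_derive_cos_comp (dxy y))).
have ds y : is_derive y (1 : R) (fun y => gdens p y * sin (x * y)) (complex.Im (D y)).
  rewrite ImD.
  exact: (is_derive_mul (is_derive_gdens p y) (is_derive_sin_comp (dxy y))).
apply: complex_eqP => /=.
  rewrite -[RHS](subrr 0); apply: (Rintegral_FTC dc) => //.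
  - by rewrite (funext ReD); solve_continuous.
  - by apply: lim0; [exact: (fun y => cos_max (x * y))|exact: cvg_gdensy].
  - by apply: lim0; [exact: (fun y => cos_max (x * y))|exact: cvg_gdensNy].
rewrite -[RHS](subrr 0); apply: (Rintegral_FTC ds) => //.
- by rewrite (funext ImD); solve_continuous.
- by apply: lim0; [exact: (fun y => sin_max (x * y))|exact: cvg_gdensy].
- by apply: lim0; [exact: (fun y => sin_max (x * y))|exact: cvg_gdensNy].
Qed.

Lemma poch0 (a : C) : poch a 0 = 1.
Proof. by rewrite /poch big_ord0. Qed.

Lemma pochSr (a : C) n : poch a n.+1 = poch a n * (a + n%:R).
Proof. by rewrite /poch big_ord_recr. Qed.

Lemma Re_natr n : complex.Re (n%:R : C) = n%:R.
Proof. by rewrite -(rmorph_nat (real_complex R)). Qed.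

Lemma Gamma_poch (z : C) n : 0 < complex.Re z ->
  Gamma (z + n%:R) = poch z n * Gamma z.
Proof.
move=> z0; elim: n => [|n ih]; first by rewrite addr0 poch0 mul1r.
rewrite -natr1 addrA GammaS; last by rewrite ReD Re_natr ltr_wpDr.
by rewrite ih pochSr mulrCA mulrA.
Qed.

Lemma normc_fourier (phi : R -> R) x : mu.-integrable setT (EFin \o phi) ->
  normc (fourier phi x) <= 2 * \int[mu]_y `|phi y|.
Proof.
move=> phii; rewrite (le_trans (normc_le1 _))// mulr_natl mulr2n.
have [f1 f2] := cintegrable_cis x (cintegrable_real phii).
have ni : mu.-integrable setT (EFin \o (fun y => `|phi y|)) by exact: integrable_norm.
have bnd (f : R -> R) : mu.-integrable setT (EFin \o f) ->
    (forall y, `|f y| <= `|phi y|) -> `|\int[mu]_y f y| <= \int[mu]_y `|phi y|.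
  move=> fi fle; rewrite (le_trans (le_normr_Rintegral _ _))//.
  by apply: le_Rintegral => //; exact: integrable_norm.
apply: lerD; apply: bnd => // y; rewrite /= mul0r ?subr0 ?addr0 normrM ler_piMr//.
  exact: cos_max.
exact: sin_max.
Qed.

Lemma continuous_fourier (phi : R -> R) : mu.-integrable setT (EFin \o phi) ->
  continuous (fun x => complex.Re (fourier phi x)) /\
  continuous (fun x => complex.Im (fourier phi x)).
Proof.
move=> phii.
have main (f : R -> R) : continuous f -> (forall y, `|f y| <= 1) ->
    continuous (fun x => \int[mu]_y (phi y * f (x * y))).
  move=> cf f1 x.
  have mphi : measurable_fun setT (phi : mR -> R) by move: phii => /measurable_int/measurable_EFinP.
  have fi (t : R) : mu.-integrable setT (EFin \o (fun y => phi y * f (t * y))).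
    apply: (le_integrable _ _ _ (integrable_norm phii)) => //.
      apply/measurable_EFinP; apply: measurable_funM => //.
      apply: (@measurableT_comp _ _ _ _ _ _ f); first exact: continuous_measurable_fun.
      exact: measurable_funM.
    by move=> y _ /=; rewrite lee_fin normrM normr_id ler_piMr.
  apply: (@continuity_under_integral _ _ _ mu (fun x y => phi y * f (x * y)) setT
    measurableT (x - 1) (x + 1) _ _ (fun y => `|phi y|)).
  - by move=> t _; exact: fi.
  - apply: aeW => y _ t _; apply: cvgM; first exact: cvg_cst.
    have ty : s * y @[s --> t] --> t * y by apply: cvgM; [exact: cvg_id|exact: cvg_cst].
    exact: (cvg_comp _ f ty (cf _)).
  - exact: integrable_norm.
  - by move=> t _; apply: aeW => y _; rewrite normrM ler_piMr.
  - by rewrite inE/= in_itv/= ltrBlDr ltrDl ltr01.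
split.
  rewrite (_ : (fun x => _) = (fun x => \int[mu]_y (phi y * cos (x * y)))).
    by apply: main; [exact: continuous_cos|exact: cos_max].
  by apply/funext => x; apply: eq_Rintegral => y _; rewrite /= mul0r subr0.
rewrite (_ : (fun x => _) = (fun x => \int[mu]_y (phi y * sin (x * y)))).
  by apply: main; [exact: continuous_sin|exact: sin_max].
by apply/funext => x; apply: eq_Rintegral => y _; rewrite /= mul0r addr0.
Qed.

Lemma cmeasurable_Gamma d (T : measurableType d) p (f : T -> R) :
  0 < p -> measurable_fun setT f ->
  cmeasurable (fun t => Gamma (p +i* f t)).
Proof.
move=> p0 mf; under eq_fun do rewrite Gamma_fourier//.
have [c1 c2] := continuous_fourier (integrable_gdens p0).
split.
  exact: (measurableT_comp (continuous_measurable_fun c1) mf).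
exact: (measurableT_comp (continuous_measurable_fun c2) mf).
Qed.

Lemma Gamma_bounded p : 0 < p ->
  exists M : R, 0 <= M /\ forall x, normc (Gamma (p +i* x)) <= M.
Proof.
move=> p0; exists (2 * \int[mu]_y `|gdens p y|); split.
  by rewrite mulr_ge0// Rintegral_ge0.
by move=> x; rewrite Gamma_fourier// normc_fourier//; exact: integrable_gdens.
Qed.

(** Boundedness on the line of real part p + 2 and the functional equation
    give quadratic decay on the line of real part p. *)
Lemma Gamma_decay p : 0 < p ->
  exists M : R, 0 <= M /\ forall x, normc (Gamma (p +i* x)) <= M * (1 + x ^+ 2)^-1.
Proof.
move=> p0; have [|M [M0 Mle]] := @Gamma_bounded (p + 2); first by rewrite addr_gt0.
pose m := Num.min 1 (p ^+ 2).
have m0 : 0 < m by rewrite lt_min ltr01 exprn_gt0.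
exists (M / m); split; first by rewrite divr_ge0// ltW.
move=> x.
have x0 : 0 < 1 + x ^+ 2 by rewrite ltr_pwDl ?sqr_ge0.
rewrite -mulrA -invfM ler_pdivlMr ?mulr_gt0//.
have G2 : Gamma ((p + 2) +i* x) = poch (p +i* x) 2 * Gamma (p +i* x).
  rewrite -Gamma_poch//; congr Gamma.
  by apply: complex_eqP; rewrite /= ?addr0.
rewrite (le_trans _ (Mle x))// G2 normcM mulrC ler_wpM2r ?normc_ge0//.
have -> : poch (p +i* x) 2 = ((p +i* x) * ((p + 1) +i* x) : C).
  rewrite /poch !big_ord_recl big_ord0 mulr1 addr0.
  by congr (_ * _); apply: complex_eqP; rewrite /= ?addr0.
have mp : m * (1 + x ^+ 2) <= p ^+ 2 + x ^+ 2.
  have m1 : m <= 1 by rewrite ge_min lexx.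
  have m2 : m <= p ^+ 2 by rewrite ge_min lexx orbT.
  by rewrite mulrDr mulr1 lerD// ler_piMl// sqr_ge0.
rewrite (le_trans mp)// normcM /= -{1}[p ^+ 2 + x ^+ 2]sqr_sqrtr ?addr_ge0 ?sqr_ge0//.
rewrite expr2 ler_wpM2l ?sqrtr_ge0// ler_sqrt ?addr_ge0 ?sqr_ge0// lerD2r.
by rewrite ler_sqr ?nnegrE ?lerDl// ?addr_ge0// ltW.
Qed.

End gamma_theory.

(** * Euler's Beta integral and Barnes's first lemma *)

Section barnes.
Context {R : realType}.
Notation mu := (@lebesgue_measure R).
Local Notation mR := (measurableTypeR R).
Local Notation C := R[i].
Implicit Types p q x y : R.
Opaque Gamma.

Lemma Rintegral_shift (b : R) (f : R -> R) : mu.-integrable setT (EFin \o f) ->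
  mu.-integrable setT (EFin \o (fun x => f (x + b))) /\
  \int[mu]_x f (x + b) = \int[mu]_x f x.
Proof.
move=> fi; have [gi ->] := Rintegral_affine b ltr01 fi.
have E : (fun x => f (1 * x + b)) = (fun x => f (x + b)).
  by apply/funext => x; rewrite mul1r.
rewrite -(mul1r (\int[mu]_x f (x + b))); split.
  by apply: eq_integrable gi => // x _ /=; rewrite mul1r.
by congr (_ * _); apply: eq_Rintegral => x _; rewrite mul1r.
Qed.

Lemma integral_EFin (f : mR -> R) : mu.-integrable setT (EFin \o f) ->
  (\int[mu]_x (f x)%:E = (\int[mu]_x f x)%:E)%E.
Proof. by move=> fi; rewrite /Rintegral fineK//; exact: (integrable_fin_num measurableT fi). Qed.

Lemma gdens_bdens p q w v : gdens q w * gdens p (v + w) =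
  bdens p q v * gdens (p + q) (w + ln (1 + expR v)).
Proof.
rewrite /gdens /bdens -!expRD; congr expR.
rewrite [expR (w + ln _)]expRD lnK ?posrE ?addr_gt0 ?expR_gt0// [expR (v + w)]expRD.
ring.
Qed.

(** Euler's Beta integral on a vertical line. In the product of two Gamma
    integrals, shifting one logarithmic variable by the other separates the
    variables. *)
Lemma Gamma_mul_fourier p q x : 0 < p -> 0 < q ->
  Gamma (p +i* x) * Gamma (q +i* - x) =
  (rGamma (p + q))%:C * fourier (bdens p q) x.
Proof.
move=> p0 q0; have pq0 : 0 < p + q by rewrite addr_gt0.
have gp := integrable_gdens p0; have gq := integrable_gdens q0.
have gpq := integrable_gdens pq0; have bpq := integrable_bdens p0 q0.
pose h (u : mR * mR) := gdens q u.1 * gdens p (u.2 + u.1).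
have hi : (mu \x mu)%E.-integrable setT (EFin \o h).
  apply/integrable12ltyP.
    apply/measurable_EFinP; apply: measurable_funM.
      apply: (measurableT_comp _ measurable_fst).
      exact: (continuous_measurable_fun (@continuous_gdens R q)).
    apply: (@measurableT_comp _ _ _ _ _ _ (gdens p)).
      exact: (continuous_measurable_fun (@continuous_gdens R p)).
    by apply: measurable_funD; [exact: measurable_snd|exact: measurable_fst].
  rewrite (_ : (fun w => _) = fun w => (gdens q w * rGamma p)%:E).
    have qi : mu.-integrable setT (EFin \o (fun w => gdens q w * rGamma p)).
      have := integrableZr measurableT (rGamma p) gq.
      by apply: eq_integrable => // w _ /=; rewrite EFinM.
    by rewrite integral_EFin// ltry.
  apply/funext => w; have [pi_ pe] := Rintegral_shift w gp.
  have wi : mu.-integrable setT (EFin \o (fun v => gdens q w * gdens p (v + w))).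
    have := integrableZl measurableT (gdens q w) pi_.
    by apply: eq_integrable => // v _ /=; rewrite EFinM.
  rewrite (eq_integral (fun v : mR => (gdens q w * gdens p (v + w))%:E)); last first.
    move=> v _; congr EFin.
    by apply: ger0_norm; apply: mulr_ge0; apply: ltW; exact: gdens_gt0.
  by rewrite (integral_EFin wi) (RintegralZl _ measurableT pi_) pe.
have hR w v : h (w, v) = bdens p q v * gdens (p + q) (w + ln (1 + expR v)).
  exact: gdens_bdens.
pose H u : C := (h u)%:C * cis (x * u.2).
have Hi : cintegrable (mu \x mu)%E setT H.
  apply: (cintegrable_bounded_mul (M := 1)); first exact: cintegrable_real.
    apply: cmeasurable_cis; apply: measurable_funM => //; exact: measurable_snd.
  by move=> u; rewrite normc_cis.
have H1 w : cintegrable mu setT (fun v => H (w, v)).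
  have [pi_ _] := Rintegral_shift w gp.
  have := cintegrableZ (gdens q w)%:C (cintegrable_cis x (cintegrable_real pi_)).
  by apply: eq_cintegrable => v; rewrite /H /h/= rmorphM/= mulrA.
have H2 v : cintegrable mu setT (fun w => H (w, v)).
  have [pi_ _] := Rintegral_shift (ln (1 + expR v)) gpq.
  have := cintegrableZ ((bdens p q v)%:C * cis (x * v)) (cintegrable_real pi_).
  by apply: eq_cintegrable => w; rewrite /H hR rmorphM/= mulrAC.
transitivity (cintegral (mu \x mu)%E setT H).
  rewrite cintegral_fubini1// mulrC !Gamma_fourier// {1}/fourier mulrC.
  rewrite -cintegralZ; last exact/cintegrable_cis/cintegrable_real.
  apply: eq_cintegral => w; rewrite mulrC /fourier.
  have [_ <-] := cintegral_shift w (cintegrable_cis x (cintegrable_real gp)).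
  have [pi_ _] := cintegral_shift w (cintegrable_cis x (cintegrable_real gp)).
  rewrite -cintegralZ//; apply: eq_cintegral => v; rewrite /H /h/=.
  have -> : cis (x * v) = cis (- x * w) * cis (x * (v + w)) :> C.
    by rewrite -cisD; congr cis; ring.
  by rewrite rmorphM/=; ring.
rewrite cintegral_fubini2// /fourier -cintegralZ; last exact/cintegrable_cis/cintegrable_real.
apply: eq_cintegral => v.
have [pi_ pe] := Rintegral_shift (ln (1 + expR v)) gpq.
transitivity (cintegral mu setT (fun w => ((bdens p q v)%:C * cis (x * v)) *
    (gdens (p + q) (w + ln (1 + expR v)))%:C)).
  by apply: eq_cintegral => w; rewrite /H hR rmorphM/= mulrAC.
rewrite cintegralZ; last exact: cintegrable_real.
by rewrite cintegral_real pe mulrC.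
Qed.

Lemma integral_bdens p q : 0 < p -> 0 < q ->
  \int[mu]_y bdens p q y = rGamma p * rGamma q / rGamma (p + q).
Proof.
move=> p0 q0; have pq0 : 0 < p + q by rewrite addr_gt0.
have := Gamma_mul_fourier 0 p0 q0.
rewrite oppr0 -[_ +i* 0]/(p%:C) -[q +i* 0]/(q%:C) !Gamma_real// fourier0.
rewrite -!rmorphM => /complexI ->.
by rewrite mulrC mulKf// lt0r_neq0// rGamma_gt0.
Qed.

Lemma cintegrable_GammaGamma p q : 0 < p -> 0 < q ->
  cintegrable mu setT (fun x => Gamma (p +i* x) * Gamma (q +i* - x)).
Proof.
move=> p0 q0.
have [M1 [M10 M1le]] := Gamma_decay p0; have [M2 [M20 M2le]] := Gamma_bounded q0.
apply: (@cintegrable_le _ _ _ mu _ (fun x : mR => M1 * M2 * (1 + x ^+ 2)^-1)).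
- apply: cmeasurableM; apply: cmeasurable_Gamma => //; exact: oppr_measurable.
- have := integrableZl measurableT (M1 * M2) integrable_cauchy.
  by apply: eq_integrable => // x _ /=; rewrite -EFinM.
- by move=> x; rewrite normcM mulrAC ler_pM ?normc_ge0.
Qed.

(** By Parseval's formula this is the integral of
    exp ((p + q) y - 2 exp y), and the factor 2 is absorbed by translating y by
    ln 2. *)
Lemma cintegral_GammaGamma p q : 0 < p -> 0 < q ->
  cintegral mu setT (fun x => Gamma (p +i* x) * Gamma (q +i* - x)) =
  (2 * pi * (2 `^ (- (p + q)) * rGamma (p + q)))%:C.
Proof.
move=> p0 q0; have pq0 : 0 < p + q by rewrite addr_gt0.
have Gi : cintegrable mu setT (fourier (gdens p)).
  have [M [M0 Mle]] := Gamma_decay p0.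
  apply: (@cintegrable_le _ _ _ mu _ (fun x : mR => M * (1 + x ^+ 2)^-1)).
  - have [c1 c2] := continuous_fourier (integrable_gdens p0).
    by split; [exact: (continuous_measurable_fun c1)|exact: (continuous_measurable_fun c2)].
  - have := integrableZl measurableT M integrable_cauchy.
    by apply: eq_integrable => // x _ /=; rewrite -EFinM.
  - by move=> x; rewrite -Gamma_fourier.
under eq_fun do rewrite !Gamma_fourier//.
rewrite (parseval (M := expR (2 * p ^+ 2)) (@continuous_gdens R p)); last 4 first.
- exact: integrable_gdens.
- move=> y; rewrite (ger0_norm (ltW (gdens_gt0 _ _))) (le_trans (gdens_le y p0))//.
  by rewrite ler_piMr ?expR_ge0// abel_le1.
- exact: Gi.
- exact: integrable_gdens.
congr ((_ * _)%:C).
have [pi_ pe] := Rintegral_shift (ln 2) (integrable_gdens pq0).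
rewrite /rGamma -pe.
rewrite -(RintegralZl _ measurableT pi_); apply: eq_Rintegral => y _.
rewrite /gdens /powR pnatr_eq0/= -!expRD; congr expR.
have e2 : expR (ln 2) = 2 :> R by apply: lnK; rewrite posrE ltr0n.
rewrite [expR (y + ln 2)]expRD e2; ring.
Qed.

Lemma Gamma_mul4E (a b c d x : R) : 0 < a -> 0 < b -> 0 < c -> 0 < d ->
  Gamma (a +i* x) * Gamma (b +i* x) * Gamma (c +i* - x) * Gamma (d +i* - x) =
  (rGamma (a + c) * rGamma (b + d))%:C *
    (fourier (bdens a c) x * fourier (bdens d b) (- x)).
Proof.
move=> a0 b0 c0 d0.
have E1 := Gamma_mul_fourier x a0 c0.
have E2 := Gamma_mul_fourier (- x) d0 b0.
rewrite opprK in E2.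
have perm (u v w z : C) : u * v * w * z = (u * w) * (z * v) by ring.
by rewrite perm E1 E2 (addrC d b) rmorphM/= mulrACA.
Qed.

Lemma cintegrable_barnes (a b c d : R) : 0 < a -> 0 < b -> 0 < c -> 0 < d ->
  cintegrable mu setT (fun x =>
    Gamma (a +i* x) * Gamma (b +i* x) * Gamma (c +i* - x) * Gamma (d +i* - x)).
Proof.
move=> a0 b0 c0 d0.
have [M1 [M10 M1le]] := Gamma_bounded b0; have [M2 [M20 M2le]] := Gamma_bounded d0.
have mG : cmeasurable (fun x : mR => Gamma (b +i* x) * Gamma (d +i* - x)).
  by apply: cmeasurableM; apply: cmeasurable_Gamma => //; exact: oppr_measurable.
have Gle x : normc (Gamma (b +i* x) * Gamma (d +i* - x)) <= M1 * M2.
  by rewrite normcM ler_pM ?normc_ge0.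
have perm (u v w z : C) : (u * w) * (v * z) = u * v * w * z by ring.
have := cintegrable_bounded_mul (cintegrable_GammaGamma a0 c0) mG Gle.
by apply: eq_cintegrable => x; exact: perm.
Qed.

(** Barnes's first lemma for positive parameters: by Parseval's formula and the
    Beta integral, both sides are an integral of a product of two Beta densities,
    which is again a Beta density. *)
Lemma cintegral_barnes (a b c d : R) : 0 < a -> 0 < b -> 0 < c -> 0 < d ->
  cintegral mu setT (fun x =>
    Gamma (a +i* x) * Gamma (b +i* x) * Gamma (c +i* - x) * Gamma (d +i* - x)) =
  (2 * pi * (rGamma (a + c) * rGamma (a + d) * rGamma (b + c) * rGamma (b + d) /
     rGamma (a + b + c + d)))%:C.
Proof.
move=> a0 b0 c0 d0.
have ac0 : 0 < a + c by rewrite addr_gt0.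
have bd0 : 0 < b + d by rewrite addr_gt0.
have ad0 : 0 < a + d by rewrite addr_gt0.
have bc0 : 0 < b + c by rewrite addr_gt0.
have Fi : cintegrable mu setT (fourier (bdens a c)).
  have := cintegrableZ ((rGamma (a + c))^-1)%:C (cintegrable_GammaGamma a0 c0).
  apply: eq_cintegrable => x; rewrite Gamma_mul_fourier// mulrA -rmorphM/=.
  by rewrite mulVf ?mul1r// lt0r_neq0// rGamma_gt0.
have le1 p q y : 0 < p -> 0 < q -> `|bdens p q y| <= 1.
  move=> p0 q0; rewrite (ger0_norm (ltW (bdens_gt0 _ _ _))).
  by rewrite (le_trans (bdens_le y p0 q0))// abel_le1// lt_min p0.
under eq_fun do rewrite Gamma_mul4E//.
rewrite cintegralZ; last first.
  apply: (@eq_cintegrable _ _ _ _ (fun x : mR => ((rGamma (a + c) * rGamma (b + d))^-1)%:C *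
    (Gamma (a +i* x) * Gamma (b +i* x) * Gamma (c +i* - x) * Gamma (d +i* - x)))).
    move=> x; rewrite Gamma_mul4E// mulrA -rmorphM/= mulVf ?mul1r//.
    by rewrite mulf_neq0// lt0r_neq0// rGamma_gt0.
  exact/cintegrableZ/cintegrable_barnes.
rewrite (parseval (M := 1) (@continuous_bdens R a c)); last 4 first.
- exact: integrable_bdens.
- by move=> y; exact: le1.
- exact: Fi.
- exact: integrable_bdens.
rewrite -rmorphM/=; congr (_%:C).
rewrite (@eq_Rintegral _ _ _ mu setT (bdens (a + d) (b + c))); last first.
  by move=> y _; rewrite /bdens -expRD; congr expR; ring.
rewrite integral_bdens// (_ : a + d + (b + c) = a + b + c + d); last by ring.
move: (rGamma (a + c)) (rGamma (b + d)) (rGamma (a + d)) (rGamma (b + c)).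
by move=> u v w z; ring.
Qed.

End barnes.

(** * Finite differences and Gram sums *)

Section pochhammer.
Context {R : realType}.
Local Notation C := R[i].
Implicit Types (a z s : C) (k n m q r : nat).

Lemma poch_add a m n : poch a (m + n) = poch a m * poch (a + m%:R) n.
Proof.
elim: n => [|n ih]; first by rewrite addn0 poch0 mulr1.
by rewrite addnS !pochSr ih natrD addrA mulrA.
Qed.

Lemma pochS a n : poch a n.+1 = a * poch (a + 1) n.
Proof. by rewrite -[n.+1]add1n poch_add pochSr poch0 mul1r addr0. Qed.

Lemma poch_neq0 a n : (forall i, a + i%:R != 0) -> poch a n != 0.
Proof. by move=> a0; apply/prodf_neq0 => i _. Qed.

Lemma poch_opp_nat k r : poch (- k%:R : C) r = (-1) ^+ r * (k ^_ r)%:R.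
Proof.
elim: r => [|r ih]; first by rewrite poch0 ffactn0 mul1r.
rewrite pochSr ih ffactnSr natrM exprS.
have [rk|kr] := leqP r k; first by rewrite natrB//; ring.
by rewrite ffact_small// mulr0 mul0r !mul0r mulr0.
Qed.

Lemma poch_opp_bin k r : poch (- k%:R : C) r / r`!%:R = (-1) ^+ r * 'C(k, r)%:R.
Proof.
rewrite poch_opp_nat -bin_ffact natrM; field.
by rewrite pnatr_eq0 -lt0n fact_gt0.
Qed.

Lemma poch_reflect s k : poch (1 - s - k%:R) k = (-1) ^+ k * poch s k.
Proof.
elim: k s => [|k ih] s; first by rewrite !poch0 mulr1.
rewrite pochSr (_ : 1 - s - k.+1%:R = 1 - (s + 1) - k%:R); last by rewrite -natr1; ring.
by rewrite ih pochS exprS; ring.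
Qed.

(** The value at 0 of the k-th finite difference of f, up to the sign
    (- 1) ^ k. *)
Definition altsum k (f : nat -> C) : C :=
  \sum_(r < k.+1) (-1) ^+ r * 'C(k, r)%:R * f r.

Lemma eq_altsum k (f g : nat -> C) : (forall r, (r <= k)%N -> f r = g r) ->
  altsum k f = altsum k g.
Proof. by move=> fg; apply: eq_bigr => r _; rewrite fg// -ltnS. Qed.

Lemma altsum0 (f : nat -> C) : altsum 0 f = f 0%N.
Proof. by rewrite /altsum big_ord_recl big_ord0 addr0 /= bin0 !mul1r. Qed.

Lemma altsumZ k c (f : nat -> C) : altsum k (fun r => c * f r) = c * altsum k f.
Proof. by rewrite /altsum mulr_sumr; apply: eq_bigr => r _; rewrite mulrCA. Qed.

Lemma altsumD k (f g : nat -> C) :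
  altsum k (fun r => f r + g r) = altsum k f + altsum k g.
Proof. by rewrite /altsum -big_split; apply: eq_bigr => r _; rewrite mulrDr. Qed.

(** Pascal's rule: one more difference is a difference of differences. *)
Lemma altsumS k (f : nat -> C) :
  altsum k.+1 f = altsum k f - altsum k (fun r => f r.+1).
Proof.
rewrite /altsum big_ord_recl /= bin0 expr0 !mul1r.
under eq_bigr => r _.
  rewrite /bump/= add1n binS natrD exprS mulrDr mulrDl; over.
rewrite big_split/= addrA; congr (_ + _).
  rewrite [RHS]big_ord_recl /= bin0 expr0 !mul1r; congr (_ + _).
  rewrite big_ord_recr/= bin_small// mulr0 mul0r addr0.
  by apply: eq_bigr => r _; rewrite /bump/= add1n exprS.
by rewrite -sumrN; apply: eq_bigr => r _; ring.
Qed.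

(** A difference lowers the degree, because the leading coefficients of p and of
    its translate agree. *)
Lemma altsum_poly k (p : {poly C}) : (size p <= k)%N ->
  altsum k (fun r => p.[r%:R]) = 0.
Proof.
elim: k p => [|k ih] p.
  by rewrite leqn0 size_poly_eq0 => /eqP ->; rewrite altsum0 horner0.
move=> pk; rewrite altsumS.
pose d := p - (p \Po ('X + 1%:P)).
transitivity (altsum k (fun r => d.[r%:R])).
  rewrite -mulN1r -altsumZ -altsumD; apply: eq_altsum => r _.
  by rewrite /d hornerD hornerN horner_comp hornerD hornerX hornerC natr1 mulN1r.
apply: ih; rewrite /d.
have [->|p0] := eqVneq p 0; first by rewrite comp_poly0 subrr size_poly0.
have sp : size (p \Po ('X + 1%:P)) = size p by rewrite size_comp_poly2// size_XaddC.
apply/leq_sizeP => j kj; rewrite coefB.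
have [pj|jp] := leqP (size p) j; first by rewrite !nth_default ?sp// subrr.
have pj : size p = j.+1.
  by apply/eqP; rewrite eqn_leq jp (leq_trans pk).
rewrite -[j]/(j.+1.-1) -pj -{2}sp -!lead_coefE.
by rewrite lead_coef_comp ?size_XaddC// lead_coefXaddC expr1n mulr1 subrr.
Qed.

Lemma altsum_inv k z : (forall i, z + i%:R != 0) ->
  altsum k (fun r => (z + r%:R)^-1) = k`!%:R / poch z k.+1.
Proof.
elim: k z => [|k ih] z z0.
  by rewrite altsum0 pochSr poch0 mul1r fact0 div1r.
have z1 i : z + 1 + i%:R != 0 by rewrite -addrA nat1r z0.
have := z0 0%N; rewrite addr0 => z00.
have p0 := poch_neq0 k z1.
have zk := z1 k.
rewrite altsumS ih// (_ : altsum k _ = altsum k (fun r => (z + 1 + r%:R)^-1)); last first.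
  by apply: eq_altsum => r _; rewrite -addrA -natr1 [1 + _]addrC.
rewrite ih// pochS [poch z k.+2]pochS !pochSr factS natrM -natr1.
by field; rewrite zk p0 z00.
Qed.

Lemma altsum_poch k z : altsum k (fun r => poch (z + r%:R) k) = (-1) ^+ k * k`!%:R.
Proof.
elim: k z => [|k ih] z; first by rewrite altsum0 poch0 fact0 mulr1.
rewrite altsumS -[- altsum _ _]mulN1r -altsumZ -altsumD.
rewrite (eq_altsum (g := fun r => - k.+1%:R * poch (z + 1 + r%:R) k)).
  by rewrite altsumZ ih factS natrM exprS; ring.
move=> r _; rewrite pochS pochSr -natr1 (_ : z + r%:R + 1 = z + 1 + r%:R).
  by rewrite (_ : z + (r%:R + 1) = z + 1 + r%:R) ?pochSr -?natr1; ring.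
ring.
Qed.

(** If the n-th row annihilates the columns below n, then summing first along the
    longer row kills every off-diagonal value, and on the diagonal only the last
    column is left. *)
Lemma gram_triangular (u w : nat -> nat -> C) :
  (forall r q, w r q = w q r) ->
  (forall n q, (q < n)%N -> \sum_(r < n.+1) u n r * w r q = 0) ->
  forall n m, \sum_(r < n.+1) \sum_(q < m.+1) u n r * u m q * w r q =
    (n == m)%:R * (u n n * \sum_(r < n.+1) u n r * w r n).
Proof.
move=> wC uw n m.
have low (i j : nat) : (j < i)%N ->
    \sum_(q < j.+1) \sum_(r < i.+1) u i r * u j q * w r q = 0.
  move=> ji; rewrite big1// => q _.
  transitivity (u j q * \sum_(r < i.+1) u i r * w r q).
    by rewrite mulr_sumr; apply: eq_bigr => r _; rewrite mulrCA mulrA.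
  by rewrite uw ?mulr0// (leq_trans (ltn_ord q)).
have [nm|mn|<-] := ltngtP n m.
- rewrite mul0r -[RHS](low m n nm); apply: eq_bigr => r _; apply: eq_bigr => q _.
  by rewrite wC [u n r * _]mulrC.
- by rewrite exchange_big mul0r /= low.
- rewrite mul1r exchange_big/= big_ord_recr/= big1 ?add0r; last first.
    move=> q _; transitivity (u n q * \sum_(r < n.+1) u n r * w r q).
      by rewrite mulr_sumr; apply: eq_bigr => r _; rewrite mulrCA mulrA.
    by rewrite uw ?mulr0.
  by rewrite mulr_sumr; apply: eq_bigr => r _; rewrite mulrCA mulrA.
Qed.

Definition poch_poly a n : {poly C} := \prod_(i < n) ('X + (a + i%:R)%:P).

Lemma size_poch_poly a n : size (poch_poly a n) = n.+1.
Proof.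
rewrite /poch_poly size_prod => [|i _]; last first.
  by rewrite -size_poly_eq0 size_XaddC.
under eq_bigr do rewrite size_XaddC.
by rewrite sum_nat_const card_ord muln2 -addnn subSn ?leq_addr// addnK.
Qed.

Lemma horner_poch_poly a n x : (poch_poly a n).[x] = poch (a + x) n.
Proof.
rewrite /poch_poly horner_prod; apply: eq_bigr => i _.
by rewrite hornerD hornerX hornerC addrCA addrA.
Qed.

(** The kernel (B)_(r+q) is (B)_r times a polynomial in r of degree q, and the
    coefficients cancel (B)_r up to an alternating binomial: the sum over r is an
    n-th difference of a polynomial of degree q. *)
Lemma gram_laguerre (B : C) n m : (forall i, B + i%:R != 0) ->
  \sum_(r < n.+1) \sum_(q < m.+1)
    poch (- n%:R) r / (poch B r * r`!%:R) *
    (poch (- m%:R) q / (poch B q * q`!%:R)) * poch B (r + q) =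
  (n == m)%:R * (n`!%:R / poch B n).
Proof.
move=> B0; have p0 j : poch B j != 0 by exact: poch_neq0.
have f0 j : j`!%:R != 0 :> C by rewrite pnatr_eq0 -lt0n fact_gt0.
pose u (n r : nat) := poch (- n%:R) r / (poch B r * r`!%:R) : C.
have uE i r q : u i r * poch B (r + q) =
    (-1) ^+ r * 'C(i, r)%:R * (poch_poly B q).[r%:R].
  rewrite -poch_opp_bin poch_add horner_poch_poly /u; field.
  by rewrite p0 pnatr_eq0 -lt0n fact_gt0.
have uw i q : \sum_(r < i.+1) u i r * poch B (r + q) =
    altsum i (fun r => (poch_poly B q).[r%:R]).
  by apply: eq_bigr => r _; exact: uE.
rewrite (gram_triangular (u := u) (w := fun r q => poch B (r + q))); last 2 first.
- by move=> r q; rewrite addnC.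
- by move=> i q qi; rewrite uw altsum_poly// size_poch_poly.
congr (_ * _); rewrite uw (eq_altsum (g := fun r => poch (B + r%:R) n)); last first.
  by move=> r _; rewrite horner_poch_poly.
rewrite altsum_poch /u poch_opp_nat ffactnn.
transitivity ((-1) ^+ n * (-1) ^+ n * (n`!%:R / poch B n)).
  by field; rewrite p0 f0.
by rewrite -expr2 sqrr_sign mul1r.
Qed.

(** For q < n the ratio of Pochhammer symbols depending on r is a polynomial, so
    that the sum over r is an n-th difference of a polynomial of degree n - 1. For
    q = n that ratio has a single simple pole; dividing (s + r)_n by the linear
    denominator leaves a polynomial of degree n - 1, which contributes 0, and the
    value of (s + r)_n at the pole times the difference of a reciprocal. *)
Lemma gram_jacobi (s : C) k l : (forall i, s + i%:R != 0) ->
  (forall i, 2 * s + i%:R != 0) ->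
  \sum_(r < k.+1) \sum_(q < l.+1)
    poch (- k%:R) r * poch (k%:R + 2 * s - 1) r / (poch s r * r`!%:R) *
    (poch (- l%:R) q * poch (l%:R + 2 * s - 1) q / (poch s q * q`!%:R)) *
    (poch s (r + q) / poch (2 * s) (r + q)) =
  (k == l)%:R * (k`!%:R * poch (k%:R + 2 * s - 1) k / poch (2 * s) (k + k)).
Proof.
move=> s0 ss0; have p0 j : poch s j != 0 by exact: poch_neq0.
have pp0 j : poch (2 * s) j != 0 by exact: poch_neq0.
have f0 j : j`!%:R != 0 :> C by rewrite pnatr_eq0 -lt0n fact_gt0.
pose u (n r : nat) := poch (- n%:R) r * poch (n%:R + 2 * s - 1) r / (poch s r * r`!%:R) : C.
pose w (r q : nat) := poch s (r + q) / poch (2 * s) (r + q) : C.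
have uE i r q : u i r * w r q = (-1) ^+ r * 'C(i, r)%:R *
    (poch (s + r%:R) q * (poch (i%:R + 2 * s - 1) r / poch (2 * s) (r + q))).
  by rewrite -poch_opp_bin /w /u poch_add; field; rewrite pp0 p0 f0.
rewrite (gram_triangular (u := u) (w := w)); last 2 first.
- by move=> r q; rewrite /w addnC.
- move=> [//|i] q qi.
  transitivity (altsum i.+1 (fun r => (poch (2 * s) i)^-1 *
      (poch_poly s q * poch_poly (2 * s + q%:R) (i - q)).[r%:R])).
    apply: eq_bigr => r _; rewrite uE; congr (_ * _).
    rewrite hornerM !horner_poch_poly [RHS]mulrCA; congr (_ * _).
    have e1 : poch (2 * s) (i + r) = poch (2 * s) i * poch (i.+1%:R + 2 * s - 1) r.
      by rewrite poch_add; congr (_ * poch _ _); rewrite -natr1; ring.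
    have e2 : poch (2 * s) (i + r) = poch (2 * s) (r + q) * poch (2 * s + q%:R + r%:R) (i - q).
      rewrite (_ : (i + r = (r + q) + (i - q))%N); last by rewrite -addnA subnKC// addnC.
      by rewrite poch_add natrD; congr (_ * poch _ _); ring.
    apply: (mulfI (pp0 i)); rewrite mulrA -e1 e2; field.
    by rewrite !pp0.
  rewrite altsumZ altsum_poly ?mulr0//.
  by rewrite size_mul -?size_poly_eq0 ?size_poch_poly//= addnS ltnS subnKC.
congr (_ * _).
case: k => [|k].
  by rewrite big_ord_recl big_ord0 /w /u !poch0 fact0; field.
pose z := 2 * s + k%:R.
have z0 i : z + i%:R != 0 by rewrite /z -addrA -natrD.
have zk : k.+1%:R + 2 * s - 1 = z by rewrite /z -[k.+1%:R]natr1; ring.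
have zpoch r : poch z r / poch (2 * s) (r + k.+1) = z / poch (2 * s) k.+1 * (z + r%:R)^-1.
  have e : poch z r * (z + r%:R) = z * poch (z + 1) r by rewrite -pochSr pochS.
  have z1 : poch (z + 1) r != 0.
    by apply: poch_neq0 => i; rewrite -addrA nat1r z0.
  have -> : poch (2 * s) (r + k.+1) = poch (2 * s) k.+1 * poch (z + 1) r.
    by rewrite addnC poch_add; congr (_ * poch _ _); rewrite /z -[k.+1%:R]natr1 addrA.
  apply: (mulIf (z0 r)); rewrite mulrAC e; field.
  by rewrite z0 pp0 z1.
(* Polynomial division of P by the denominator z + X of the remaining ratio. *)
pose P := poch_poly s k.+1.
have /factor_theorem[Q PQ] : root (P - (P.[- z])%:P) (- z).
  by rewrite rootE hornerD hornerN hornerC subrr.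
have sQ : (size Q <= k.+1)%N.
  have [->|Q0] := eqVneq Q 0; first by rewrite size_poly0.
  have : (size (P - (P.[- z])%:P)%R <= k.+2)%N.
    rewrite (leq_trans (size_polyD _ _))// geq_max size_polyN size_poch_poly leqnn.
    by rewrite (leq_trans (size_polyC_leq1 _)).
  by rewrite PQ size_mul ?polyXsubC_eq0// size_XsubC addn2.
have PE r : P.[r%:R] * (z + r%:R)^-1 = Q.[r%:R] + P.[- z] * (z + r%:R)^-1.
  have -> : P = Q * ('X - (- z)%:P) + (P.[- z])%:P by rewrite -PQ subrK.
  by rewrite !(hornerE, hornerD, hornerM); field; rewrite z0.
rewrite (eq_bigr (fun r : 'I_k.+2 => (-1) ^+ r * 'C(k.+1, r)%:R *
    (z / poch (2 * s) k.+1 * (Q.[r%:R] + P.[- z] * (z + r%:R)^-1)))); last first.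
  move=> r _; rewrite uE zk zpoch -PE horner_poch_poly; ring.
rewrite -/(altsum k.+1 (fun r => z / poch (2 * s) k.+1 * (Q.[r%:R] + P.[- z] * (z + r%:R)^-1))).
rewrite altsumZ altsumD altsum_poly// add0r altsumZ altsum_inv//.
rewrite horner_poch_poly (_ : s + - z = 1 - s - k.+1%:R); last by rewrite /z -[k.+1%:R]natr1; ring.
rewrite poch_reflect /u zk poch_opp_nat ffactnn [poch z k.+2]pochS.
have z1 : poch (z + 1) k.+1 != 0.
  by apply: poch_neq0 => i; rewrite -addrA nat1r z0.
have -> : poch (2 * s) (k.+1 + k.+1) = poch (2 * s) k.+1 * poch (z + 1) k.+1.
  by rewrite poch_add; congr (_ * poch _ _); rewrite /z -[k.+1%:R]natr1 addrA.
have z00 : z != 0 by have := z0 0%N; rewrite addr0.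
have sg : (-1) ^+ k.+1 * (-1) ^+ k.+1 = 1 :> C by rewrite -expr2 sqrr_sign.
move: sg; set e := (-1) ^+ k.+1 => sg.
transitivity (e * e * (k.+1`!%:R * poch z k.+1 / (poch (2 * s) k.+1 * poch (z + 1) k.+1))).
  by field; rewrite pp0 z1 p0 f0 z00.
by rewrite sg mul1r.
Qed.

End pochhammer.

(** * Legendre's duplication formula *)

Section duplication.
Context {R : realType}.
Notation mu := (@lebesgue_measure R).
Local Notation mR := (measurableTypeR R).
Local Notation C := R[i].
Implicit Types p q x y z : R.
Opaque Gamma.

Lemma rGammaS p : 0 < p -> rGamma (p + 1) = p * rGamma p.
Proof.
move=> p0; have p1 : 0 < p + 1 by rewrite addr_gt0.
have := @GammaS R p%:C p0.
rewrite -[1]/((1 : R)%:C) -rmorphD/= !Gamma_real// -rmorphM/=.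
by move/complexI.
Qed.

Lemma cvgy_expR : @expR R y @[y --> +oo] --> +oo.
Proof.
apply: (@ger_cvgy _ _ _ R id); last exact: cvg_id.
by apply: nearW => y; rewrite (le_trans _ (expR_ge1Dx y))// lerDr.
Qed.

Lemma rGamma1 : rGamma 1 = 1 :> R.
Proof.
have dF y : is_derive y (1 : R) (fun y => - expR (- expR y)) (gdens 1 y).
  have := is_derive_neg (is_derive_exp_comp (is_derive_neg (is_derive_expR y))).
  by move/is_derive_eq; apply; rewrite /gdens mulrN opprK mul1r -expRD addrC.
rewrite /rGamma (Rintegral_FTC dF (l1 := 0) (l2 := - 1)).
- by rewrite sub0r opprK.
- exact: continuous_gdens.
- exact: integrable_gdens.
- rewrite -oppr0; apply: cvgN.
  exact: (cvg_comp _ _ (@cvgy_expR) (@cvgr_expR R)).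
- apply: cvgN; rewrite -expR0.
  have e0 : - expR y @[y --> -oo] --> (0 : R).
    by rewrite -oppr0; apply: cvgN; apply/cvgNy_compNP; exact: cvgr_expR.
  exact: (cvg_comp _ _ e0 (@continuous_expR R 0)).
Qed.

Lemma integral_bdens_half : \int[mu]_y bdens 2^-1 2^-1 y = pi :> R.
Proof.
have dy y : is_derive y (1 : R) (fun y => 2^-1 * y) 2^-1.
  have := is_derive_scale 2^-1 (is_derive_id y (1 : R)).
  by move/is_derive_eq; apply; rewrite mulr1.
have dF y : is_derive y (1 : R) (fun y => 2 * atan (expR (2^-1 * y))) (bdens 2^-1 2^-1 y).
  have da := is_derive_exp_comp (dy y).
  have := is_derive_scale 2 (is_derive1_comp (f := @atan R)
    (g := fun y => expR (2^-1 * y)) (is_derive1_atan _) da).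
  move/is_derive_eq; apply.
  have e0 := expR_gt0 y.
  rewrite /bdens (_ : 2^-1 + 2^-1 = 1); last by field.
  rewrite mul1r expRD expRN lnK ?posrE ?addr_gt0// -expRM_natl.
  rewrite (_ : 2%:R * (2^-1 * y) = y); last by field.
  field; apply: lt0r_neq0; exact: addr_gt0.
have h0 : 0 < (2^-1 : R) by rewrite invr_gt0.
have hoo : 2^-1 * y @[y --> +oo] --> (+oo : set_system R).
  by apply: gt0_cvgMry => //; exact: cvg_id.
rewrite (Rintegral_FTC dF (l1 := 2 * (pi / 2)) (l2 := 2 * atan 0)).
- by rewrite atan0; field.
- exact: continuous_bdens.
- exact: integrable_bdens.
- apply: cvgM; first exact: cvg_cst.
  exact: (cvg_comp _ _ (cvg_comp _ _ hoo (@cvgy_expR)) (@cvgy_atan R)).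
- apply: cvgM; first exact: cvg_cst.
  have e0 : expR (2^-1 * y) @[y --> -oo] --> (0 : R).
    apply/cvgNy_compNP; rewrite (_ : _ \o _ = fun y => expR (- (2^-1 * y))).
      exact: (cvg_comp _ (fun y => expR (- y)) hoo (@cvgr_expR R)).
    by apply/funext => y /=; rewrite mulrN.
  exact: (cvg_comp _ _ e0 (@continuous_atan R 0)).
Qed.

Lemma rGamma_half : rGamma 2^-1 = Num.sqrt pi :> R.
Proof.
have h0 : 0 < (2^-1 : R) by rewrite invr_gt0.
have := integral_bdens h0 h0; rewrite integral_bdens_half.
have -> : 2^-1 + 2^-1 = 1 :> R by field.
rewrite rGamma1 divr1 -expr2 => ->.
by rewrite sqrtr_sqr ger0_norm// ltW// rGamma_gt0.
Qed.

(** 4 ^ z B (z, z), written so that z multiplies a function of y which is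
    nonpositive by the inequality of the arithmetic and geometric means. *)
Definition beta_diag z : R := \int[mu]_y expR (z * (ln 4 + y - 2 * ln (1 + expR y))).

(** B (z, 1 / 2). *)
Definition beta_half z : R := \int[mu]_y bdens z 2^-1 y.

Lemma powR2 z : 2 `^ (2 * z) = expR (z * ln 4).
Proof.
rewrite /powR pnatr_eq0/=; congr expR.
rewrite (_ : 4 = 2 * 2) ?lnM ?posrE//; last by rewrite -natrM.
ring.
Qed.

Lemma beta_diag_integrand z y :
  expR (z * (ln 4 + y - 2 * ln (1 + expR y))) = 2 `^ (2 * z) * bdens z z y.
Proof. by rewrite powR2 /bdens -expRD; congr expR; ring. Qed.

Lemma integrable_beta_diag z : 0 < z ->
  mu.-integrable setT (EFin \o (fun y => expR (z * (ln 4 + y - 2 * ln (1 + expR y))))).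
Proof.
move=> z0; have := integrableZl measurableT (2 `^ (2 * z)) (integrable_bdens z0 z0).
by apply: eq_integrable => // y _ /=; rewrite -EFinM beta_diag_integrand.
Qed.

Lemma beta_diagE z : 0 < z ->
  beta_diag z = 2 `^ (2 * z) * (rGamma z * rGamma z / rGamma (z + z)).
Proof.
move=> z0; rewrite -integral_bdens// -(RintegralZl _ measurableT (integrable_bdens z0 z0)).
by apply: eq_Rintegral => y _; rewrite beta_diag_integrand.
Qed.

Lemma beta_halfE z : 0 < z -> beta_half z = rGamma z * rGamma 2^-1 / rGamma (z + 2^-1).
Proof. by move=> z0; rewrite /beta_half integral_bdens// invr_gt0. Qed.

Lemma beta_diag_decr z1 z2 : 0 < z1 -> z1 <= z2 -> beta_diag z2 <= beta_diag z1.
Proof.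
move=> z10 z12; have z20 : 0 < z2 by exact: lt_le_trans z12.
apply: le_Rintegral => //; [exact: integrable_beta_diag|exact: integrable_beta_diag|].
move=> y _; rewrite ler_expR ler_wnM2r// subr_le0.
have e0 := expR_gt0 y.
have -> : ln 4 + y = ln (4 * expR y) by rewrite lnM ?posrE// expRK.
have -> : 2 * ln (1 + expR y) = ln ((1 + expR y) ^+ 2).
  by rewrite lnXn ?addr_gt0// mulr_natl.
rewrite ler_ln ?posrE ?mulr_gt0 ?exprn_gt0 ?addr_gt0//.
have := sqr_ge0 (1 - expR y); nra.
Qed.

Lemma beta_half_decr z1 z2 : 0 < z1 -> z1 <= z2 -> beta_half z2 <= beta_half z1.
Proof.
move=> z10 z12; have z20 : 0 < z2 by exact: lt_le_trans z12.
have h0 : 0 < (2^-1 : R) by rewrite invr_gt0.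
apply: le_Rintegral => //; [exact: integrable_bdens|exact: integrable_bdens|].
move=> y _; rewrite /bdens ler_expR.
have : y <= ln (1 + expR y).
  by rewrite -[leLHS]expRK ler_ln ?posrE ?addr_gt0 ?expR_gt0// lerDr.
nra.
Qed.

Definition beta_ratio z : R := beta_diag z / beta_half z.

Lemma beta_half_gt0 z : 0 < z -> 0 < beta_half z.
Proof.
by move=> z0; rewrite beta_halfE// divr_gt0 ?mulr_gt0 ?rGamma_gt0 ?addr_gt0 ?invr_gt0.
Qed.

Lemma beta_ratioE z : 0 < z -> beta_ratio z =
  2 `^ (2 * z) * rGamma z * rGamma (z + 2^-1) / (rGamma (z + z) * rGamma 2^-1).
Proof.
move=> z0; rewrite /beta_ratio beta_diagE// beta_halfE//.
have h0 : 0 < (2^-1 : R) by rewrite invr_gt0.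
have zh0 : 0 < z + 2^-1 by rewrite addr_gt0.
have zz0 : 0 < z + z by rewrite addr_gt0.
have := lt0r_neq0 (rGamma_gt0 z0); have := lt0r_neq0 (rGamma_gt0 h0).
have := lt0r_neq0 (rGamma_gt0 zh0); have := lt0r_neq0 (rGamma_gt0 zz0).
move: (rGamma z) (rGamma 2^-1) (rGamma (z + 2^-1)) (rGamma (z + z)) (2 `^ _).
by move=> a b c d e d0 c0 b0 a0; field; rewrite a0 b0 c0 d0.
Qed.

Lemma beta_ratio_half_periodic z : 0 < z -> beta_ratio (z + 2^-1) = beta_ratio z.
Proof.
move=> z0; have h0 : 0 < (2^-1 : R) by rewrite invr_gt0.
have zh0 : 0 < z + 2^-1 by rewrite addr_gt0.
have zz0 : 0 < z + z by rewrite addr_gt0.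
rewrite (beta_ratioE zh0) (beta_ratioE z0).
have -> : z + 2^-1 + 2^-1 = z + 1 by field.
have -> : z + 2^-1 + (z + 2^-1) = z + z + 1 by field.
have -> : 2 * (z + 2^-1) = 2 * z + 1 by field.
rewrite !rGammaS// powRD ?pnatr_eq0 ?implybT// powRr1//.
have := lt0r_neq0 z0.
have := lt0r_neq0 (rGamma_gt0 z0); have := lt0r_neq0 (rGamma_gt0 h0).
have := lt0r_neq0 (rGamma_gt0 zh0); have := lt0r_neq0 (rGamma_gt0 zz0).
move: (rGamma z) (rGamma 2^-1) (rGamma (z + 2^-1)) (rGamma (z + z)) (2 `^ _).
move=> a b c d e d0 c0 b0 a0 z1; field; rewrite ?b0 ?d0 ?z1 /=.
by rewrite -mulr2n -mulr_natl mulf_neq0// pnatr_eq0.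
Qed.

Lemma beta_ratio_periodic z n : 0 < z -> beta_ratio (z + n%:R / 2) = beta_ratio z.
Proof.
move=> z0; elim: n => [|n ih]; first by rewrite mul0r addr0.
rewrite -natr1 mulrDl mul1r addrA beta_ratio_half_periodic// ltr_wpDr//.
Qed.

Lemma beta_ratio_half n : beta_ratio (n.+1%:R / 2) = 2.
Proof.
have h0 : 0 < (2^-1 : R) by rewrite invr_gt0.
have -> : n.+1%:R / 2 = 2^-1 + n%:R / 2 :> R by rewrite -natr1; field.
rewrite beta_ratio_periodic// beta_ratioE//.
have -> : 2^-1 + 2^-1 = 1 :> R by field.
rewrite divff// powRr1// rGamma1; field.
exact/lt0r_neq0/rGamma_gt0.
Qed.

Lemma beta_halfS z : 0 < z -> beta_half (z + 1) = z / (z + 2^-1) * beta_half z.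
Proof.
move=> z0; have h0 : 0 < (2^-1 : R) by rewrite invr_gt0.
have zh0 : 0 < z + 2^-1 by rewrite addr_gt0.
have z1 : 0 < z + 1 by rewrite addr_gt0.
rewrite !beta_halfE// (_ : z + 1 + 2^-1 = z + 2^-1 + 1); last by ring.
rewrite !rGammaS// -mulf_div; ring.
Qed.

Opaque beta_diag beta_half.

Lemma ratio_squeeze (r w v v1 v2 : R) : 0 < r -> 0 < v -> w <= 2 * v1 ->
  2 * v2 <= w -> v <= v1 -> v2 <= v -> r * v1 <= v2 ->
  2 * r <= w / v <= 2 * r^-1.
Proof.
move=> r0 v0 w1 w2 vv1 vv2 rv; apply/andP; split.
  by rewrite ler_pdivlMr//; nra.
by rewrite ler_pdivrMr// mulrAC ler_pdivlMr//; nra.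
Qed.

(** The two sides of the duplication formula are Beta integrals decreasing in z
    whose ratio has period 1/2 and takes the value 2 at the half-integers;
    monotonicity then squeezes the ratio far out. *)
Lemma beta_ratio_eq2 z : 0 < z -> beta_ratio z = 2.
Proof.
move=> z0.
have WV x : 0 < x -> beta_ratio x = 2 -> beta_diag x = 2 * beta_half x.
  by move=> x0 <-; rewrite /beta_ratio divfK// lt0r_neq0// beta_half_gt0.
have bnd N : 2 * (N.+1%:R / (N.+1%:R + 1)) <= beta_ratio z <= 2 * ((N.+1%:R + 1) / N.+1%:R).
  (* Translating z by (N + 1) / 2 puts it between two consecutive half-integers
     n.+1 / 2 and n.+2 / 2, where the ratio is known to be 2. *)
  pose n := (Num.truncn (2 * z) + N)%N.
  pose z' := z + N.+1%:R / 2.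
  have z'0 : 0 < z' by rewrite addr_gt0// divr_gt0.
  have z20 : 0 <= 2 * z by rewrite mulr_ge0// ltW.
  have /andP[t1 t2] := Num.Theory.truncn_itv z20.
  have n1 : n.+1%:R / 2 <= z'.
    by rewrite /z' /n -addnS natrD; lra.
  have n2 : z' <= n.+2%:R / 2.
    move: t2; rewrite /z' /n -!addnS addnS -addSn natrD => t2; lra.
  have n0 : 0 < n.+1%:R / 2 :> R by rewrite divr_gt0.
  have n20 : 0 < n.+2%:R / 2 :> R by rewrite divr_gt0.
  have half_ratio (x : R) : 0 < x -> x / (x + 1) = x / 2 / (x / 2 + 2^-1).
    move=> x0; have x1 : x + 1 != 0 by rewrite gt_eqF// addr_gt0.
    by field; rewrite x1.
  have V12 : n.+1%:R / (n.+1%:R + 1) * beta_half (n.+1%:R / 2) <= beta_half (n.+2%:R / 2).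
    rewrite half_ratio ?ltr0n// -(beta_halfS n0); apply: (beta_half_decr n20).
    by rewrite -[n.+2%:R]natr1; lra.
  have r0 : 0 < N.+1%:R :> R by rewrite ltr0n.
  have rs : N.+1%:R / (N.+1%:R + 1) <= n.+1%:R / (n.+1%:R + 1) :> R.
    rewrite ler_pdivrMr ?addr_gt0// mulrAC ler_pdivlMr ?addr_gt0//.
    rewrite !mulrDr !mulr1 mulrC lerD2l ler_nat ltnS leq_addl//.
  rewrite -(beta_ratio_periodic N.+1 z0) -/z' /beta_ratio.
  rewrite -[(N.+1%:R + 1) / N.+1%:R]invf_div.
  apply: (@ratio_squeeze _ _ _ (beta_half (n.+1%:R / 2)) (beta_half (n.+2%:R / 2))).
  - by rewrite divr_gt0// addr_gt0.
  - exact: beta_half_gt0.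
  - rewrite -(WV _ n0 (beta_ratio_half n)); exact: beta_diag_decr.
  - rewrite -(WV _ n20 (beta_ratio_half n.+1)); exact: beta_diag_decr.
  - exact: beta_half_decr.
  - exact: beta_half_decr.
  - rewrite (le_trans _ V12)// ler_wpM2r//; exact/ltW/beta_half_gt0.
apply/le_anti/andP; split; rewrite leNgt; apply/negP => rho2.
  have d0 : 0 < beta_ratio z - 2 by rewrite subr_gt0.
  have /andP[_ t2] := Num.Theory.truncn_itv (divr_ge0 (ler0n R 2) (ltW d0)).
  have /andP[_] := bnd (Num.truncn (2 / (beta_ratio z - 2))).
  move: t2; set M := (Num.truncn _).+1%:R => t2.
  have M0 : 0 < M :> R by rewrite ltr0n.
  rewrite mulrA ler_pdivlMr// leNgt => /negP; apply.
  move: t2; rewrite ltr_pdivrMr//; lra.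
have d0 : 0 < 2 - beta_ratio z by rewrite subr_gt0.
have /andP[_ t2] := Num.Theory.truncn_itv (divr_ge0 (ler0n R 2) (ltW d0)).
have /andP[+ _] := bnd (Num.truncn (2 / (2 - beta_ratio z))).
move: t2; set M := (Num.truncn _).+1%:R => t2.
have M0 : 0 < M :> R by rewrite ltr0n.
rewrite mulrA ler_pdivrMr ?addr_gt0// leNgt => /negP; apply.
move: t2; rewrite ltr_pdivrMr//; lra.
Qed.

Lemma rGamma_duplication z : 0 < z ->
  rGamma (2 * z) = 2 `^ (2 * z - 1) * rGamma z * rGamma (z + 2^-1) / Num.sqrt pi.
Proof.
move=> z0; have h0 : 0 < (2^-1 : R) by rewrite invr_gt0.
have zh0 : 0 < z + 2^-1 by rewrite addr_gt0.
have zz0 : 0 < z + z by rewrite addr_gt0.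
have := beta_ratio_eq2 z0; rewrite beta_ratioE// -rGamma_half.
have -> : 2 * z = z + z by ring.
have -> : 2 `^ (z + z - 1) = 2 `^ (z + z) / 2 :> R.
  by rewrite powRB ?pnatr_eq0 ?implybT// powRr1.
have := lt0r_neq0 (rGamma_gt0 z0); have := lt0r_neq0 (rGamma_gt0 h0).
have := lt0r_neq0 (rGamma_gt0 zh0); have := lt0r_neq0 (rGamma_gt0 zz0).
move: (rGamma z) (rGamma 2^-1) (rGamma (z + 2^-1)) (rGamma (z + z)) (2 `^ _).
move=> a b c d e d0 c0 b0 a0 /(congr1 (fun u => u * d / 2)) E.
transitivity (2 * d / 2); first by field.
by rewrite -E; field; rewrite b0 d0.
Qed.

End duplication.

(** * The integral in t: Meixner-Pollaczek polynomials *)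

Section one_dimensional.
Context {R : realType}.
Notation mu := (@lebesgue_measure R).
Local Notation mR := (measurableTypeR R).
Local Notation C := R[i].
Implicit Types p u : R.
Opaque Gamma.

(** Past the index N every term contains the factor - N + N. *)
Lemma hypergeom_trunc (N : nat) (a b : seq C) (x : C) : - N%:R \in a ->
  hypergeom a b x = \sum_(n < N.+1)
    (\prod_(z <- a) poch z n) / (\prod_(z <- b) poch z n) * (x ^+ n / n`!%:R).
Proof.
move=> Na; rewrite /hypergeom.
set t := fun n : nat => _.
have t0 n : (N < n)%N -> t n = 0.
  move=> Nn; rewrite /t (big_rem _ Na)/= /poch (bigD1 (Ordinal Nn))//=.
  by rewrite addNr !mul0r.
apply: (@cvg_lim (R[i])^o); first exact: norm_hausdorff.
apply: cvg_near_cst; near=> n.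
rewrite /series/= (big_cat_nat (n := N.+1))//=; last by near: n; exact: nbhs_infty_ge.
rewrite [X in _ + X]big_nat_cond [X in _ + X]big1 ?addr0 ?big_mkord//.
by move=> i; rewrite andbT => /andP[Ni _]; exact: t0.
Unshelve. all: by end_near.
Qed.

Lemma complex_coord p u : (p +i* u) = p%:C + 'i%C * u%:C :> C.
Proof. by rewrite {1}[LHS]complexE. Qed.

Lemma complex_addn p u (r : nat) : ((p + r%:R) +i* u) = (p +i* u) + r%:R :> C.
Proof. by rewrite (complex_coord (p + r%:R) u) (complex_coord p u) rmorphD/= rmorph_nat addrAC. Qed.

Lemma Gamma_shift p u (r : nat) : 0 < p ->
  Gamma ((p + r%:R) +i* u) = Gamma (p +i* u) * poch (p +i* u) r.
Proof.
move=> p0; rewrite mulrC -Gamma_poch//; congr Gamma.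
exact: complex_addn.
Qed.

Lemma rGamma_shift p (r : nat) : 0 < p ->
  (rGamma (p + r%:R))%:C = (rGamma p)%:C * poch (p%:C : C) r.
Proof.
move=> p0; rewrite -!Gamma_real ?ltr_wpDr//.
exact: (Gamma_shift 0 r p0).
Qed.

Lemma poch_real_neq0 p n : 0 < p -> poch (p%:C : C) n != 0.
Proof.
move=> p0; apply: poch_neq0 => i.
rewrite -(rmorph_nat (real_complex R)) -rmorphD/= (inj_eq (@complexI R)).
by rewrite gt_eqF// ltr_wpDr.
Qed.

Lemma real_shift_neq0 p i : 0 < p -> p%:C + i%:R != 0 :> C.
Proof.
move=> p0; rewrite -(rmorph_nat (real_complex R)) -rmorphD/= (inj_eq (@complexI R)).
by rewrite gt_eqF// ltr_wpDr.
Qed.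

Definition meixner_coef (N : nat) (B : C) (r : nat) : C :=
  poch (- N%:R) r / poch B r * (2 ^+ r / r`!%:R).

(** The Pochhammer symbols of the argument shift the Gamma function, so that the
    polynomial times its Gamma factor is a sum of Gamma functions. *)
Lemma meixner_expand (N kap : nat) (p u : R) (B : C) : 0 < p ->
  Gamma (p +i* u) * (hypergeom [:: - N%:R; (p +i* u) + kap%:R] [:: B] 2 *
    poch (p +i* u) kap) =
  \sum_(r < N.+1) meixner_coef N B r * Gamma ((p + kap%:R + r%:R) +i* u).
Proof.
move=> p0; rewrite (@hypergeom_trunc N) ?mem_head// mulr_suml mulr_sumr.
have pk0 : 0 < p + kap%:R by rewrite ltr_wpDr.
apply: eq_bigr => r _; rewrite (Gamma_shift _ _ pk0) (Gamma_shift _ _ p0).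
rewrite !big_cons !big_nil !mulr1 /meixner_coef.
rewrite -complex_addn.
ring.
Qed.

Lemma cintegrable_double_sum (N M : nat) (c c' : nat -> C) (F : nat -> nat -> R -> C) :
  (forall r q, cintegrable mu setT (F r q)) ->
  cintegrable mu setT (fun x => \sum_(r < N.+1) \sum_(q < M.+1) c r * c' q * F r q x).
Proof.
move=> Fi; apply: cintegrable_sum => r; apply: cintegrable_sum => q.
exact: cintegrableZ.
Qed.

Lemma cintegral_double_sum (N M : nat) (c c' : nat -> C) (F : nat -> nat -> R -> C) :
  (forall r q, cintegrable mu setT (F r q)) ->
  cintegral mu setT (fun x => \sum_(r < N.+1) \sum_(q < M.+1) c r * c' q * F r q x) =
  \sum_(r < N.+1) \sum_(q < M.+1) c r * c' q * cintegral mu setT (F r q).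
Proof.
move=> Fi; rewrite cintegral_sum; last first.
  by move=> r; apply: cintegrable_sum => q; exact: cintegrableZ.
apply: eq_bigr => r _; rewrite cintegral_sum; last by move=> q; exact: cintegrableZ.
by apply: eq_bigr => q _; rewrite cintegralZ.
Qed.

Definition meixner_prod (N M kap lam : nat) (B B' : C) (b1 b2 t : R) : C :=
  (Gamma (b1 +i* - t) * (hypergeom [:: - N%:R; (b1 +i* - t) + kap%:R] [:: B] 2 *
    poch (b1 +i* - t) kap)) *
  (Gamma (b2 +i* t) * (hypergeom [:: - M%:R; (b2 +i* t) + lam%:R] [:: B'] 2 *
    poch (b2 +i* t) lam)).

Lemma meixner_prodE N M kap lam B B' b1 b2 : 0 < b1 -> 0 < b2 ->
  meixner_prod N M kap lam B B' b1 b2 = fun t =>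
  \sum_(r < N.+1) \sum_(q < M.+1) meixner_coef N B r * meixner_coef M B' q *
    (Gamma ((b2 + lam%:R + q%:R) +i* t) * Gamma ((b1 + kap%:R + r%:R) +i* - t)).
Proof.
move=> b10 b20; apply/funext => t.
transitivity ((\sum_(r < N.+1) meixner_coef N B r * Gamma ((b1 + kap%:R + r%:R) +i* - t)) *
    (\sum_(q < M.+1) meixner_coef M B' q * Gamma ((b2 + lam%:R + q%:R) +i* t))).
  by rewrite /meixner_prod; congr (_ * _); exact: meixner_expand.
rewrite mulr_suml.
apply: eq_bigr => r _; rewrite mulr_sumr.
apply: eq_bigr => q _.
have perm (x y z w : C) : (x * y) * (z * w) = x * z * (w * y) by ring.
exact: perm.
Qed.

Lemma cintegrable_meixner N M kap lam B B' b1 b2 : 0 < b1 -> 0 < b2 ->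
  cintegrable mu setT (meixner_prod N M kap lam B B' b1 b2).
Proof.
move=> b10 b20; rewrite meixner_prodE//.
apply: (@cintegrable_double_sum N M (meixner_coef N B) (meixner_coef M B') (fun r q t =>
  Gamma ((b2 + lam%:R + q%:R) +i* t) * Gamma ((b1 + kap%:R + r%:R) +i* - t))) => r q.
by apply: cintegrable_GammaGamma; rewrite ?ltr_wpDr.
Qed.

(** Orthogonality of the Meixner-Pollaczek polynomials: the integrals of products
    of shifted Gamma functions are 2 pi Gamma (B + r + q) / 2 ^ (B + r + q); the
    argument 2 of the hypergeometric series cancels the powers 2 ^ r and 2 ^ q,
    which leaves the moments of a Laguerre weight. *)
Lemma cintegral_meixner N M kap (b1 b2 B : R) : 0 < b1 -> 0 < b2 ->
  B = b1 + b2 + 2 * kap%:R ->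
  cintegral mu setT (meixner_prod N M kap kap B%:C B%:C b1 b2) =
  (2 * pi * (2 `^ (- B)))%:C * (rGamma B)%:C *
    ((N == M)%:R * (N`!%:R / poch B%:C N)).
Proof.
move=> b10 b20 BE.
have B0 : 0 < B by rewrite BE ltr_wpDr ?addr_gt0// mulr_ge0.
rewrite meixner_prodE// (@cintegral_double_sum N M (meixner_coef N B%:C) (meixner_coef M B%:C) (fun r q t =>
  Gamma ((b2 + kap%:R + q%:R) +i* t) * Gamma ((b1 + kap%:R + r%:R) +i* - t))); last first.
  by move=> r q; apply: cintegrable_GammaGamma; rewrite ?ltr_wpDr.
rewrite -(@gram_laguerre R B%:C); last by move=> i; exact: real_shift_neq0.
rewrite mulr_sumr; apply: eq_bigr => r _.
rewrite mulr_sumr; apply: eq_bigr => q _.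
rewrite cintegral_GammaGamma; [|by rewrite ?ltr_wpDr..].
have -> : b2 + kap%:R + q%:R + (b1 + kap%:R + r%:R) = B + (r + q)%:R.
  by rewrite BE natrD; ring.
have -> : 2 `^ (- (B + (r + q)%:R)) = 2 `^ (- B) * (2 ^+ r)^-1 * (2 ^+ q)^-1 :> R.
  rewrite opprD powRD ?pnatr_eq0 ?implybT// !powRN powR_mulrn// exprD invfM.
  by rewrite mulrA.
rewrite !rmorphM/= (rGamma_shift _ B0) /meixner_coef.
have two n : (2 ^+ n : C) != 0 by rewrite expf_neq0// pnatr_eq0.
have inv2 n : ((2 ^+ n)^-1)%:C = (2 ^+ n)^-1 :> C.
  by rewrite fmorphV rmorphXn rmorph_nat.
rewrite !inv2.
have f0 j : j`!%:R != 0 :> C by rewrite pnatr_eq0 -lt0n fact_gt0.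
have p0 j := poch_real_neq0 j B0.
move: (rGamma B)%:C (2 `^ (- B))%:C (2%:C) (pi%:C) (poch B%:C (r + q)) => g w t pp P.
by field; rewrite ?two ?f0 ?p0.
Qed.

End one_dimensional.

(** * The integrals in x: continuous Hahn polynomials *)

Section hahn.
Context {R : realType}.
Notation mu := (@lebesgue_measure R).
Local Notation mR := (measurableTypeR R).
Local Notation C := R[i].
Implicit Types p u : R.
Opaque Gamma rGamma.

Definition hahn_coef (k : nat) (c s t : C) (r : nat) : C :=
  poch (- k%:R) r * poch c r / (poch s r * poch t r * r`!%:R).

Lemma hahn_expand (k : nat) (c s t : C) p u : 0 < p ->
  Gamma (p +i* u) * hypergeom [:: - k%:R; c; p +i* u] [:: s; t] 1 =
  \sum_(r < k.+1) hahn_coef k c s t r * Gamma ((p + r%:R) +i* u).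
Proof.
move=> p0; rewrite (@hypergeom_trunc R k) ?mem_head// mulr_sumr.
apply: eq_bigr => r _; rewrite (Gamma_shift _ _ p0).
rewrite !big_cons !big_nil !mulr1 /hahn_coef expr1n !invfM.
move: (poch (- k%:R) r) (poch c r) (poch (p +i* u) r) (poch s r)^-1 (poch t r)^-1.
by move: (Gamma _) (r`!%:R^-1) => g f x y z w v; ring.
Qed.

Definition hahn_prod (k l : nat) (c1 c2 s1 s2 t1 t2 : C) (p1 p2 u : R) : C :=
  (Gamma (p1 +i* - u) * Gamma (p1 +i* u) *
    hypergeom [:: - k%:R; c1; p1 +i* u] [:: s1; t1] 1) *
  (Gamma (p2 +i* u) * Gamma (p2 +i* - u) *
    hypergeom [:: - l%:R; c2; p2 +i* - u] [:: s2; t2] 1).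

Lemma hahn_prodE k l c1 c2 s1 s2 t1 t2 p1 p2 : 0 < p1 -> 0 < p2 ->
  hahn_prod k l c1 c2 s1 s2 t1 t2 p1 p2 = fun u =>
  \sum_(r < k.+1) \sum_(q < l.+1) hahn_coef k c1 s1 t1 r * hahn_coef l c2 s2 t2 q *
    (Gamma ((p1 + r%:R) +i* u) * Gamma (p2 +i* u) *
     Gamma (p1 +i* - u) * Gamma ((p2 + q%:R) +i* - u)).
Proof.
move=> p10 p20; apply/funext => u.
transitivity (Gamma (p1 +i* - u) * (\sum_(r < k.+1) hahn_coef k c1 s1 t1 r * Gamma ((p1 + r%:R) +i* u)) *
    (Gamma (p2 +i* u) * (\sum_(q < l.+1) hahn_coef l c2 s2 t2 q * Gamma ((p2 + q%:R) +i* - u)))).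
  rewrite -(hahn_expand k c1 s1 t1 u p10) -(hahn_expand l c2 s2 t2 (- u) p20) /hahn_prod.
  by rewrite -!mulrA.
have sums (g1 g2 : C) (c c' F G : nat -> C) :
    g1 * (\sum_(r < k.+1) c r * F r) * (g2 * (\sum_(q < l.+1) c' q * G q)) =
    \sum_(r < k.+1) \sum_(q < l.+1) c r * c' q * (F r * g2 * g1 * G q).
  rewrite mulr_sumr mulr_suml; apply: eq_bigr => r _.
  by rewrite !mulr_sumr; apply: eq_bigr => q _; ring.
exact: (sums _ _ (hahn_coef k c1 s1 t1) (hahn_coef l c2 s2 t2)
  (fun r => Gamma ((p1 + r%:R) +i* u)) (fun q => Gamma ((p2 + q%:R) +i* - u))).
Qed.

Lemma cintegrable_hahn_term p1 p2 (r q : nat) : 0 < p1 -> 0 < p2 ->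
  cintegrable mu setT (fun u : mR => Gamma ((p1 + r%:R) +i* u) * Gamma (p2 +i* u) *
     Gamma (p1 +i* - u) * Gamma ((p2 + q%:R) +i* - u)).
Proof. by move=> p10 p20; apply: cintegrable_barnes; rewrite ?ltr_wpDr. Qed.

Lemma cintegrable_hahn k l c1 c2 s1 s2 t1 t2 p1 p2 : 0 < p1 -> 0 < p2 ->
  cintegrable mu setT (hahn_prod k l c1 c2 s1 s2 t1 t2 p1 p2).
Proof.
move=> p10 p20; rewrite hahn_prodE//.
apply: (@cintegrable_double_sum R k l (hahn_coef k c1 s1 t1) (hahn_coef l c2 s2 t2)
  (fun r q u => Gamma ((p1 + r%:R) +i* u) * Gamma (p2 +i* u) *
     Gamma (p1 +i* - u) * Gamma ((p2 + q%:R) +i* - u))) => r q.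
exact: cintegrable_hahn_term.
Qed.

(** Orthogonality of the continuous Hahn polynomials: by Barnes's lemma their
    Gram matrix in the basis of shifted Gamma functions consists of the moments
    (s)_(r+q) / (2 s)_(r+q) of a symmetric Beta distribution, so that
    orthogonality becomes that of shifted Gegenbauer polynomials. *)
Lemma cintegral_hahn k l p1 p2 s : 0 < p1 -> 0 < p2 -> s = p1 + p2 ->
  cintegral mu setT (hahn_prod k l (k%:R + 2 * s%:C - 1) (l%:R + 2 * s%:C - 1)
    s%:C s%:C (2 * p1)%:C (2 * p2)%:C p1 p2) =
  (2 * pi * (rGamma (2 * p1) * rGamma (2 * p2) * rGamma s ^+ 2 / rGamma (2 * s)))%:C *
  ((k == l)%:R * (k`!%:R * poch (k%:R + 2 * s%:C - 1) k / poch (2 * s%:C) (k + k))).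
Proof.
move=> p10 p20 sE; have s0 : 0 < s by rewrite sE addr_gt0.
have s20 : 0 < 2 * s by rewrite mulr_gt0.
have p120 : 0 < 2 * p1 by rewrite mulr_gt0.
have p220 : 0 < 2 * p2 by rewrite mulr_gt0.
have s2C : 2 * s%:C = (2 * s)%:C :> C by rewrite rmorphM/= rmorph_nat.
rewrite hahn_prodE// (@cintegral_double_sum R k l
  (hahn_coef k (k%:R + 2 * s%:C - 1) s%:C (2 * p1)%:C)
  (hahn_coef l (l%:R + 2 * s%:C - 1) s%:C (2 * p2)%:C)
  (fun r q u => Gamma ((p1 + r%:R) +i* u) * Gamma (p2 +i* u) *
     Gamma (p1 +i* - u) * Gamma ((p2 + q%:R) +i* - u))); last first.
  by move=> r q; exact: cintegrable_hahn_term.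
rewrite -(@gram_jacobi R s%:C); last 2 first.
- by move=> i; exact: real_shift_neq0.
- by move=> i; rewrite s2C; exact: real_shift_neq0.
rewrite mulr_sumr; apply: eq_bigr => r _.
rewrite mulr_sumr; apply: eq_bigr => q _.
rewrite cintegral_barnes; [|by rewrite ?ltr_wpDr..].
have -> : p1 + r%:R + p1 = 2 * p1 + r%:R by ring.
have -> : p1 + r%:R + (p2 + q%:R) = s + (r + q)%:R by rewrite sE natrD; ring.
have -> : p2 + p1 = s by rewrite sE addrC.
have -> : p2 + (p2 + q%:R) = 2 * p2 + q%:R by ring.
have -> : p1 + r%:R + p2 + p1 + (p2 + q%:R) = 2 * s + (r + q)%:R by rewrite sE natrD; ring.
rewrite /hahn_coef s2C.
move: p120 p220 s0 s20 => /[swap].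
move: (2 * p1) (2 * p2) (2 * s) (2 * pi) => q1 q2 ss tp q20 q10 s0 ss0.
have g0 : (rGamma ss)%:C != 0 :> C.
  by rewrite (inj_eq (@complexI R)) lt0r_neq0// rGamma_gt0.
have f0 j : j`!%:R != 0 :> C by rewrite pnatr_eq0 -lt0n fact_gt0.
have cancel_moments (x1 x2 x3 x4 g1 g2 g3 g4 : R)
    (u v w z P1 P2 S1 S2 SS TT F1 F2 : C) :
    x1%:C = g1%:C * P1 -> x2%:C = g2%:C * P2 -> x3%:C = g3%:C * SS ->
    x4%:C = g4%:C * TT -> g4%:C != 0 :> C ->
    P1 != 0 -> P2 != 0 -> S1 != 0 -> S2 != 0 -> TT != 0 -> F1 != 0 -> F2 != 0 ->
    u * v / (S1 * P1 * F1) * (w * z / (S2 * P2 * F2)) *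
      (tp * (x1 * x3 * g3 * x2 / x4))%:C =
    (tp * (g1 * g2 * g3 ^+ 2 / g4))%:C *
      (u * v / (S1 * F1) * (w * z / (S2 * F2)) * (SS / TT)).
  move=> E1 E2 E3 E4 e1 e2 e3 e4 e5 e6 e7 e8.
  rewrite expr2 !rmorphM !fmorphV/= E1 E2 E3 E4.
  by field; rewrite e1 e2 e3 e4 e5 e6 e7 e8.
exact: (cancel_moments _ _ _ _ _ _ _ _ _ _ _ _ _ _ _ _ _ _ _ _
  (rGamma_shift r q10) (rGamma_shift q q20) (rGamma_shift (r + q) s0)
  (rGamma_shift (r + q) ss0) g0 (poch_real_neq0 r q10) (poch_real_neq0 q q20)
  (poch_real_neq0 r s0) (poch_real_neq0 q s0) (poch_real_neq0 (r + q) ss0)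
  (f0 r) (f0 q)).
Qed.

Lemma cintegrable_half (f : R -> C) : cintegrable mu setT f ->
  cintegrable mu setT (fun x => f (x / 2)) /\
  cintegral mu setT (fun x => f (x / 2)) = 2 * cintegral mu setT f.
Proof.
move=> fi; have h0 : 0 < (2^-1 : R) by rewrite invr_gt0.
have [gi ge] := cintegral_affine 0 h0 fi.
have E : (fun x => f (2^-1 * x + 0)) = (fun x => f (x / 2)).
  by apply/funext => x; rewrite addr0 mulrC.
rewrite E in gi ge; split => //; rewrite ge mulrA fmorphV rmorph_nat mulfV ?mul1r//.
Qed.

End hahn.

(** * Products of one-dimensional integrals *)

Section tuples.
Context {R : realType}.
Notation mu := (@lebesgue_measure R).
Local Notation mR := (measurableTypeR R).
Local Notation C := R[i].

Lemma cintegral_tcons n (m : {sigma_finite_measure set (n.-tuple mR) -> \bar R})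
    (f : n.+1.-tuple mR -> C) : cmeasurable f ->
  cintegrable (lebesgue_line \x m)%E setT (f \o @tcons R n) ->
  cintegrable (tcons_measure m) setT f /\
  cintegral (tcons_measure m) setT f =
  cintegral (lebesgue_line \x m)%E setT (f \o @tcons R n).
Proof.
move=> [m1 m2] [i1 i2].
have push (h : n.+1.-tuple mR -> R) : measurable_fun setT h ->
    (lebesgue_line \x m)%E.-integrable setT (EFin \o (h \o @tcons R n)) ->
    (tcons_measure m).-integrable setT (EFin \o h) /\
    \int[tcons_measure m]_v h v = \int[(lebesgue_line \x m)%E]_p h (tcons p).
  move=> mh hi.
  have mh' : measurable_fun setT (EFin \o h) by exact/measurable_EFinP.
  have hi' : (lebesgue_line \x m)%E.-integrable (@tcons R n @^-1` setT)
      ((EFin \o h) \o @tcons R n) by rewrite preimage_setT.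
  split; first exact: (integrable_pushforward (@measurable_tcons R n) mh' hi').
  rewrite /Rintegral; congr fine.
  have := integral_pushforward (@measurable_tcons R n) mh' hi' measurableT.
  by rewrite preimage_setT.
have [j1 e1] := push _ m1 i1; have [j2 e2] := push _ m2 i2.
by split => //; apply: complex_eqP => /=.
Qed.

Lemma cmeasurable_prod_tuple n (g : 'I_n -> R -> C) :
  (forall j, cmeasurable (g j : mR -> C)) ->
  cmeasurable (fun v : n.-tuple mR => \prod_(j < n) g j (tnth v j)).
Proof.
move=> mg.
suff H (s : seq 'I_n) : cmeasurable (fun v : n.-tuple mR => \prod_(j <- s) g j (tnth v j)).
  exact: H.
elim: s => [|j s ih].
  by under eq_fun do rewrite big_nil; exact: cmeasurable_cst.
under eq_fun do rewrite big_cons.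
apply: cmeasurableM => //; have [m1 m2] := mg j; split.
  exact: (measurableT_comp m1 (measurable_tnth j)).
exact: (measurableT_comp m2 (measurable_tnth j)).
Qed.

Lemma cintegral_prod_tuple n (g : 'I_n -> R -> C) :
  (forall j, cintegrable mu setT (g j)) ->
  cintegrable (lebesgue_tuple R n) setT
    (fun v => \prod_(j < n) g j (tnth v j)) /\
  cintegral (lebesgue_tuple R n) setT (fun v => \prod_(j < n) g j (tnth v j)) =
  \prod_(j < n) cintegral mu setT (g j).
Proof.
elim: n g => [|n ih] g gi.
  rewrite big_ord0; under eq_fun do rewrite big_ord0; split.
    split; apply/integrableP; split; try exact: measurable_cst.
      by rewrite integral_dirac//= ?normr1 ?diracE ?mem_set// mul1e ltry.
    by rewrite integral_dirac//= ?normr0 ?diracE ?mem_set// mul1e ltry.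
  apply: complex_eqP; rewrite /= /Rintegral integral_dirac//= ?diracE ?mem_set//.
    by rewrite indicT mulr1.
  by rewrite mulr0.
have [ihi ihe] := ih (fun j => g (lift ord0 j)) (fun j => gi _).
have gE : (fun v : n.+1.-tuple mR => \prod_(j < n.+1) g j (tnth v j)) \o @tcons R n =
    (fun p => g ord0 p.1 * \prod_(j < n) g (lift ord0 j) (tnth p.2 j)).
  apply/funext => -[x v] /=; rewrite big_ord_recl; congr (_ * _).
  by apply: eq_bigr => j _; rewrite !(tnth_nth 0).
have [] := @cintegral_tcons n (lebesgue_tuple R n)
  (fun v => \prod_(j < n.+1) g j (tnth v j)).
- by apply: cmeasurable_prod_tuple => j; exact/cintegrable_measurable.
- by rewrite gE; exact: (@cintegrable_tensor _ _ _ _ _ lebesgue_line (lebesgue_tuple R n) _ _ (gi ord0) ihi).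
move=> fi ->; split; first exact: fi.
rewrite gE big_ord_recl -ihe.
exact: (@cintegral_tensor _ _ _ _ _ lebesgue_line (lebesgue_tuple R n) _ _ (gi ord0) ihi).
Qed.

End tuples.

(** * Norms, tail sums and telescoping products *)

Section norms.
Context {R : realType}.
Notation mu := (@lebesgue_measure R).
Local Notation C := R[i].
Opaque Gamma rGamma.

Lemma poch_double (z : C) k :
  poch (2 * z) (k + k) = 4 ^+ k * (poch z k * poch (z + 2^-1) k).
Proof.
elim: k => [|k ih]; first by rewrite !poch0 !mul1r.
rewrite addnS addSn !pochSr ih exprS -[(k + k).+1%:R]natr1 natrD.
by field.
Qed.

(** The norm of the continuous Hahn polynomials in Gegenbauer form; the
    duplication formula separates s from s + 1/2, which makes the product over
    the variables telescope. *)
Lemma hahn_norm_eval (s : R) (k : nat) : 0 < s ->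
  poch (2 * s%:C - 1) k != 0 ->
  (rGamma s ^+ 2 / rGamma (2 * s))%:C *
    (k`!%:R * poch (k%:R + 2 * s%:C - 1) k / poch (2 * s%:C) (k + k)) =
  (2 `^ (1 - 2 * s) * Num.sqrt pi)%:C *
    ((rGamma s)%:C / (rGamma (s + k%:R + 2^-1))%:C) *
    (k`!%:R * poch (s%:C - 2^-1) k / poch (2 * s%:C - 1) k).
Proof.
move=> s0 p0.
have s20 : 0 < 2 * s by rewrite mulr_gt0.
have sk0 : 0 < s + k%:R by rewrite ltr_wpDr.
have skh0 : 0 < s + k%:R + 2^-1 by rewrite addr_gt0// invr_gt0.
have s2C : 2 * s%:C = (2 * s)%:C :> C by rewrite rmorphM/= rmorph_nat.
have sq0 : Num.sqrt pi != 0 :> R by rewrite gt_eqF// sqrtr_gt0 pi_gt0.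
have E1 : (rGamma (2 * s))%:C * poch (2 * s%:C) (k + k) =
   (2 `^ (2 * s - 1))%:C * 4 ^+ k * ((rGamma s)%:C * poch s%:C k) *
     (rGamma (s + k%:R + 2^-1))%:C / (Num.sqrt pi)%:C.
  rewrite s2C -rGamma_shift// -rGamma_shift//.
  have -> : 2 * s + (k + k)%:R = 2 * (s + k%:R) by rewrite natrD; ring.
  rewrite rGamma_duplication//.
  have -> : 2 `^ (2 * (s + k%:R) - 1) = 2 `^ (2 * s - 1) * 4 ^+ k :> R.
    have -> : 2 * (s + k%:R) - 1 = 2 * s - 1 + (2 * k)%:R by rewrite natrM; ring.
    by rewrite powRD ?pnatr_eq0 ?implybT// powR_mulrn// exprM -natrX.
  by rewrite !rmorphM fmorphV rmorphXn/= rmorph_nat.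
have E2 : poch (2 * s%:C - 1) k * poch (k%:R + 2 * s%:C - 1) k =
    4 ^+ k * (poch (s%:C - 2^-1) k * poch s%:C k).
  have := poch_double (s%:C - 2^-1) k.
  have -> : 2 * (s%:C - 2^-1) = 2 * s%:C - 1 by field.
  rewrite subrK poch_add => <-; congr (_ * poch _ _); ring.
have pw : (2 `^ (1 - 2 * s))%:C = ((2 `^ (2 * s - 1))%:C)^-1 :> C.
  by rewrite -fmorphV -powRN opprB.
have nz (x : R) : x != 0 -> x%:C != 0 :> C by rewrite (inj_eq (@complexI R)).
have q0 := poch_real_neq0 (k + k) s20; have q1 := poch_real_neq0 k s0.
have w0 : (2 `^ (2 * s - 1))%:C != 0 :> C by apply/nz/lt0r_neq0/powR_gt0.
have g1 := nz _ (lt0r_neq0 (rGamma_gt0 s0)).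
have g2 := nz _ (lt0r_neq0 (rGamma_gt0 s20)).
have g3 := nz _ (lt0r_neq0 (rGamma_gt0 skh0)).
have h0 := nz _ sq0.
have f4 : 4 ^+ k != 0 :> C by rewrite expf_neq0// pnatr_eq0.
have L1 : (rGamma s ^+ 2 / rGamma (2 * s))%:C =
    (rGamma s)%:C ^+ 2 / (rGamma (2 * s))%:C :> C by rewrite rmorphM fmorphV rmorphXn.
have L2 : (2 `^ (1 - 2 * s) * Num.sqrt pi)%:C =
    ((2 `^ (2 * s - 1))%:C)^-1 * (Num.sqrt pi)%:C :> C by rewrite rmorphM/= pw.
rewrite L1 L2; rewrite -s2C in q0.
move: p0 E1 E2 q0 q1 w0 g1 g2 g3 h0 f4.
move: (poch (2 * s%:C - 1) k) (poch (2 * s%:C) (k + k)) (poch (k%:R + 2 * s%:C - 1) k).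
move: (poch (s%:C - 2^-1) k) (poch s%:C k) (rGamma (2 * s))%:C (rGamma s)%:C.
move: (rGamma (s + k%:R + 2^-1))%:C (2 `^ (2 * s - 1))%:C (Num.sqrt pi)%:C (4 ^+ k : C) (k`!%:R : C).
move=> g3 w h f fk ph p g2 g1 pm1 q pk e1 E1 E2 e2 e3 e4 e5 e6 e7 e8 e9.
have Eq : q = w * f * (g1 * p) * g3 / h / g2 by rewrite -E1 mulrC mulKf.
have Ek : pk = f * (ph * p) / pm1 by rewrite -E2 mulrC mulKf.
by rewrite Eq Ek; field; rewrite e1 e3 e4 e5 e6 e7 e8 e9.
Qed.

End norms.

Section indices.
Variables (d : nat) (k : 'I_d -> nat).

Lemma tailsum_last : tailsum k d = 0%N.
Proof. by rewrite /tailsum big_pred0// => i; rewrite leqNgt ltn_ord. Qed.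

Lemma tailsumS (j : 'I_d) : tailsum k j = (k j + tailsum k j.+1)%N.
Proof.
rewrite /tailsum (bigD1 j)//=; congr addn; apply: eq_bigl => i.
by rewrite [RHS]ltn_neqAle andbC -val_eqE eq_sym.
Qed.

End indices.

Section products.
Context {R : realType}.
Local Notation C := R[i].

Lemma prod_telescope (F : fieldType) n (f : nat -> F) :
  (forall i, (i <= n)%N -> f i != 0) ->
  \prod_(j < n) (f j.+1 / f j) = f n / f 0%N.
Proof.
elim: n => [|n ih] f0; first by rewrite big_ord0 divff// f0.
rewrite big_ord_recr/= ih; last by move=> i ni; rewrite f0// ltnW.
by field; rewrite !f0.
Qed.

Lemma prod_powR2 d (a : R) :
  \prod_(j < d) 2 `^ (2 - 2 * a - (d - j.+1)%:R) =
  2 `^ (2 * d%:R - 2 * d%:R * a - 'C(d, 2)%:R).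
Proof.
elim: d => [|d ih]; first by rewrite big_ord0 !mulr0 mul0r !subr0 powRr0.
rewrite big_ord_recl subn1/=.
under eq_bigr do rewrite /bump/= add1n subSS.
rewrite ih -powRD ?pnatr_eq0 ?implybT// binS bin1 natrD -natr1.
by congr (_ `^ _); ring.
Qed.

Lemma exponent2E d kap (a b : R) : (0 < d)%N ->
  exponent2 d kap a b = 2 * d%:R - 2 * d%:R * a - 'C(d, 2)%:R - (b + 2 * kap%:R).
Proof.
case: d => // d _; rewrite /exponent2 /= binS bin1 natrD -natr1; ring.
Qed.

End products.

(** * Factorization of the integrand *)

Section factorization.
Context {R : realType}.
Notation mu := (@lebesgue_measure R).
Local Notation mR := (measurableTypeR R).
Local Notation C := R[i].
Variables (d : nat) (a1 a2 b1 b2 : R) (k l : 'I_d -> nat) (n m : nat).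
Hypotheses (ha1 : 0 < a1) (ha2 : 0 < a2).
Opaque Gamma rGamma hypergeom.

Lemma coord_arg (a x : R) (K e : nat) :
  a%:C + (K%:R + 'i%C * x%:C) / 2 + e%:R / 4 =
  ((a + K%:R / 2 + e%:R / 4) +i* (x / 2)) :> C.
Proof.
rewrite (complex_coord (a + K%:R / 2 + e%:R / 4) (x / 2)) !rmorphD !rmorphM.
rewrite !fmorphV !rmorph_nat/=.
by field.
Qed.

Lemma Afun_hahnE (t : C) (x : 'I_d -> C) :
  Afun n k t x a1%:C a2%:C b1%:C b2%:C =
  Afun_hahn n k t x a1%:C a2%:C b1%:C b2%:C.
Proof.
congr (_ * _); apply: eq_bigr => j _ /=.
have e0 : 0 <= (d - j.+1)%:R / 2 :> R by rewrite divr_ge0.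
have P1 : poch ((tailsum k j.+1)%:R + 2 * a1%:C + (d - j.+1)%:R / 2) (k j) != 0 :> C.
  have -> : (tailsum k j.+1)%:R + 2 * a1%:C + (d - j.+1)%:R / 2 =
      ((tailsum k j.+1)%:R + 2 * a1 + (d - j.+1)%:R / 2)%:C :> C.
    by rewrite !rmorphD !rmorphM fmorphV !rmorph_nat.
  by apply: poch_real_neq0; rewrite ltr_wpDr// ltr_wpDl// mulr_gt0.
have P2 : poch ((tailsum k j.+1)%:R + (a1%:C + a2%:C) + (d - j.+1)%:R / 2) (k j) != 0 :> C.
  have -> : (tailsum k j.+1)%:R + (a1%:C + a2%:C) + (d - j.+1)%:R / 2 =
      ((tailsum k j.+1)%:R + (a1 + a2) + (d - j.+1)%:R / 2)%:C :> C.
    by rewrite !rmorphD rmorphM fmorphV !rmorph_nat.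
  by apply: poch_real_neq0; rewrite ltr_wpDr// ltr_wpDl// addr_gt0.
have f0 : (k j)`!%:R != 0 :> C by rewrite pnatr_eq0 -lt0n fact_gt0.
have i0 : 'i%C ^+ k j != 0 :> C.
  by rewrite expf_neq0// eq_complex/= oner_eq0 andbF.
rewrite /cont_hahn.
set K : C := (tailsum k j.+1)%:R in P1 P2 *; set e : C := (d - j.+1)%:R in P1 P2 *.
have -> : a1%:C + K / 2 + e / 4 + (a2%:C + K / 2 + e / 4) = K + (a1%:C + a2%:C) + e / 2 by field.
have -> : a1%:C + K / 2 + e / 4 + (a1%:C + K / 2 + e / 4) = K + 2 * a1%:C + e / 2 by field.
have -> : (k j)%:R + (a1%:C + K / 2 + e / 4) + (a2%:C + K / 2 + e / 4) +
    (a2%:C + K / 2 + e / 4) + (a1%:C + K / 2 + e / 4) - 1 =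
    (k j)%:R + 2 * (K + (a1%:C + a2%:C) + (e - 1) / 2) by field.
have -> : a1%:C + K / 2 + e / 4 + 'i%C * - ('i%C * x j / 2) = a1%:C + (K + x j) / 2 + e / 4.
  have -> : 'i%C * - ('i%C * x j / 2) = - ('i%C ^+ 2) * (x j / 2) by rewrite expr2; ring.
  by rewrite sqr_i opprK mul1r; field.
move: (hypergeom _ _ _) (Gamma _) (Gamma _) P1 P2 f0 i0.
move: (poch _ _) (poch _ _) ('i%C ^+ k j) ((k j)`!%:R) => u v w f h g1 g2 u0 v0 f0 w0.
by field; rewrite u0 v0 f0 w0.
Qed.

(** The parameters alpha_j and alpha_j' of the Hahn polynomials; the first is
    attached to k, the second to l. *)
Definition hahn_re1 (j : 'I_d) : R := a1 + (tailsum k j.+1)%:R / 2 + (d - j.+1)%:R / 4.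
Definition hahn_re2 (j : 'I_d) : R := a2 + (tailsum l j.+1)%:R / 2 + (d - j.+1)%:R / 4.

(** The variable is u = x_j / 2. *)
Definition x_factor (j : 'I_d) (u : R) : C :=
  let K : C := (tailsum k j.+1)%:R in
  let L : C := (tailsum l j.+1)%:R in
  let e : C := (d - j.+1)%:R in
  hahn_prod (k j) (l j)
    ((k j)%:R + 2 * (K + (a1%:C + a2%:C) + (e - 1) / 2))
    ((l j)%:R + 2 * (L + (a2%:C + a1%:C) + (e - 1) / 2))
    (K + (a1%:C + a2%:C) + e / 2) (L + (a2%:C + a1%:C) + e / 2)
    (K + 2 * a1%:C + e / 2) (L + 2 * a2%:C + e / 2) (hahn_re1 j) (hahn_re2 j) u.

Definition t_factor (t : R) : C :=
  meixner_prod (n - wt k) (m - wt l) (wt k) (wt l)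
    (2 * (wt k)%:R + (b1%:C + b2%:C)) (2 * (wt l)%:R + (b2%:C + b1%:C)) b1 b2 t.

Lemma integrandE (hn : (wt k <= n)%N) (hm : (wt l <= m)%N) :
  integrand n m k l a1%:C a2%:C b1%:C b2%:C =
  fun p => t_factor p.1 * \prod_(j < d) x_factor j (tnth p.2 j / 2).
Proof.
apply/funext => -[t v]; rewrite /integrand /Afun /Afun_t /t_factor /meixner_prod /=.
have bm : b1%:C - 'i%C * t%:C = (b1 +i* - t) :> C.
  by rewrite (complex_coord b1 (- t)) rmorphN/= mulrN.
have bp : b2%:C + 'i%C * t%:C = (b2 +i* t) :> C by rewrite (complex_coord b2 t).
rewrite !opprK bm bp.
have -> : b1%:C + (wt k)%:R - 'i%C * t%:C = (b1 +i* - t) + (wt k)%:R :> C.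
  by rewrite -bm addrAC.
have -> : b2%:C + (wt l)%:R + 'i%C * t%:C = (b2 +i* t) + (wt l)%:R :> C.
  by rewrite -bp addrAC.
have nE (i j : nat) : (j <= i)%N -> - i%:R + j%:R = - (i - j)%:R :> C.
  by move=> ji; rewrite natrB// opprB addrC.
rewrite !nE//.
have regroup (u1 u2 u3 u4 u5 u6 f g : C) :
  u1 * u2 * ((u3 * u4) * f) * ((u5 * u6) * g) = (u1 * (u3 * u4)) * (u2 * (u5 * u6)) * (f * g).
  by ring.
rewrite regroup -big_split/=; congr (_ * _); apply: eq_bigr => j _.
rewrite /x_factor /hahn_prod /hahn_re1 /hahn_re2.
have cp a K := coord_arg a (tnth v j) K (d - j.+1).
have cm a K : a%:C + (K%:R - 'i%C * (tnth v j)%:C) / 2 + (d - j.+1)%:R / 4 =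
    ((a + K%:R / 2 + (d - j.+1)%:R / 4) +i* - (tnth v j / 2)) :> C.
  have := coord_arg a (- tnth v j) K (d - j.+1).
  by rewrite rmorphN/= mulrN mulNr.
by rewrite opprK !cp !cm.
Qed.

End factorization.

(** * Evaluation of the factors *)

Section evaluation.
Context {R : realType}.
Notation mu := (@lebesgue_measure R).
Local Notation mR := (measurableTypeR R).
Local Notation C := R[i].
Variables (d : nat) (a1 a2 : R) (k : 'I_d -> nat).
Hypotheses (ha1 : 0 < a1) (ha2 : 0 < a2).
Opaque Gamma rGamma hypergeom.

Local Notation a := (a1 + a2).

Lemma a_gt0 : 0 < a. Proof. exact: addr_gt0. Qed.

(** alpha_j + alpha_j', the parameter on which orthogonality depends. *)
Definition hahn_sum (j : 'I_d) : R := a + (tailsum k j.+1)%:R + (d - j.+1)%:R / 2.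

Lemma hahn_sum_gt0 j : 0 < hahn_sum j.
Proof. by rewrite /hahn_sum -addrA ltr_wpDr ?a_gt0// addr_ge0// divr_ge0. Qed.

Lemma hahn_sumC j : (hahn_sum j)%:C =
  a1%:C + a2%:C + (tailsum k j.+1)%:R + (d - j.+1)%:R / 2 :> C.
Proof. by rewrite /hahn_sum !rmorphD rmorphM fmorphV !rmorph_nat. Qed.

Lemma cintegral_x_factor (l : 'I_d -> nat) (j : 'I_d) :
  tailsum l j.+1 = tailsum k j.+1 ->
  cintegral mu setT (x_factor a1 a2 k l j) =
  (2 * pi * (rGamma (2 * hahn_re1 a1 k j) * rGamma (2 * hahn_re2 a2 k j) *
     rGamma (hahn_sum j) ^+ 2 / rGamma (2 * hahn_sum j)))%:C *
  ((k j == l j)%:R * ((k j)`!%:R * poch ((k j)%:R + 2 * (hahn_sum j)%:C - 1) (k j) /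
     poch (2 * (hahn_sum j)%:C) (k j + k j))).
Proof.
move=> lk.
have q1 : 0 < hahn_re1 a1 k j by rewrite /hahn_re1 -addrA ltr_wpDr// addr_ge0// divr_ge0.
have q2 : 0 < hahn_re2 a2 k j by rewrite /hahn_re2 -addrA ltr_wpDr// addr_ge0// divr_ge0.
have sE : hahn_sum j = hahn_re1 a1 k j + hahn_re2 a2 k j by rewrite /hahn_sum /hahn_re1 /hahn_re2; field.
rewrite -(cintegral_hahn (k j) (l j) q1 q2 sE).
rewrite /x_factor /= /hahn_re2 lk -/(hahn_re2 a2 k j) hahn_sumC.
have e1 : (2 * hahn_re1 a1 k j)%:C = (tailsum k j.+1)%:R + 2 * a1%:C + (d - j.+1)%:R / 2 :> C.
  by rewrite /hahn_re1 !(rmorphD, rmorphM, fmorphV, rmorph_nat)/=; field.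
have e2 : (2 * hahn_re2 a2 k j)%:C = (tailsum k j.+1)%:R + 2 * a2%:C + (d - j.+1)%:R / 2 :> C.
  by rewrite /hahn_re2 !(rmorphD, rmorphM, fmorphV, rmorph_nat)/=; field.
rewrite e1.
rewrite e2.
have -> : (k j)%:R + 2 * ((tailsum k j.+1)%:R + (a1%:C + a2%:C) + ((d - j.+1)%:R - 1) / 2) =
  (k j)%:R + 2 * (a1%:C + a2%:C + (tailsum k j.+1)%:R + (d - j.+1)%:R / 2) - 1 :> C by field.
have -> : (l j)%:R + 2 * ((tailsum k j.+1)%:R + (a2%:C + a1%:C) + ((d - j.+1)%:R - 1) / 2) =
  (l j)%:R + 2 * (a1%:C + a2%:C + (tailsum k j.+1)%:R + (d - j.+1)%:R / 2) - 1 :> C by field.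
have -> : (tailsum k j.+1)%:R + (a1%:C + a2%:C) + (d - j.+1)%:R / 2 =
  a1%:C + a2%:C + (tailsum k j.+1)%:R + (d - j.+1)%:R / 2 :> C by ring.
have -> : (tailsum k j.+1)%:R + (a2%:C + a1%:C) + (d - j.+1)%:R / 2 =
  a1%:C + a2%:C + (tailsum k j.+1)%:R + (d - j.+1)%:R / 2 :> C by ring.
by [].
Qed.

(** The sequences through which the products of the norms telescope. Splitting
    off the component k_j relates index j to index j.+1, since the tail sum and
    half the number of remaining variables change together. *)
Definition Gamma_step (i : nat) : C := (rGamma (a + (tailsum k i)%:R + (d - i)%:R / 2))%:C.
Definition poch_step (i : nat) : C := poch (a%:C + (d - i)%:R / 2 - 2^-1) (tailsum k i).

Lemma Gamma_step_neq0 i : Gamma_step i != 0.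
Proof.
rewrite /Gamma_step (inj_eq (@complexI R)) lt0r_neq0// rGamma_gt0//.
by rewrite -addrA ltr_wpDr ?a_gt0// addr_ge0// divr_ge0.
Qed.

Lemma poch_step_neq0 i : (i <= d)%N -> poch_step i != 0.
Proof.
rewrite leq_eqVlt => /predU1P[->|id]; first by rewrite /poch_step tailsum_last poch0 oner_eq0.
have -> : poch_step i = poch (a + (d - i.+1)%:R / 2)%:C (tailsum k i).
  rewrite /poch_step !(rmorphD, rmorphM, fmorphV, rmorph_nat)/=; congr poch.
  by rewrite -(subnSK id) -natr1; field.
by apply: poch_real_neq0; rewrite ltr_wpDr ?a_gt0// divr_ge0.
Qed.

(** The part of the j-th norm that does not telescope; it is common to the
    computed integral and to the closed formula. *)
Definition plain_factor (j : 'I_d) : C :=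
  (k j)`!%:R * (Gamma ((tailsum k j.+1)%:R + 2 * a1%:C + (d - j.+1)%:R / 2) *
    Gamma ((tailsum k j.+1)%:R + 2 * a2%:C + (d - j.+1)%:R / 2)) *
  poch ((hahn_sum j)%:C - 2^-1) (k j) /
  (2 ^+ (2 * tailsum k j.+1) * poch (norm_base k a%:C j) (k j)).

Lemma norm_baseE j : norm_base k a%:C j = 2 * (hahn_sum j)%:C - 1.
Proof. by rewrite /norm_base hahn_sumC rmorphD/=; field. Qed.

(** The Gamma quotient of hahn_norm_eval is a quotient of consecutive terms:
    s_j + k_j + 1 / 2 is the value at index j of the sequence whose value at
    index j.+1 is s_j. *)
Lemma x_factor_eval (j : 'I_d) : poch (norm_base k a%:C j) (k j) != 0 ->
  2 * cintegral mu setT (x_factor a1 a2 k k j) =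
  (2 * pi * Num.sqrt pi)%:C * (2 `^ (2 - 2 * a - (d - j.+1)%:R))%:C *
    (Gamma_step j.+1 / Gamma_step j) * plain_factor j.
Proof.
rewrite norm_baseE => p0.
rewrite cintegral_x_factor// eqxx mul1r.
have split4 (t u v w z : R) :
    (t * (u * v * w / z))%:C = t%:C * (u%:C * v%:C) * (w / z)%:C :> C.
  by rewrite -!rmorphM; congr (_%:C); rewrite !mulrA.
rewrite split4 -mulrA hahn_norm_eval ?hahn_sum_gt0//.
have q1 : 0 < 2 * hahn_re1 a1 k j.
  by rewrite mulr_gt0// /hahn_re1 -addrA ltr_wpDr// addr_ge0// divr_ge0.
have q2 : 0 < 2 * hahn_re2 a2 k j.
  by rewrite mulr_gt0// /hahn_re2 -addrA ltr_wpDr// addr_ge0// divr_ge0.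
have e1 : (2 * hahn_re1 a1 k j)%:C = (tailsum k j.+1)%:R + 2 * a1%:C + (d - j.+1)%:R / 2 :> C.
  by rewrite /hahn_re1 !(rmorphD, rmorphM, fmorphV, rmorph_nat)/=; field.
have e2 : (2 * hahn_re2 a2 k j)%:C = (tailsum k j.+1)%:R + 2 * a2%:C + (d - j.+1)%:R / 2 :> C.
  by rewrite /hahn_re2 !(rmorphD, rmorphM, fmorphV, rmorph_nat)/=; field.
rewrite -(Gamma_real q1) -(Gamma_real q2) e1 e2 /plain_factor norm_baseE.
have -> : (rGamma (hahn_sum j))%:C = Gamma_step j.+1 by [].
have -> : (rGamma (hahn_sum j + (k j)%:R + 2^-1))%:C = Gamma_step j.
  rewrite /Gamma_step /hahn_sum (tailsumS k j) natrD -(subnSK (ltn_ord j)) -[(d - j.+1).+1%:R]natr1.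
  by congr (rGamma _)%:C; field.
have -> : (2 `^ (1 - 2 * hahn_sum j) * Num.sqrt pi)%:C =
   2^-1 * (2 `^ (2 - 2 * a - (d - j.+1)%:R))%:C / 2 ^+ (2 * tailsum k j.+1) * (Num.sqrt pi)%:C :> C.
  have -> : 2 `^ (1 - 2 * hahn_sum j) = 2^-1 * 2 `^ (2 - 2 * a - (d - j.+1)%:R) / 2 ^+ (2 * tailsum k j.+1) :> R.
    have -> : 1 - 2 * hahn_sum j = 2 - 2 * a - (d - j.+1)%:R - 1 - (2 * tailsum k j.+1)%:R.
      by rewrite /hahn_sum natrM; field.
    rewrite powRB ?pnatr_eq0 ?implybT// powRB ?pnatr_eq0 ?implybT//.
    by rewrite powR_mulrn// powRr1// [2^-1 * _]mulrC.
  by rewrite !(rmorphM, fmorphV, rmorphXn, rmorph_nat).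
rewrite !rmorphM/= rmorph_nat.
have t0 : 2 ^+ (2 * tailsum k j.+1) != 0 :> C by rewrite expf_neq0// pnatr_eq0.
have f0 := Gamma_step_neq0 j.
move: p0 t0 f0.
move: (poch (2 * (hahn_sum j)%:C - 1) (k j)) (2 ^+ (2 * tailsum k j.+1) : C) (Gamma_step j) (Gamma_step j.+1).
move: (poch _ _) (Gamma _) (Gamma _) (2 `^ _)%:C (Num.sqrt pi)%:C pi%:C ((k j)`!%:R : C).
by move=> u1 u2 u3 u4 u5 u6 u7 v1 v2 v3 v4 w1 w2 w3; field; rewrite w1 w2 w3.
Qed.

Lemma norm_factor_eval (j : 'I_d) : poch (norm_base k a%:C j) (k j) != 0 ->
  (poch (a%:C - 2^-1 + (d - j.+1)%:R / 2) (tailsum k j) *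
     poch (2 * (a%:C - 2^-1) + 2 * (tailsum k j.+1)%:R + (d - j.+1)%:R) (k j) /
     ((k j)`!%:R * poch (a%:C - 2^-1 + (d - j.+1).+1%:R / 2) (tailsum k j))) *
  ((k j)`!%:R ^+ 2 *
     Gamma ((tailsum k j.+1)%:R + 2 * a1%:C + (d - j.+1)%:R / 2) *
     Gamma ((tailsum k j.+1)%:R + 2 * a2%:C + (d - j.+1)%:R / 2) /
     (2 ^+ (2 * tailsum k j.+1) * poch (norm_base k a%:C j) (k j) ^+ 2) *
     (k j == k j)%:R) = poch_step j.+1 / poch_step j * plain_factor j.
Proof.
move=> p0; rewrite eqxx mulr1.
have -> : poch (a%:C - 2^-1 + (d - j.+1).+1%:R / 2) (tailsum k j) = poch_step j.
  by rewrite /poch_step (subnSK (ltn_ord j)) addrAC.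
have -> : poch (a%:C - 2^-1 + (d - j.+1)%:R / 2) (tailsum k j) =
    poch_step j.+1 * poch ((hahn_sum j)%:C - 2^-1) (k j).
  rewrite (tailsumS k j) addnC poch_add /poch_step addrAC; congr (_ * poch _ _).
  by rewrite hahn_sumC rmorphD/=; ring.
have -> : 2 * (a%:C - 2^-1) + 2 * (tailsum k j.+1)%:R + (d - j.+1)%:R = norm_base k a%:C j.
  by rewrite /norm_base; field.
have f0 : (k j)`!%:R != 0 :> C by rewrite pnatr_eq0 -lt0n fact_gt0.
have t0 : 2 ^+ (2 * tailsum k j.+1) != 0 :> C by rewrite expf_neq0// pnatr_eq0.
have P0 := poch_step_neq0 (ltnW (ltn_ord j)).
rewrite /plain_factor; move: p0 t0 f0 P0.
move: (poch (norm_base k a%:C j) (k j)) (2 ^+ (2 * tailsum k j.+1) : C) (poch_step j) (poch_step j.+1).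
move: (poch _ _) (Gamma _) (Gamma _) ((k j)`!%:R : C).
by move=> u1 u2 u3 u4 v1 v2 v3 v4 w1 w2 w3 w4; field; rewrite w1 w2 w3 w4.
Qed.

End evaluation.

(** * The orthogonality relation *)

Section value.
Context {R : realType}.
Notation mu := (@lebesgue_measure R).
Local Notation mR := (measurableTypeR R).
Local Notation C := R[i].
Opaque Gamma rGamma hypergeom.

Lemma sqrt_pi_prod (d : nat) : (Num.sqrt pi : R) ^+ d = pi `^ (d%:R / 2).
Proof.
rewrite -powR12_sqrt ?pi_ge0// -powR_mulrn ?powR_ge0// -powRrM.
by congr (_ `^ _); rewrite mulrC.
Qed.

(** The factors 2 come from the substitutions u = x_j / 2. *)
Lemma value_factors (d : nat) (a1 a2 b1 b2 : R) (k l : 'I_d -> nat) (n m : nat)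
    (ha1 : 0 < a1) (ha2 : 0 < a2) (hb1 : 0 < b1) (hb2 : 0 < b2)
    (hn : (wt k <= n)%N) (hm : (wt l <= m)%N) :
  let lambda := (lebesgue_line \x lebesgue_tuple R d)%E in
  let f := integrand n m k l a1%:C a2%:C b1%:C b2%:C in
  cintegrable lambda setT f /\
  cintegral lambda setT f = cintegral mu setT (t_factor b1 b2 k l n m) *
    \prod_(j < d) (2 * cintegral mu setT (x_factor a1 a2 k l j)).
Proof.
move=> lambda f.
have fE := integrandE a1 a2 b1 b2 hn hm.
have mi : cintegrable mu setT (t_factor b1 b2 k l n m) by exact: cintegrable_meixner.
have q1 j : 0 < hahn_re1 a1 k j by rewrite /hahn_re1 -addrA ltr_wpDr// addr_ge0// divr_ge0.
have q2 j : 0 < hahn_re2 a2 l j by rewrite /hahn_re2 -addrA ltr_wpDr// addr_ge0// divr_ge0.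
have hi j : cintegrable mu setT (x_factor a1 a2 k l j) by exact: cintegrable_hahn.
have hi2 j : cintegrable mu setT (fun x => x_factor a1 a2 k l j (x / 2)).
  by have [] := cintegrable_half (hi j).
have [ti te] := cintegral_prod_tuple (g := fun j x => x_factor a1 a2 k l j (x / 2)) hi2.
rewrite /f fE; split.
  exact: (@cintegrable_tensor _ _ _ _ _ lebesgue_line (lebesgue_tuple R d) _ _ mi ti).
rewrite [LHS](@cintegral_tensor _ _ _ _ _ lebesgue_line (lebesgue_tuple R d) _ _ mi ti).
rewrite te; congr (_ * _); apply: eq_bigr => j _.
by have [_ ->] := cintegrable_half (hi j).
Qed.

Lemma cintegral_t_factor (d : nat) (b1 b2 : R) (k : 'I_d -> nat) (n m : nat) :
  0 < b1 -> 0 < b2 -> (wt k <= n)%N -> (wt k <= m)%N ->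
  cintegral mu setT (t_factor b1 b2 k k n m) =
  (2 * pi * (2 `^ (- (b1 + b2 + 2 * (wt k)%:R))))%:C *
    (rGamma (b1 + b2 + 2 * (wt k)%:R))%:C *
    ((n == m)%:R * ((n - wt k)`!%:R /
       poch (b1 + b2 + 2 * (wt k)%:R)%:C (n - wt k))).
Proof.
move=> b10 b20 kn km.
have -> : (n == m) = (n - wt k == m - wt k)%N by rewrite -[RHS](eqn_add2r (wt k)) !subnK.
rewrite -(cintegral_meixner (n - wt k) (m - wt k) b10 b20 (erefl _)); congr (cintegral mu setT _).
have e : (b1 + b2 + 2 * (wt k)%:R)%:C = 2 * (wt k)%:R + (b1%:C + b2%:C) :> C.
  by rewrite !(rmorphD, rmorphM, rmorph_nat)/= addrC.
by rewrite /t_factor e; apply/funext => t; rewrite [b2%:C + _]addrC.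
Qed.

(** If k and l differ, then at the last index where they do, the orders of the
    two Hahn polynomials differ while their parameters agree. *)
Lemma prod_cintegral_x_factor0 (d : nat) (a1 a2 : R) (k l : 'I_d -> nat) :
  0 < a1 -> 0 < a2 -> ~ (k =1 l) ->
  \prod_(j < d) (2 * cintegral mu setT (x_factor a1 a2 k l j)) = 0.
Proof.
move=> a10 a20 kl.
have [j0 kl0] : exists j, k j != l j.
  apply: contrapT => /forallNP H; apply: kl => j.
  by apply/eqP; apply: contrapT => /negP; exact: H.
case: (@arg_maxnP _ j0 (fun j => k j != l j) (fun j => nat_of_ord j) kl0) => j klj jmax.
have lk : tailsum l j.+1 = tailsum k j.+1.
  apply: eq_bigr => i ji; apply/eqP; apply: contraT; rewrite eq_sym => kli.
  by have /= := jmax i kli; rewrite /geq/= leqNgt ji.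
apply/eqP/prodf_eq0; exists j; first by [].
by rewrite (cintegral_x_factor a10 a20 lk) (negbTE klj) mul0r !mulr0.
Qed.

End value.

Unset Implicit Arguments.

Theorem theorem3p3 (R : realType) (d : nat) (a1 a2 b1 b2 : R)
    (k l : 'I_d -> nat) (n m : nat)
    (hd : (1 <= d)%N)
    (ha1 : 0 < a1) (ha2 : 0 < a2) (hb1 : 0 < b1) (hb2 : 0 < b2)
    (hn : (wt k <= n)%N) (hm : (wt l <= m)%N) :
  let lambda := (lebesgue_line \x lebesgue_tuple R d)%E in
  let f := integrand n m k l a1%:C a2%:C b1%:C b2%:C in
  let a : R[i] := (a1 + a2)%:C in
  let b : R[i] := (b1 + b2)%:C in
  [/\ forall (t : R[i]) (x : 'I_d -> R[i]),
        Afun n k t x a1%:C a2%:C b1%:C b2%:C =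
        Afun_hahn n k t x a1%:C a2%:C b1%:C b2%:C,
      cintegrable lambda setT f &
      (n = m -> k =1 l -> forall j, poch (norm_base k a j) (k j) != 0) ->
      cintegral lambda setT f =
      (2 * pi : R)%:C ^+ d.+1 *
      (2 `^ exponent2 d (wt k) (a1 + a2) (b1 + b2) : R)%:C *
      ball_norm k (a - 2^-1) *
      (Gamma (b + n%:R + (wt k)%:R) * (n - wt k)`!%:R /
         poch (2 * (wt k)%:R + b) (n - wt k) ^+ 2) *
      (n == m)%:R *
      \prod_(j < d)
        ((k j)`!%:R ^+ 2 *
         Gamma ((tailsum k j.+1)%:R + 2 * a1%:C + (d - j.+1)%:R / 2) *
         Gamma ((tailsum k j.+1)%:R + 2 * a2%:C + (d - j.+1)%:R / 2) /
         (2 ^+ (2 * tailsum k j.+1) * poch (norm_base k a j) (k j) ^+ 2) *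
         (k j == l j)%:R)].
Proof.
move=> lambda f a b.
have [fi fv] := value_factors ha1 ha2 hb1 hb2 hn hm.
split; [by move=> t x; exact: Afun_hahnE|exact: fi|move=> nd; rewrite /lambda /f fv].
(* One of the Kronecker symbols on the right vanishes with the integral. *)
have [kl|kl] := pselect (k =1 l); last first.
  rewrite prod_cintegral_x_factor0// mulr0.
  have [j kj] : exists j, k j != l j.
    apply: contrapT => /forallNP H; apply: kl => j.
    by apply/eqP; apply: contrapT => /negP; exact: H.
  by rewrite [X in _ * X](bigD1 j)//= (negbTE kj) mulr0 mul0r mulr0.
have El : l = k by apply/funext => j; rewrite kl.
rewrite El in fv hm nd *.
rewrite cintegral_t_factor//.
have [nm|nm] := eqVneq n m; last by rewrite !(mul0r, mulr0).
have {}nd j : poch (norm_base k a j) (k j) != 0 by exact: nd.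
have ha : 0 < a1 + a2 by exact: addr_gt0.
have hb : 0 < b1 + b2 by exact: addr_gt0.
rewrite (eq_bigr (fun j : 'I_d => (2 * pi * Num.sqrt pi)%:C *
    (2 `^ (2 - 2 * (a1 + a2) - (d - j.+1)%:R))%:C *
    (Gamma_step a1 a2 k j.+1 / Gamma_step a1 a2 k j) * plain_factor a1 a2 k j)); last first.
  by move=> j _; exact: x_factor_eval.
rewrite 3!big_split/= (prod_telescope (f := Gamma_step a1 a2 k)); last first.
  by move=> i _; exact: Gamma_step_neq0.
rewrite prodr_const card_ord -rmorph_prod prod_powR2 -rmorphXn/=.
rewrite /ball_norm.
have normE : \prod_(j < d)
    (poch (a - 2^-1 + (d - j.+1)%:R / 2) (tailsum k j) *
     poch (2 * (a - 2^-1) + 2 * (tailsum k j.+1)%:R + (d - j.+1)%:R) (k j) /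
     ((k j)`!%:R * poch (a - 2^-1 + (d - j.+1).+1%:R / 2) (tailsum k j))) *
    \prod_(j < d)
        ((k j)`!%:R ^+ 2 *
         Gamma ((tailsum k j.+1)%:R + 2 * a1%:C + (d - j.+1)%:R / 2) *
         Gamma ((tailsum k j.+1)%:R + 2 * a2%:C + (d - j.+1)%:R / 2) /
         (2 ^+ (2 * tailsum k j.+1) * poch (norm_base k a j) (k j) ^+ 2) *
         (k j == k j)%:R) =
    poch_step a1 a2 k d / poch_step a1 a2 k 0 * \prod_(j < d) plain_factor a1 a2 k j.
  rewrite -big_split/= -(prod_telescope (f := poch_step a1 a2 k)); last first.
    by move=> i; exact: poch_step_neq0.
  by rewrite -big_split/=; apply: eq_bigr => j _; exact: norm_factor_eval.
have regroup (x1 x2 x3 x4 x5 x6 x7 : R[i]) :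
  x1 * x2 * (x3 * x4) * x5 * x6 * x7 = x1 * x2 * x3 * x5 * x6 * (x4 * x7) by ring.
rewrite regroup normE.
set B := b1 + b2 + 2 * (wt k)%:R; set N := (n - wt k)%N.
have B0 : 0 < B by rewrite /B ltr_wpDr// mulr_ge0.
have BC : 2 * (wt k)%:R + b = B%:C.
  by rewrite /B /b !(rmorphD, rmorphM, rmorph_nat)/= addrC.
have GB : Gamma (b + n%:R + (wt k)%:R) = (rGamma B)%:C * poch B%:C N.
  have BN0 : 0 < B + N%:R by exact: (ltr_wpDr (ler0n _ _) B0).
  rewrite -(rGamma_shift N B0) -(Gamma_real BN0).
  apply: f_equal.
  rewrite (_ : (B + N%:R)%:C = B%:C + N%:R); last by rewrite rmorphD rmorph_nat.
  rewrite -BC /N natrB//; ring.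
have Ga : Gamma (a - 2^-1 + 2^-1) = Gamma_step a1 a2 k d.
  by rewrite subrK Gamma_real// /Gamma_step tailsum_last subnn mul0r !addr0.
have Pa : poch (a - 2^-1 + d%:R / 2) (wt k) = poch_step a1 a2 k 0.
  by rewrite /poch_step subn0 addrAC.
have Gd : Gamma (a - 2^-1 + d.+1%:R / 2 + (wt k)%:R) = Gamma_step a1 a2 k 0.
  rewrite /Gamma_step subn0 -Gamma_real; last by rewrite -addrA ltr_wpDr// addr_ge0// divr_ge0.
  congr Gamma; rewrite !(rmorphD, rmorphM, fmorphV, rmorph_nat)/= -natr1.
  by rewrite /a rmorphD/=; field.
have Pd : poch_step a1 a2 k d = 1 by rewrite /poch_step tailsum_last poch0.
have e2 : 2 `^ exponent2 d (wt k) (a1 + a2) (b1 + b2) =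
    2 `^ (2 * d%:R - 2 * d%:R * (a1 + a2) - 'C(d, 2)%:R) * 2 `^ (- B).
  by rewrite exponent2E// powRD ?pnatr_eq0 ?implybT.
have e3 : (2 * pi * Num.sqrt pi) ^+ d = (2 * pi) ^+ d * pi `^ (d%:R / 2) :> R.
  by rewrite exprMn sqrt_pi_prod.
have e4 : (2 * pi * 2 `^ (- B))%:C = (2 * pi)%:C * (2 `^ (- B))%:C :> R[i].
  by rewrite rmorphM.
have e5 : (2 * pi)%:C = 2%:C * pi%:C :> R[i] by rewrite rmorphM.
rewrite GB Ga Pa Gd Pd BC e2 e3 e4 !rmorphM/= exprS rmorphXn/= e5.
have PN := poch_real_neq0 N B0.
have f0 := Gamma_step_neq0 k ha1 ha2 0.
have P0 := poch_step_neq0 k ha1 ha2 (leq0n d).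
(* What remains is an identity of rational expressions in these quantities. *)
move: PN f0 P0.
move: (poch B%:C N) (Gamma_step a1 a2 k 0) (Gamma_step a1 a2 k d) (poch_step a1 a2 k 0).
move: (\prod_(j < d) plain_factor a1 a2 k j) (rGamma B)%:C (2 `^ (- B))%:C (pi `^ (d%:R / 2))%:C.
move: (2 `^ _)%:C (N`!%:R : R[i]) (2%:C * pi%:C).
move=> u1 u2 u3 v1 v2 v3 v4 w1 w2 w3 w4 h1 h2 h3.
by field; rewrite h1 h2 h3.
Qed.
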